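(* Let $l$ be an integer greater than $1$, let $G=\pi_1(\Sigma_l)$ be the fundamental group of the closed orientable surface $\Sigma_l$ of genus $l$, and let $N=[\pi_1(\Sigma_l),\pi_1(\Sigma_l)]$ be its commutator subgroup, with inclusion $i\colon N\hookrightarrow G$. Then \[ \dim\big(\mathrm{Q}(N)^G/i^*\mathrm{Q}(G)\big)=l(2l-1)\quad\text{and}\quad \dim\big(\mathrm{Q}(N)^G/(\mathrm{H}^1(N)^G+i^*\mathrm{Q}(G))\big)=1. \]
   Context: A quasimorphism on a group $G$ is a function $f\colon G\to\mathbb{R}$ with $\sup_{x,y\in G}|f(xy)-f(x)-f(y)|<\infty$; it is homogeneous if $f(x^n)=n f(x)$ for all $x\in G$, $n\in\mathbb{Z}$. $\mathrm{Q}(G)$ is the real vector space of homogeneous quasimorphisms on $G$. For a normal subgroup $N$ of $G$ with inclusion $i\colon N\hookrightarrow G$: $\mathrm{Q}(N)^G$ is the space of $f\in\mathrm{Q}(N)$ with $f(gxg^{-1})=f(x)$ for all $g\in G$, $x\in N$; $\mathrm{H}^1(N)^G$ is the subspace of $G$-invariant homomorphisms $N\to\mathbb{R}$; $i^*\mathrm{Q}(G)$ is the space of restrictions to $N$ of elements of $\mathrm{Q}(G)$ (contained in $\mathrm{Q}(N)^G$, since homogeneous quasimorphisms are conjugation invariant). Dimensions are over $\mathbb{R}$. *)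

(* Defs.v *)
From HB Require Import structures.
From Stdlib Require Relations.
From mathcomp Require Import all_boot all_order all_algebra generic_quotient.
From mathcomp Require Import all_classical all_reals all_analysis.
From mathcomp Require Import homotopy.
From mathcomp Require Import lra.

Set Implicit Arguments.
Unset Strict Implicit.
Unset Printing Implicit Defensive.

Import Order.TTheory GRing.Theory Num.Theory.
Import numFieldNormedType.Exports.

Local Open Scope classical_set_scope.
Local Open Scope quotient_scope.
Local Open Scope ring_scope.

(** * The fundamental group *)

Section UnitInterval.
Context (R : realType).

Definition unit_interval : set R := `[0, 1]%classic.

Lemma unit_interval0 : 0 \in unit_interval.
Proof. by rewrite inE /unit_interval /= in_itv /= lexx ler01. Qed.

Lemma unit_interval1 : 1 \in unit_interval.
Proof. by rewrite inE /unit_interval /= in_itv /= lexx ler01. Qed.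

Let zero01 : unit_interval := exist _ 0 unit_interval0.
Let one01 : unit_interval := exist _ 1 unit_interval1.

Lemma unit_interval_zero_neq_one : zero01 != one01.
Proof. by apply/eqP => /(congr1 val) /= /eqP; rewrite eq_sym oner_eq0. Qed.

HB.instance Definition _ :=
  isBiPointed.Build (set_type unit_interval) unit_interval_zero_neq_one.

End UnitInterval.

Notation I01 R := (set_type (@unit_interval R)).

Section UnitIntervalTheory.
Context (R : realType).
Local Notation I := (I01 R).

Lemma val_zero01 : val (zero : I) = 0. Proof. by []. Qed.
Lemma val_one01 : val (one : I) = 1. Proof. by []. Qed.

Lemma I01_bound (t : I) : 0 <= val t <= 1.
Proof. by have := valP t; rewrite inE /unit_interval /= in_itv. Qed.

Lemma val01_continuous : continuous (val : I -> R).
Proof. exact: initial_continuous. Qed.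

(* The retraction of the line onto the unit interval. *)
Lemma clamp_subproof (r : R) : Num.max 0 (Num.min r 1) \in @unit_interval R.
Proof.
by rewrite inE /unit_interval /= in_itv /= le_max lexx /= ge_max ler01 ge_min lexx orbT.
Qed.

Definition clamp (r : R) : I :=
  exist (fun x => x \in @unit_interval R) _ (clamp_subproof r).

Lemma clamp_continuous : continuous clamp.
Proof.
apply: continuous_comp_initial => r.
apply: (@continuous_max R R (cst 0) (fun r => Num.min r 1)).
  exact: cvg_cst.
by apply: (@continuous_min R R id (cst 1)); [exact: cvg_id|exact: cvg_cst].
Qed.

Lemma val_clamp (r : R) : 0 <= r <= 1 -> val (clamp r) = r.
Proof. by move=> /andP[r0 r1] /=; rewrite (min_idPl r1) (max_idPr r0). Qed.

Lemma clamp_val (t : I) : clamp (val t) = t.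
Proof. by apply: val_inj; rewrite val_clamp ?I01_bound. Qed.

Lemma clamp_le0 (r : R) : r <= 0 -> clamp r = zero.
Proof.
move=> r0; apply: val_inj; rewrite val_zero01 /=.
by rewrite (min_idPl (le_trans r0 ler01)) (max_idPl r0).
Qed.

Lemma clamp_ge1 (r : R) : 1 <= r -> clamp r = one.
Proof.
by move=> r1; apply: val_inj; rewrite val_one01 /= (min_idPr r1) (max_idPr ler01).
Qed.

End UnitIntervalTheory.

Section RealContinuity.
Context (R : realType) (Z : topologicalType).
Implicit Types h k : Z -> R.

Lemma continuousDr h k :
  continuous h -> continuous k -> continuous (fun z => h z + k z).
Proof. by move=> ch ck z; apply: (cvgD (ch z) (ck z)). Qed.

Lemma continuousMr h k :
  continuous h -> continuous k -> continuous (fun z => h z * k z).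
Proof. by move=> ch ck z; apply: (cvgM (ch z) (ck z)). Qed.

Lemma continuous_mull (c : R) h : continuous h -> continuous (fun z => c * h z).
Proof. by move=> ch; apply: continuousMr => // z; exact: cvg_cst. Qed.

Lemma continuous_subr (c : R) h : continuous h -> continuous (fun z => h z - c).
Proof. by move=> ch; apply: continuousDr => // z; exact: cvg_cst. Qed.

Lemma continuous_subl (c : R) h : continuous h -> continuous (fun z => c - h z).
Proof.
move=> ch; apply: continuousDr; first by move=> z; exact: cvg_cst.
by move=> z; exact: (cvgN (ch z)).
Qed.

End RealContinuity.

Lemma pair_continuous (Z A B : topologicalType) (f : Z -> A) (g : Z -> B) :
  continuous f -> continuous g -> continuous (fun z => (f z, g z)).
Proof. by move=> cf cg z; exact: (cvg_pair (cf z) (cg z)). Qed.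

Lemma fst_continuous (A B : topologicalType) : continuous (fst : A * B -> A).
Proof. by move=> z; exact: cvg_fst. Qed.

Lemma snd_continuous (A B : topologicalType) : continuous (snd : A * B -> B).
Proof. by move=> z; exact: cvg_snd. Qed.

Section Pasting.
Context (R : realType) (Z X : topologicalType).

Lemma paste_continuous (h : Z -> R) (c : R) (f g : Z -> X) :
  continuous h -> continuous f -> continuous g ->
  (forall z, h z = c -> f z = g z) ->
  continuous (fun z => if h z <= c then f z else g z).
Proof.
move=> ch cf cg fg.
set k := fun z => _; apply/continuous_subspace_setT.
have -> : [set: Z] = (h @^-1` [set r | r <= c]) `|` (h @^-1` [set r | c <= r]).
  by apply/seteqP; split => // z _ /=; apply/orP; exact: le_total.
apply: withinU_continuous.
- by apply: preimage_closed => // z _; exact: ch.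
- by apply: preimage_closed => // z _; exact: ch.
- apply: (@subspace_eq_continuous Z (h @^-1` [set r | r <= c]) X
    (from_subspace (h @^-1` [set r | r <= c]) f)).
    move=> z; rewrite inE /= /k => zc; by rewrite /from_subspace /= zc.
  exact: continuous_subspaceT cf.
- apply: (@subspace_eq_continuous Z (h @^-1` [set r | c <= r]) X
    (from_subspace (h @^-1` [set r | c <= r]) g)).
    move=> z; rewrite inE /= /k => cz; rewrite /from_subspace /=; case: ifPn => // zc; symmetry.
    by apply: fg; apply/eqP; rewrite eq_le zc cz.
  exact: continuous_subspaceT cg.
Qed.

End Pasting.

Section Paths.
Context (R : realType) (X : topologicalType).
Local Notation I := (I01 R).

(* Homotopy of paths relative to the endpoints. *)
Definition path_homotopic (x y : X) (p q : {path I from x to y}) : Prop :=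
  exists H : I * I -> X,
    [/\ continuous H,
        forall t, H (zero, t) = p t,
        forall t, H (one, t) = q t,
        forall s, H (s, zero) = x &
        forall s, H (s, one) = y].

(* The argument of each clamp is in the unit interval on its branch. *)
Definition path_concat_fun (p q : I -> X) (t : I) : X :=
  if val t <= 2^-1 then p (clamp (2 * val t)) else q (clamp (2 * val t - 1)).

Definition path_reverse_fun (p : I -> X) (t : I) : X := p (clamp (1 - val t)).

Lemma clamp_comp_continuous (Z Y : topologicalType) (k : I -> Y) (a : Z -> R) :
  continuous k -> continuous a -> continuous (fun z => k (clamp (a z))).
Proof.
move=> ck ca z; apply: (continuous_comp (f := fun z => clamp (a z))); last exact: ck.
by apply: continuous_comp; [exact: ca|exact: clamp_continuous].
Qed.

Section Concat.
Context (x y z : X) (p : {path I from x to y}) (q : {path I from y to z}).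

Lemma path_concat_continuous : continuous (path_concat_fun p q).
Proof.
apply: (@paste_continuous R I X (fun t : I => val t) 2^-1
  (fun t => p (clamp (2 * val t))) (fun t => q (clamp (2 * val t - 1)))).
- exact: val01_continuous.
- apply: clamp_comp_continuous; first exact: cts_fun.
  exact/continuous_mull/val01_continuous.
- apply: clamp_comp_continuous; first exact: cts_fun.
  exact/continuous_subr/continuous_mull/val01_continuous.
- move=> t ->; rewrite clamp_ge1 ?clamp_le0 ?path_one ?path_zero //.
  + by rewrite divff ?subrr // pnatr_eq0.
  + by rewrite divff // pnatr_eq0.
Qed.

Lemma path_concat_zero : path_concat_fun p q zero = x.
Proof.
by rewrite /path_concat_fun val_zero01 invr_ge0 ler0n mulr0 clamp_le0 ?path_zero.
Qed.

Lemma path_concat_one : path_concat_fun p q one = z.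
Proof.
rewrite /path_concat_fun val_one01 ifF; last by apply/negbTE; lra.
by rewrite clamp_ge1 ?path_one //; lra.
Qed.

HB.instance Definition _ :=
  isContinuous.Build I X (path_concat_fun p q) path_concat_continuous.
HB.instance Definition _ :=
  @isPath.Build I X x z (path_concat_fun p q) path_concat_zero path_concat_one.

Definition path_concat : {path I from x to z} := path_concat_fun p q.

End Concat.

Section Reverse.
Context (x y : X) (p : {path I from x to y}).

Lemma path_reverse_continuous : continuous (path_reverse_fun p).
Proof.
apply: clamp_comp_continuous; first exact: cts_fun.
exact/continuous_subl/val01_continuous.
Qed.

Lemma path_reverse_zero : path_reverse_fun p zero = y.
Proof. by rewrite /path_reverse_fun val_zero01 subr0 clamp_ge1 ?path_one. Qed.

Lemma path_reverse_one : path_reverse_fun p one = x.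
Proof. by rewrite /path_reverse_fun val_one01 subrr clamp_le0 ?path_zero. Qed.

HB.instance Definition _ :=
  isContinuous.Build I X (path_reverse_fun p) path_reverse_continuous.
HB.instance Definition _ :=
  @isPath.Build I X y x (path_reverse_fun p) path_reverse_zero path_reverse_one.

Definition path_reverse : {path I from y to x} := path_reverse_fun p.

End Reverse.

Section Homotopy.
Context (x y : X).
Implicit Types p q r : {path I from x to y}.

(* Both sides are compositions of [f] with maps from the interval to itself
   that agree at the endpoints. *)
Lemma reparam_homotopic (x' y' : X) (f : {path I from x' to y'}) p q
    (phi psi : R -> R) :
  continuous phi -> continuous psi -> phi 0 = psi 0 -> phi 1 = psi 1 ->
  (forall t : I, p t = f (clamp (phi (val t)))) ->
  (forall t : I, q t = f (clamp (psi (val t)))) ->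
  path_homotopic p q.
Proof.
move=> cphi cpsi e0 e1 pE qE.
exists (fun st => f (clamp ((1 - val st.1) * phi (val st.2) +
                            val st.1 * psi (val st.2)))); split.
- have c1 : continuous (fun st : I * I => val st.1 : R).
    by move=> st; apply: (continuous_comp (f := fst));
      [exact: fst_continuous|exact: val01_continuous].
  have c2 (a : R -> R) : continuous a ->
      continuous (fun st : I * I => a (val st.2) : R).
    move=> ca st; apply: (continuous_comp (f := fun st : I * I => val st.2 : R));
      last exact: ca.
    by apply: (continuous_comp (f := snd));
      [exact: snd_continuous|exact: val01_continuous].
  apply: clamp_comp_continuous; first exact: cts_fun.
  apply: continuousDr; apply: continuousMr; [|exact: c2|exact: c1|exact: c2].
  exact: continuous_subl.
- by move=> t; rewrite /= subr0 mul1r mul0r addr0 -pE.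
- by move=> t; rewrite /= subrr mul1r mul0r add0r -qE.
- move=> s; rewrite /= -e0 -mulrDl subrK mul1r -[RHS](path_zero (s := p)) pE.
  by rewrite val_zero01.
- move=> s; rewrite /= -e1 -mulrDl subrK mul1r -[RHS](path_one (s := p)) pE.
  by rewrite val_one01.
Qed.

Lemma path_homotopic_refl p : path_homotopic p p.
Proof.
by apply: (@reparam_homotopic _ _ p p p id id) => // t; try exact: cvg_id;
  rewrite clamp_val.
Qed.

Lemma path_homotopic_sym p q : path_homotopic p q -> path_homotopic q p.
Proof.
move=> [H [cH H0 H1 Hx Hy]].
exists (fun st => H (clamp (1 - val st.1), st.2)); split.
- move=> st; apply: (continuous_comp
    (f := fun st : I * I => (clamp (1 - val st.1), st.2))); last exact: cH.
  apply: pair_continuous; last exact: snd_continuous.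
  apply: (@clamp_comp_continuous _ _ id (fun st : I * I => 1 - val st.1)).
    by move=> ?; exact: cvg_id.
  apply: continuous_subl => z.
  by apply: (continuous_comp (f := fst));
    [exact: fst_continuous|exact: val01_continuous].
- by move=> t; rewrite /= subr0 clamp_ge1.
- by move=> t; rewrite /= subrr clamp_le0.
- by move=> s; rewrite /= Hx.
- by move=> s; rewrite /= Hy.
Qed.

Lemma path_homotopic_trans p q r :
  path_homotopic p q -> path_homotopic q r -> path_homotopic p r.
Proof.
move=> [H [cH H0 H1 Hx Hy]] [K [cK K0 K1 Kx Ky]].
have c1 : continuous (fun st : I * I => val st.1 : R).
  by move=> st; apply: (continuous_comp (f := fst));
    [exact: fst_continuous|exact: val01_continuous].
have cc (L : I * I -> X) (a : I * I -> R) : continuous L -> continuous a ->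
    continuous (fun st : I * I => L (clamp (a st), st.2)).
  move=> cL ca st; apply: (continuous_comp
    (f := fun st : I * I => (clamp (a st), st.2))); last exact: cL.
  apply: pair_continuous; last exact: snd_continuous.
  apply: (@clamp_comp_continuous _ _ id a) => //.
  by move=> ?; exact: cvg_id.
exists (fun st => if val st.1 <= 2^-1 then H (clamp (2 * val st.1), st.2)
                  else K (clamp (2 * val st.1 - 1), st.2)); split.
- apply: (@paste_continuous R _ X (fun st : I * I => val st.1) 2^-1
    (fun st : I * I => H (clamp (2 * val st.1), st.2))
    (fun st : I * I => K (clamp (2 * val st.1 - 1), st.2))).
  + exact: c1.
  + by apply: cc => //; exact/continuous_mull.
  + by apply: cc => //; exact/continuous_subr/continuous_mull.
  + move=> st ->; rewrite clamp_ge1; last by lra.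
    by rewrite clamp_le0 ?H1 ?K0 //; lra.
- by move=> t; rewrite val_zero01 invr_ge0 ler0n mulr0 clamp_le0.
- move=> t; rewrite val_one01 ifF; last by apply/negbTE; lra.
  by rewrite clamp_ge1 ?K1 //; lra.
- by move=> s; case: ifP; rewrite ?Hx ?Kx.
- by move=> s; case: ifP; rewrite ?Hy ?Ky.
Qed.

End Homotopy.

Lemma path_concat_homotopic (x y z : X) (p p' : {path I from x to y})
    (q q' : {path I from y to z}) :
  path_homotopic p p' -> path_homotopic q q' ->
  path_homotopic (path_concat p q) (path_concat p' q').
Proof.
move=> [H [cH H0 H1 Hx Hy]] [K [cK K0 K1 Kx Ky]].
have c2 : continuous (fun st : I * I => val st.2 : R).
  by move=> st; apply: (continuous_comp (f := snd));
    [exact: snd_continuous|exact: val01_continuous].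
have cc (L : I * I -> X) (a : I * I -> R) : continuous L -> continuous a ->
    continuous (fun st : I * I => L (st.1, clamp (a st))).
  move=> cL ca st; apply: (continuous_comp
    (f := fun st : I * I => (st.1, clamp (a st)))); last exact: cL.
  apply: pair_continuous; first exact: fst_continuous.
  apply: (@clamp_comp_continuous _ _ id a) => //.
  by move=> ?; exact: cvg_id.
exists (fun st => if val st.2 <= 2^-1 then H (st.1, clamp (2 * val st.2))
                  else K (st.1, clamp (2 * val st.2 - 1))); split.
- apply: (@paste_continuous R _ X (fun st : I * I => val st.2) 2^-1
    (fun st : I * I => H (st.1, clamp (2 * val st.2)))
    (fun st : I * I => K (st.1, clamp (2 * val st.2 - 1)))).
  + exact: c2.
  + by apply: cc => //; exact/continuous_mull.
  + by apply: cc => //; exact/continuous_subr/continuous_mull.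
  + move=> st ->; rewrite clamp_ge1; last by lra.
    by rewrite clamp_le0 ?Hy ?Kx //; lra.
- by move=> t; rewrite /= /path_concat_fun; case: ifP; rewrite ?H0 ?K0.
- by move=> t; rewrite /= /path_concat_fun; case: ifP; rewrite ?H1 ?K1.
- by move=> s; rewrite val_zero01 invr_ge0 ler0n mulr0 clamp_le0.
- move=> s; rewrite val_one01 ifF; last by apply/negbTE; lra.
  by rewrite clamp_ge1 ?Ky //; lra.
Qed.

Lemma path_reverse_homotopic (x y : X) (p p' : {path I from x to y}) :
  path_homotopic p p' -> path_homotopic (path_reverse p) (path_reverse p').
Proof.
move=> [H [cH H0 H1 Hx Hy]].
exists (fun st => H (st.1, clamp (1 - val st.2))); split.
- move=> st; apply: (continuous_comp
    (f := fun st : I * I => (st.1, clamp (1 - val st.2)))); last exact: cH.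
  apply: pair_continuous; first exact: fst_continuous.
  apply: (@clamp_comp_continuous _ _ id (fun st : I * I => 1 - val st.2)).
    by move=> ?; exact: cvg_id.
  apply: continuous_subl => z.
  by apply: (continuous_comp (f := snd));
    [exact: snd_continuous|exact: val01_continuous].
- by move=> t; rewrite H0.
- by move=> t; rewrite H1.
- by move=> s; rewrite val_zero01 subr0 clamp_ge1.
- by move=> s; rewrite val_one01 subrr clamp_le0.
Qed.

End Paths.

Section FundamentalGroup.
Context (R : realType) (X : topologicalType) (x : X).
Local Notation I := (I01 R).
Local Notation loop := {path I from x to x}.

Definition loop_homotopic (p q : loop) : bool := `[< path_homotopic p q >].

Lemma loop_homotopic_equiv : equiv_class_of loop_homotopic.
Proof.
split=> [p|p q|q p r].
- exact/asboolP/path_homotopic_refl.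
- by apply/asboolP/asboolP => /path_homotopic_sym.
- by move=> /asboolP pq /asboolP qr; apply/asboolP/(path_homotopic_trans pq qr).
Qed.

Canonical loop_homotopic_equiv_rel := EquivRelPack loop_homotopic_equiv.

Definition pi1 : Type := {eq_quot loop_homotopic}.

HB.instance Definition _ := Choice.on pi1.

Definition pi1_class (p : loop) : pi1 := \pi_{eq_quot loop_homotopic} p.

Definition pi1_repr (a : pi1) : loop := repr (a : {eq_quot loop_homotopic}).

Lemma pi1_reprK (a : pi1) : pi1_class (pi1_repr a) = a.
Proof. exact: reprK. Qed.

Lemma pi1_classP (p q : loop) :
  pi1_class p = pi1_class q <-> path_homotopic p q.
Proof. by split=> [/eqmodP/asboolP|pq] //; apply/eqmodP/asboolP. Qed.

Lemma pi1_repr_class (p : loop) : path_homotopic (pi1_repr (pi1_class p)) p.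
Proof. by apply/pi1_classP; rewrite pi1_reprK. Qed.

Definition pi1_one : pi1 := pi1_class (cst x : loop).

Definition pi1_mul (a b : pi1) : pi1 :=
  pi1_class (path_concat (pi1_repr a) (pi1_repr b)).

Definition pi1_inv (a : pi1) : pi1 := pi1_class (path_reverse (pi1_repr a)).

Lemma pi1_mul_class (p q : loop) :
  pi1_mul (pi1_class p) (pi1_class q) = pi1_class (path_concat p q).
Proof. by apply/pi1_classP; apply: path_concat_homotopic; exact: pi1_repr_class. Qed.

Lemma pi1_inv_class (p : loop) :
  pi1_inv (pi1_class p) = pi1_class (path_reverse p).
Proof. by apply/pi1_classP; apply: path_reverse_homotopic; exact: pi1_repr_class. Qed.

Lemma min_continuous_real (h k : R -> R) :
  continuous h -> continuous k -> continuous (fun r => Num.min (h r) (k r)).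
Proof. by move=> ch ck r; exact: (@continuous_min R R h k r (ch r) (ck r)). Qed.

Lemma max_continuous_real (h k : R -> R) :
  continuous h -> continuous k -> continuous (fun r => Num.max (h r) (k r)).
Proof. by move=> ch ck r; exact: (@continuous_max R R h k r (ch r) (ck r)). Qed.

Lemma id_continuous_real : continuous (fun r : R => r).
Proof. by move=> r; exact: cvg_id. Qed.

Lemma cst_continuous_real (c : R) : continuous (fun _ : R => c).
Proof. by move=> r; exact: cvg_cst. Qed.

Lemma path_concatE (p q : loop) (t : I) :
  path_concat p q t =
  if val t <= 2^-1 then p (clamp (2 * val t)) else q (clamp (2 * val t - 1)).
Proof. by []. Qed.

Lemma loop_concat1 (p : loop) : path_homotopic (path_concat p (cst x)) p.
Proof.
apply: (@reparam_homotopic _ _ x x x x p _ _ (fun r => Num.min (2 * r) 1) id).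
- apply: min_continuous_real; last exact: cst_continuous_real.
  exact/continuous_mull/id_continuous_real.
- exact: id_continuous_real.
- by rewrite mulr0 (min_idPl ler01).
- by rewrite mulr1; apply/min_idPr; lra.
- move=> t; rewrite /= /path_concat_fun /=; have := I01_bound t.
  rewrite /=; move: (sval t) => r r01.
  case: (leP r 2^-1) => r2.
    by have -> : Num.min (2 * r) 1 = 2 * r by apply/min_idPl; lra.
  have -> : Num.min (2 * r) 1 = 1 by apply/min_idPr; lra.
  by rewrite clamp_ge1 ?path_one.
- by move=> t; rewrite clamp_val.
Qed.

Lemma loop_concatl1 (p : loop) : path_homotopic (path_concat (cst x) p) p.
Proof.
apply: (@reparam_homotopic _ _ x x x x p _ _ (fun r => Num.max 0 (2 * r - 1)) id).
- apply: max_continuous_real; first exact: cst_continuous_real.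
  exact/continuous_subr/continuous_mull/id_continuous_real.
- exact: id_continuous_real.
- by apply/max_idPl; lra.
- have -> : Num.max 0 (2 * 1 - 1) = 2 * 1 - 1 :> R by apply/max_idPr; lra.
  by rewrite /=; lra.
- move=> t; rewrite /= /path_concat_fun /=; have := I01_bound t.
  rewrite /=; move: (sval t) => r r01.
  case: (leP r 2^-1) => r2.
    have -> : Num.max 0 (2 * r - 1) = 0 by apply/max_idPl; lra.
    by rewrite clamp_le0 ?path_zero.
  by have -> : Num.max 0 (2 * r - 1) = 2 * r - 1 by apply/max_idPr; lra.
- by move=> t; rewrite clamp_val.
Qed.

Lemma loop_concatV (p : loop) :
  path_homotopic (path_concat p (path_reverse p)) (cst x).
Proof.
apply: (@reparam_homotopic _ _ x x x x p _ _
  (fun r => Num.min (2 * r) (2 - 2 * r)) (cst 0)).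
- apply: min_continuous_real.
    exact/continuous_mull/id_continuous_real.
  exact/continuous_subl/continuous_mull/id_continuous_real.
- exact: cst_continuous_real.
- have -> : Num.min (2 * 0) (2 - 2 * 0) = 2 * 0 :> R by apply/min_idPl; lra.
  by rewrite /= mulr0.
- have -> : Num.min (2 * 1) (2 - 2 * 1) = 2 - 2 * 1 :> R by apply/min_idPr; lra.
  by rewrite /= mulr1 subrr.
- move=> t; rewrite /= /path_concat_fun /=; have := I01_bound t.
  rewrite /=; move: (sval t) => r r01.
  case: (leP r 2^-1) => r2.
    by have -> : Num.min (2 * r) (2 - 2 * r) = 2 * r by apply/min_idPl; lra.
  have -> : Num.min (2 * r) (2 - 2 * r) = 2 - 2 * r by apply/min_idPr; lra.
  rewrite /= /path_reverse_fun val_clamp; last by lra.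
  by congr (p (clamp _)); lra.
- by move=> t; rewrite clamp_le0 ?path_zero.
Qed.

Lemma loop_concatVl (p : loop) :
  path_homotopic (path_concat (path_reverse p) p) (cst x).
Proof.
apply: (@reparam_homotopic _ _ x x x x p _ _
  (fun r => Num.max (1 - 2 * r) (2 * r - 1)) (cst 1)).
- apply: max_continuous_real.
    exact/continuous_subl/continuous_mull/id_continuous_real.
  exact/continuous_subr/continuous_mull/id_continuous_real.
- exact: cst_continuous_real.
- have -> : Num.max (1 - 2 * 0) (2 * 0 - 1) = 1 - 2 * 0 :> R.
    by apply/max_idPl; lra.
  by rewrite /= mulr0 subr0.
- have -> : Num.max (1 - 2 * 1) (2 * 1 - 1) = 2 * 1 - 1 :> R.
    by apply/max_idPr; lra.
  by rewrite /=; lra.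
- move=> t; rewrite /= /path_concat_fun /=; have := I01_bound t.
  rewrite /=; move: (sval t) => r r01.
  case: (leP r 2^-1) => r2.
    have -> : Num.max (1 - 2 * r) (2 * r - 1) = 1 - 2 * r by apply/max_idPl; lra.
    by rewrite /= /path_reverse_fun val_clamp //; lra.
  by have -> : Num.max (1 - 2 * r) (2 * r - 1) = 2 * r - 1 by apply/max_idPr; lra.
- by move=> t; rewrite clamp_ge1 ?path_one.
Qed.

Lemma loop_concatA (p q r : loop) :
  path_homotopic (path_concat p (path_concat q r))
                 (path_concat (path_concat p q) r).
Proof.
apply: path_homotopic_sym.
pose phi (t : R) := Num.min (2 * t) (Num.min (t + 4^-1) ((t + 1) / 2)).
have phi1 t : t <= 4^-1 -> phi t = 2 * t.
  by move=> t4; apply/min_idPl; rewrite le_min; apply/andP; split; lra.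
have phi2 t : 4^-1 <= t -> t <= 2^-1 -> phi t = t + 4^-1.
  move=> t4 t2; rewrite /phi.
  have -> : Num.min (t + 4^-1) ((t + 1) / 2) = t + 4^-1 by apply/min_idPl; lra.
  by apply/min_idPr; lra.
have phi3 t : 2^-1 <= t -> phi t = (t + 1) / 2.
  move=> t2; rewrite /phi.
  have -> : Num.min (t + 4^-1) ((t + 1) / 2) = (t + 1) / 2.
    by apply/min_idPr; lra.
  by apply/min_idPr; lra.
apply: (@reparam_homotopic _ _ x x x x (path_concat p (path_concat q r)) _ _
  phi id).
- apply: min_continuous_real.
    exact/continuous_mull/id_continuous_real.
  apply: min_continuous_real.
    by apply: continuousDr; [exact: id_continuous_real|exact: cst_continuous_real].
  apply: continuousMr; last exact: cst_continuous_real.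
  by apply: continuousDr; [exact: id_continuous_real|exact: cst_continuous_real].
- exact: id_continuous_real.
- by rewrite phi1 ?mulr0 //; lra.
- by rewrite phi3 /=; lra.
- move=> t; have := I01_bound t; rewrite !path_concatE.
  move: (val t) => u u01.
  have [u2|u2] := leP u 2^-1.
    rewrite val_clamp; last by lra.
    have [u4|u4] := leP (2 * u) 2^-1.
      rewrite phi1; last by lra.
      rewrite val_clamp; last by lra.
      by rewrite u4.
    rewrite phi2; [|lra..].
    rewrite val_clamp; last by lra.
    rewrite ifF; last by apply/negbTE; lra.
    rewrite val_clamp; last by lra.
    rewrite ifT; last by lra.
    by congr (q (clamp _)); lra.
  rewrite phi3; last by lra.
  rewrite val_clamp; last by lra.
  rewrite ifF; last by apply/negbTE; lra.
  rewrite val_clamp; last by lra.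
  rewrite ifF; last by apply/negbTE; lra.
  by congr (r (clamp _)); lra.
- by move=> t; rewrite clamp_val.
Qed.

Lemma pi1_mulA : associative pi1_mul.
Proof.
move=> a b c; rewrite -(pi1_reprK a) -(pi1_reprK b) -(pi1_reprK c).
rewrite !pi1_mul_class; apply/pi1_classP; exact: loop_concatA.
Qed.

Lemma pi1_mul1 : left_id pi1_one pi1_mul.
Proof.
move=> a; rewrite -(pi1_reprK a) pi1_mul_class; apply/pi1_classP.
exact: loop_concatl1.
Qed.

Lemma pi1_mulr1 : right_id pi1_one pi1_mul.
Proof.
move=> a; rewrite -(pi1_reprK a) pi1_mul_class; apply/pi1_classP.
exact: loop_concat1.
Qed.

Lemma pi1_mulV : left_inverse pi1_one pi1_inv pi1_mul.
Proof.
move=> a; rewrite -(pi1_reprK a) pi1_inv_class pi1_mul_class; apply/pi1_classP.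
exact: loop_concatVl.
Qed.

Lemma pi1_mulrV : right_inverse pi1_one pi1_inv pi1_mul.
Proof.
move=> a; rewrite -(pi1_reprK a) pi1_inv_class pi1_mul_class; apply/pi1_classP.
exact: loop_concatV.
Qed.

HB.instance Definition _ :=
  isGroup.Build pi1 pi1_mulA pi1_mul1 pi1_mulr1 pi1_mulV pi1_mulrV.

End FundamentalGroup.

Arguments pi1 R {X} x.

(** * The closed orientable surface of genus [l] *)

Section Surface.
Context (R : realType) (l : nat).

Definition closed_disk : set (R * R) :=
  [set z | z.1 ^+ 2 + z.2 ^+ 2 <= 1].

(* The boundary circle, seen as a polygon with [4 * l] sides: the k-th side is
   the image of [[k, k + 1]]. *)
Definition boundary_point (t : R) : R * R :=
  (cos (2 * pi * t / (4 * l)%:R), sin (2 * pi * t / (4 * l)%:R)).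

(* For each [i < l], side [4 i] is glued to side [4 i + 2] and side [4 i + 1]
   to side [4 i + 3], in both cases with opposite directions: the boundary of
   the polygon reads [a_1 b_1 a_1^-1 b_1^-1 ... a_l b_l a_l^-1 b_l^-1]. *)
Definition side_pairing (z w : closed_disk) : Prop :=
  exists (i : nat) (s : R), [/\ (i < l)%N, 0 <= s <= 1 &
    (set_val z = boundary_point ((4 * i)%:R + s) /\
     set_val w = boundary_point ((4 * i + 3)%:R - s)) \/
    (set_val z = boundary_point ((4 * i + 1)%:R + s) /\
     set_val w = boundary_point ((4 * i + 4)%:R - s))].

Definition side_glued (z w : closed_disk) : bool :=
  `[< Relation_Operators.clos_refl_sym_trans _ side_pairing z w >].

Lemma side_glued_equiv : equiv_class_of side_glued.
Proof.
split=> [z|z w|w z v].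
- exact/asboolP/Relation_Operators.rst_refl.
- by apply/asboolP/asboolP; exact: Relation_Operators.rst_sym.
- move=> /asboolP zw /asboolP wv; apply/asboolP.
  exact: (Relation_Operators.rst_trans _ _ _ _ _ zw wv).
Qed.

Canonical side_glued_equiv_rel := EquivRelPack side_glued_equiv.

Definition surface : Type := quotient_topology {eq_quot side_glued}.

HB.instance Definition _ := Topological.on surface.

Definition surface_proj (z : closed_disk) : surface :=
  \pi_{eq_quot side_glued} z.

Lemma surface_open (U : set surface) :
  open U <-> exists2 V : set (R * R), open V &
                 set_val @^-1` V = surface_proj @^-1` U.
Proof. by split=> [[V oV e]|[V oV e]]; exists V. Qed.

Lemma surface_projP (z w : closed_disk) :
  surface_proj z = surface_proj w <->
  Relation_Operators.clos_refl_sym_trans _ side_pairing z w.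
Proof. by split=> [/eqmodP/asboolP|zw] //; apply/eqmodP/asboolP. Qed.

Lemma surface_proj_surj (u : surface) : exists z, surface_proj z = u.
Proof. by exists (repr (u : {eq_quot side_glued})); exact: reprK. Qed.

End Surface.

(** * Commutator subgroup *)

Section CommutatorSubgroup.
Context (G : groupType).
Local Open Scope group_scope.

Definition subgroup (H : set G) : Prop :=
  H 1 /\ forall x y, H x -> H y -> H (x / y).

Definition commutator_set : set G := [set z | exists x y, z = [~ x, y]].

Definition commutator_subgroup : {pred G} :=
  fun z => z \in smallest subgroup commutator_set.

Lemma commutator_subgroup_closed : group_closed commutator_subgroup.
Proof.
split=> [|x y].
  by rewrite unfold_in; apply/mem_set => H [[H1 _] _].
rewrite !unfold_in => /set_mem xN /set_mem yN; apply/mem_set => H HH.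
by case: (HH) => -[_ HF] _; apply: HF; [exact: xN|exact: yN].
Qed.

Definition commutator_group : Type := {z : G | z \in commutator_subgroup}.

HB.instance Definition _ := SubChoice.on commutator_group.

HB.instance Definition _ := SubChoice_isSubGroup.Build
  G commutator_subgroup commutator_group commutator_subgroup_closed.

End CommutatorSubgroup.

(** * Homogeneous quasimorphisms *)

Section Quasimorphisms.
Context (R : realType).

Section OneGroup.
Context (G : groupType).
Local Open Scope group_scope.

Definition expgz (x : G) (n : int) : G :=
  match n with Posz m => x ^+ m | Negz m => x ^- m.+1 end.

End OneGroup.

Definition quasimorphism (G : groupType) (f : G -> R) : Prop :=
  exists D : R, forall x y : G, `|f (x * y)%g - f x - f y| <= D.

Definition homogeneous (G : groupType) (f : G -> R) : Prop :=
  forall (x : G) (n : int), f (expgz x n) = n%:~R * f x.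

Definition Q (G : groupType) : set (G -> R^o) :=
  [set f | quasimorphism f /\ homogeneous f].

Section Subgroup.
Context (G : groupType) (S : pred G) (N : subGroupType S).

(* [y] ranges over the elements of [N] equal to [g x g^-1]; when [N] is normal
   there is exactly one. *)
Definition conj_invariant (f : N -> R) : Prop :=
  forall (g : G) (x y : N), val y = (g * val x * g^-1)%g -> f y = f x.

Definition Q_invariant : set (N -> R^o) :=
  [set f | Q f /\ conj_invariant f].

Definition H1_invariant : set (N -> R^o) :=
  [set f | (forall x y : N, f (x * y)%g = f x + f y) /\ conj_invariant f].

Definition Q_restriction : set (N -> R^o) :=
  [set f | exists2 F : G -> R^o, Q F & f = F \o val].

End Subgroup.
End Quasimorphisms.

Arguments Q_invariant R {G S} N.
Arguments H1_invariant R {G S} N.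
Arguments Q_restriction R {G S} N.

(** * Dimensions of quotients *)

Section Dimension.
Context (K : fieldType) (E : lmodType K).

Definition subspace_sum (V W : set E) : set E :=
  [set u | exists2 v, V v & exists2 w, W w & u = v + w].

(* [W] is contained in [V], and [V / W] has a basis of [n] elements, given by
   the classes of the [b i]. *)
Definition dim_quotient_eq (V W : set E) (n : nat) : Prop :=
  W `<=` V /\
  exists b : 'I_n -> E,
    [/\ forall i, V (b i),
        forall c : 'I_n -> K, W (\sum_i c i *: b i) -> forall i, c i = 0 &
        forall v, V v -> exists c : 'I_n -> K, W (v - \sum_i c i *: b i)].

End Dimension.

(* Main.v *)
Require Import Defs.
From HB Require Import structures.
From mathcomp Require Import all_boot all_order all_algebra.
From mathcomp Require Import all_classical all_reals all_analysis.
From mathcomp Require Import homotopy ring lra zify.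

(* Polar coordinates present the surface as the image of the plane of the
   (r, t), with t in R / 4l the position on the boundary of the polygon.
   Radial paths turn the sides into elements a_i, b_i of the fundamental group
   G whose commutators multiply to 1.  They generate G because a loop
   is a concatenation of short paths, each of them in one of three charts that
   retract onto the centre, the sides or the corners.  Given elements of a
   group K that satisfy the relation, transition functions between these charts
   define a flat K-bundle, and its holonomy is a morphism from G to K with the
   prescribed values.  So G has the standard presentation.

   Let x_i run over the 2l generators.  For f in Q(N)^G the value
   f [x_i^k, x_j^m] is k m w_ij up to a bounded error, with w alternating.
   If w = 0 then f extends: write g in G as n x_0^(k_0) x_1^(k_1) ... with n in N
   and homogenize the quasimorphism g |-> f n.  So Q(N)^G / i^*Q(G) embeds in the
   space of alternating forms on R^(2l), of dimension l (2l - 1), and it remains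
   to realize all forms.  A form with sum_i w(a_i, b_i) = 0 comes from an
   invariant homomorphism, by mapping G to a Heisenberg group; conversely the
   relation forces this sum to vanish on homomorphisms.  A form with non-zero sum
   comes from a translation number: two piecewise linear lifts of circle
   homeomorphisms have half a translation as their commutator, so that a product
   of two such commutators is an integer translation, which is cancelled in
   a central extension of Z^2 by the group of lifts. *)

Set Implicit Arguments.
Unset Strict Implicit.
Unset Printing Implicit Defensive.

Import Order.TTheory GRing.Theory Num.Theory.
Import numFieldNormedType.Exports.

Local Open Scope classical_set_scope.
Local Open Scope ring_scope.

(** * Polar coordinates on the surface *)

(** The presentation is reached without covering spaces: generation bounds G from above, and
    holonomies supply all the quotients that the relation allows. The groups K carry no topology, so
    a flat bundle is handled through arbitrary set-theoretic sections whose transition functions are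
    locally constant. For l = 1 the statement fails, since N is then trivial. The condition l > 1
    enters through the translation number. If a commutator of two lifts f, g were a unit
    translation, then g and a conjugate of it would differ by that central translation, while
    conjugate lifts have the same translation number. A half translation is not central and escapes
    this argument; two handles are then enough for a unit translation. The quasimorphism obtained in
    this way is bounded on the commutators of two lifts. The form that it realizes is therefore
    produced by the cocycle on Z^2 alone, which can be chosen with non-zero sum. The sum condition
    has codimension one in the space of forms, hence the dimension 1 of the second quotient. *)

Section Polar.
Context {R : realType}.
Implicit Types x y t : R.

Lemma polar_angle x y : x ^+ 2 + y ^+ 2 = 1 ->
  exists2 t, 0 <= t < 2 * pi & x = cos t /\ y = sin t.
Proof.
move=> xy1.
have x1 : -1 <= x <= 1 by have := sqr_ge0 y; nra.
have sa : sin (acos x) = `|y|.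
  by rewrite sin_acos // -sqrtr_sqr; congr Num.sqrt; lra.
have ca : cos (acos x) = x by rewrite acosK.
have [y0|y0] := leP 0 y.
  exists (acos x); first by rewrite acos_ge0 //=; have := acos_lepi x1; have := pi_gt0 R; lra.
  by rewrite ca sa ger0_norm.
have a0 : 0 < acos x.
  rewrite lt_neqAle acos_ge0 // andbT; apply/eqP => a0.
  by move: sa; rewrite -a0 sin0 => /esym/eqP; rewrite normr_eq0 => /eqP; lra.
exists (2 * pi - acos x); first by have := acos_lepi x1; have := pi_gt0 R; lra.
rewrite cosB sinB mulr_natl cos2pi sin2pi ca sa ltr0_norm //; split; lra.
Qed.

End Polar.

Section Strip.
Context {R : realType} {l : nat} (l_gt0 : (0 < l)%N).

Let nu : R := (4 * l)%:R.

Let nu_gt0 : 0 < nu. Proof. by rewrite ltr0n muln_gt0. Qed.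

Definition polar (p : R * R) : R * R :=
  (val (clamp p.1) * (boundary_point l p.2).1,
   val (clamp p.1) * (boundary_point l p.2).2).

Lemma polar_disk (p : R * R) : polar p \in @closed_disk R.
Proof.
rewrite inE /closed_disk /polar /= !exprMn -mulrDr cos2Dsin2 mulr1.
by have := I01_bound (clamp p.1) => /=; nra.
Qed.

Definition strip (p : R * R) : surface R l :=
  surface_proj l (exist _ (polar p) (polar_disk p)).

Lemma polar_continuous : continuous polar.
Proof.
have c1 : continuous (fun p : R * R => val (clamp p.1) : R).
  move=> p; apply: (@continuous_comp _ _ _ fst (fun r : R => val (clamp r) : R)).
    exact: fst_continuous.
  apply: (@continuous_comp _ _ _ (@clamp R)); first exact: clamp_continuous.
  exact: val01_continuous.
have c2 : continuous (fun p : R * R => 2 * pi * p.2 / (4 * l)%:R : R).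
  apply: continuousMr; last by move=> p; exact: cvg_cst.
  by apply: continuous_mull => p; exact: snd_continuous.
have c3 (f : R -> R) : continuous f -> continuous (fun p : R * R => f (2 * pi * p.2 / (4 * l)%:R)).
  by move=> cf p; exact: (continuous_comp (c2 p) (cf _)).
apply: pair_continuous; apply: continuousMr => //.
  by apply: c3; exact: continuous_cos.
by apply: c3; exact: continuous_sin.
Qed.

Lemma polar_surj (z : set_type (@closed_disk R)) :
  exists2 p : R * R, 0 <= p.1 <= 1 /\ 0 <= p.2 <= nu & polar p = val z.
Proof.
case: z => -[x y] /= zD; have {zD} : x ^+ 2 + y ^+ 2 <= 1 by move: zD; rewrite inE.
move=> xy1; pose r := Num.sqrt (x ^+ 2 + y ^+ 2).
have r2 : r ^+ 2 = x ^+ 2 + y ^+ 2 by rewrite sqr_sqrtr //; nra.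
have r0 : 0 <= r by exact: sqrtr_ge0.
have r01 : 0 <= r <= 1 by rewrite r0 /=; nra.
have [re0|rn0] := eqVneq r 0.
  exists (0, 0); first by rewrite /= lexx ler01 ltW.
  rewrite /polar [(0, 0).1]/= clamp_le0 // val_zero01 !mul0r.
  have xx : x = 0 by apply/eqP; rewrite -sqrf_eq0; apply/eqP; nra.
  have yy : y = 0 by apply/eqP; rewrite -sqrf_eq0; apply/eqP; nra.
  by rewrite xx yy.
have [t /andP[t0 t2] [xt yt]] : exists2 t : R, 0 <= t < 2 * pi &
    x / r = cos t /\ y / r = sin t.
  by apply: polar_angle; rewrite !exprMn -mulrDl -r2 exprVn divff // expf_neq0.
have pi0 := pi_gt0 R.
exists (r, nu * t / (2 * pi)).
  split => //=; apply/andP; split.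
    by apply: divr_ge0; apply: mulr_ge0; have := nu_gt0; lra.
  by rewrite ler_pdivrMr ?mulr_gt0 // ler_pM2l // ltW.
have a : 2 * pi * (nu * t / (2 * pi)) / nu = t.
  rewrite [2 * pi * _]mulrC divfK ?gt_eqF ?mulr_gt0 //.
  by rewrite mulrAC divff ?mul1r // gt_eqF.
rewrite /polar /boundary_point -/nu.
have -> : val (clamp (r, nu * t / (2 * pi)).1) = r by rewrite val_clamp.
rewrite [(_, _).2]/= a -xt -yt /=; congr pair; field.
all: exact: rn0.
Qed.

Lemma stripE (z : set_type (@closed_disk R)) (p : R * R) :
  polar p = val z -> strip p = surface_proj l z.
Proof. by move=> pz; rewrite /strip; congr surface_proj; exact: val_inj. Qed.

Lemma strip_surj (y : surface R l) : exists p, strip p = y.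
Proof.
have [z <-] := surface_proj_surj y.
by have [p _ pz] := polar_surj z; exists p; exact: stripE.
Qed.

(** The strip is not compact, but the rectangle [0,1] x [0,nu] already covers the disk. The part of
    it outside the preimage of [W] is compact, so its image under [polar] is closed in the plane,
    and the complement of that image cuts out [W] on the disk. *)
Lemma strip_open (W : set (surface R l)) : open W <-> open (strip @^-1` W).
Proof.
split=> [/surface_open[V oV e]|oW].
  have eV z : V (val z) = W (surface_proj l z) by exact: (congr1 (fun A => A z) e).
  have -> : strip @^-1` W = polar @^-1` V.
    by apply/seteqP; split=> p; rewrite /= /strip -eV.
  by apply: open_comp => // p _; exact: polar_continuous.
apply/surface_open.
pose K := (`[0, 1] `*` `[0, nu]) `&` ~` (strip @^-1` W) : set (R * R).
have cK : compact K.
  apply: compact_closedI; last by rewrite closedC.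
  by apply: compact_setX; exact: segment_compact.
exists (~` (polar @` K)).
  apply: closed_openC; apply: compact_closed.
    exact: norm_hausdorff.
  by apply: continuous_compact => //; apply: continuous_subspaceT; exact: polar_continuous.
apply/seteqP; split=> z /=.
  move=> nK; have [p [p1 p2] pz] := polar_surj z.
  rewrite -(stripE pz); apply: contrapT => nW; apply: nK.
  by exists p => //; split => //; split; rewrite /= in_itv /=.
by move=> Wz [p [_ nW] pz]; apply: nW; rewrite /preimage /= (stripE pz).
Qed.

Lemma strip_continuous : continuous strip.
Proof. by apply/continuousP => W /strip_open. Qed.

(* The identifications between points of the strip with the same image in the
   surface; a map satisfying them factors through the surface. *)
Record glued (A : Type) (F : R * R -> A) : Prop := Glued {
  glued_ge1 : forall r t, 1 <= r -> F (r, t) = F (1, t);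
  glued_le0 : forall r t, r <= 0 -> F (r, t) = F (0, 0);
  glued_periodic : forall r t, F (r, t + nu) = F (r, t);
  glued_nat : forall (i : nat) s, (i < l)%N -> 0 <= s <= 1 ->
    F (1, (4 * i)%:R + s) = F (1, (4 * i + 3)%:R - s) /\
    F (1, (4 * i + 1)%:R + s) = F (1, (4 * i + 4)%:R - s) }.

Lemma glued_periodicn (A : Type) (F : R * R -> A) r t (n : nat) :
  glued F -> F (r, t + n%:R * nu) = F (r, t).
Proof.
move=> gF; elim: n => [|n IH]; first by rewrite mul0r addr0.
by rewrite -natr1 mulrDl mul1r addrA glued_periodic.
Qed.

Lemma glued_periodicz (A : Type) (F : R * R -> A) r t (n : int) :
  glued F -> F (r, t + n%:~R * nu) = F (r, t).
Proof.
move=> gF; case: n => n; first exact: glued_periodicn.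
rewrite NegzE -(glued_periodicn r _ n.+1 gF); congr (F (_, _)).
by rewrite mulrNz; lra.
Qed.

Lemma glued_int (A : Type) (F : R * R -> A) (i : int) s :
  glued F -> 0 <= s <= 1 ->
  F (1, 4 * i%:~R + s) = F (1, 4 * i%:~R + 3 - s) /\
  F (1, 4 * i%:~R + 1 + s) = F (1, 4 * i%:~R + 4 - s).
Proof.
move=> gF s01.
have l0 : (l%:Z != 0) by rewrite eqz_nat -lt0n.
have [j jl ji] : exists2 j : nat, (j < l)%N & i = (i %/ l)%Z * l%:Z + j%:Z.
  exists `|(i %% l)%Z|%N.
    by rewrite -ltz_nat gez0_abs ?modz_ge0 // ltz_pmod.
  by rewrite gez0_abs ?modz_ge0 // -divz_eq.
have e (t : R) : F (1, 4 * i%:~R + t) = F (1, 4 * j%:R + t).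
  rewrite -(glued_periodicz 1 (4 * j%:R + t) (i %/ l)%Z gF); congr (F (_, _)).
  by rewrite [in LHS]ji rmorphD rmorphM /= /nu natrM; ring.
have [e1 e2] := glued_nat gF jl s01.
have n4 (m : nat) : (4 * j + m)%:R = 4 * j%:R + m%:R :> R by rewrite natrD natrM.
by move: e1 e2; rewrite !n4 natrM -!addrA !e.
Qed.

Lemma polar_eq (p q : R * R) : polar p = polar q -> 
  val (clamp p.1) = val (clamp q.1) /\
  (val (clamp p.1) = 0 \/ exists n : int, q.2 = p.2 + n%:~R * nu).
Proof.
case: p q => [r t] [r' t'] [/=].
have := I01_bound (clamp r) => /=; have := I01_bound (clamp r') => /=.
set a := Num.max _ _; set a' := Num.max _ _ => a'0 a0.
set x := 2 * _ * t / _; set x' := 2 * _ * t' / _ => e1 e2.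
have ea : a' = a.
  have /eqP : a' ^+ 2 = a ^+ 2.
    transitivity (a' ^+ 2 * (cos x ^+ 2 + sin x ^+ 2)); first by rewrite cos2Dsin2 mulr1.
    by rewrite mulrDr -!exprMn e1 e2 !exprMn -mulrDr cos2Dsin2 mulr1.
  by rewrite eqf_sqr => /orP[/eqP //|/eqP]; lra.
split => //; rewrite -/a'; have [|a_neq0] := eqVneq a' 0; first by left.
right.
have {}e1 : cos x = cos x' by apply: (mulfI a_neq0); rewrite e1 ea.
have {}e2 : sin x = sin x' by apply: (mulfI a_neq0); rewrite e2 ea.
have c1 : cos (x' - x) = 1 by rewrite cosB -e1 -e2 -!expr2 cos2Dsin2.
have pi0 := pi_gt0 R.
pose n := Num.floor (t' / nu - t / nu).
pose y := x' - x - n%:~R * (2 * pi).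
have p2 : pi *+ 2 = 2 * pi :> R by rewrite mulr_natl.
have cn (m : nat) (z : R) : cos (z + m%:R * (2 * pi)) = cos z.
  elim: m => [|m IH]; first by rewrite mul0r addr0.
  by rewrite -natr1 mulrDl mul1r addrA -p2 cosD2pi p2.
have cz (m : int) (z : R) : cos (z + m%:~R * (2 * pi)) = cos z.
  case: m => m; first exact: cn.
  by rewrite NegzE mulrNz -pmulrn -[LHS](cn m.+1) mulNr subrK.
have cy : cos y = 1 by rewrite -(cz n) /y subrK.
have y0 : 0 <= y < 2 * pi.
  have := floor_itv (t' / nu - t / nu); rewrite -/n rmorphD /=.
  have -> : y = (2 * pi) * (t' / nu - t / nu - n%:~R).
    by rewrite /y /x /x' -/nu; field; rewrite ?pnatr_eq0 -?lt0n ?l_gt0 ?gt_eqF.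
  nra.
have yE : y = 0.
  have [yp|yp] := leP y pi.
    by apply: cos_inj; rewrite ?in_itv /= ?cos0 //; lra.
  suff : 2 * pi - y = 0 by lra.
  apply: cos_inj; rewrite ?in_itv /=; [lra|lra|].
  by rewrite cosB mulr_natl cos2pi sin2pi cy cos0; lra.
exists n.
have : (2 * pi) * (t' / nu - t / nu - n%:~R) = 0.
  by rewrite -yE /y /x /x' -/nu; field; rewrite ?pnatr_eq0 -?lt0n ?l_gt0 ?gt_eqF.
move/eqP; rewrite mulf_eq0 gt_eqF ?mulr_gt0 //= => /eqP.
move=> /(congr1 ( *%R nu)); rewrite mulr0 => E.
have : nu * (t' / nu - t / nu - n%:~R) = t' - t - n%:~R * nu.
  by field; rewrite ?pnatr_eq0 -?lt0n ?l_gt0 ?gt_eqF.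
lra.
Qed.

Lemma glued_clamp (A : Type) (F : R * R -> A) r t : glued F ->
  F (val (clamp r), t) = F (r, t).
Proof.
move=> gF; have [r0|r0] := leP r 0.
  by rewrite clamp_le0 // val_zero01 (glued_le0 gF) // [RHS](glued_le0 gF).
have [r1|r1] := leP 1 r.
  by rewrite clamp_ge1 // val_one01 [RHS]glued_ge1.
by rewrite val_clamp // !ltW.
Qed.

Lemma glued_polar (A : Type) (F : R * R -> A) p q : glued F ->
  polar p = polar q -> F p = F q.
Proof.
case: p q => [r t] [r' t'] gF /polar_eq.
rewrite [(r, t).1]/= [(r', t').1]/= => -[er H].
rewrite -(glued_clamp r t gF) -(glued_clamp r' t' gF) -[in X in _ = X]er.
case: H => [->|[n /= ->]].
  by rewrite (glued_le0 gF) // [RHS](glued_le0 gF).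
by rewrite glued_periodicz.
Qed.

Lemma strip_glued : glued strip.
Proof.
split.
- by move=> r t r1; rewrite /strip; congr surface_proj; apply: val_inj => /=;
    rewrite /polar [(r, t).1]/= [(1, t).1]/= !clamp_ge1.
- move=> r t r0; rewrite /strip; congr surface_proj; apply: val_inj => /=.
  by rewrite /polar [(r, t).1]/= [(0, 0).1]/= !clamp_le0 // val_zero01 !mul0r.
- move=> r t; rewrite /strip; congr surface_proj; apply: val_inj => /=.
  rewrite /polar /boundary_point /= -/nu.
  have -> : 2 * pi * (t + nu) / nu = 2 * pi * t / nu + pi *+ 2.
    have -> : pi *+ 2 = 2 * pi :> R by rewrite mulr_natl.
    by field; rewrite ?pnatr_eq0 -?lt0n ?l_gt0 ?gt_eqF.
  by rewrite cosD2pi sinD2pi.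
- move=> i s il s01.
  have pE t : polar (1, t) = boundary_point l t.
    by rewrite /polar [(1, t).1]/= clamp_ge1 // val_one01 !mul1r.
  split; apply/surface_projP; apply: Relation_Operators.rst_step; exists i, s.
    by split => //; left; split; exact: pE.
  by split => //; right; split; exact: pE.
Qed.

(** The function that [F] induces on the disk does not depend on the polar coordinates chosen, and
    it is preserved by the generating relation. As [A] is arbitrary, sets, families of curves,
    transition functions and cosets all descend to the surface in this way. *)
Lemma strip_descent (A : Type) (F : R * R -> A) p q :
  glued F -> strip p = strip q -> F p = F q.
Proof.
move=> gF /surface_projP.
have ang (z : set_type (@closed_disk R)) : exists p, polar p = val z.
  by have [p' _] := polar_surj z; exists p'.
pose G z := F (projT1 (cid (ang z))).
have GE z p' : polar p' = val z -> F p' = G z.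
  by move=> pz; apply: glued_polar => //; rewrite (projT2 (cid (ang z))).
suff GG z w : Relation_Operators.clos_refl_sym_trans _ (@side_pairing R l) z w ->
    G z = G w
  by move=> /GG; rewrite -(GE _ p) // -(GE _ q).
elim=> {p q z w} [z w|//|//|z w v _ -> //].
have pE t : polar (1, t) = boundary_point l t.
  by rewrite /polar [(1, t).1]/= clamp_ge1 // val_one01 !mul1r.
move=> [i [s [il s01 [[zE wE]|[zE wE]]]]].
  rewrite -(GE _ (1, (4 * i)%:R + s)) ?pE //.
  rewrite -(GE _ (1, (4 * i + 3)%:R - s)) ?pE //.
  exact: (glued_nat gF il s01).1.
rewrite -(GE _ (1, (4 * i + 1)%:R + s)) ?pE //.
rewrite -(GE _ (1, (4 * i + 4)%:R - s)) ?pE //.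
exact: (glued_nat gF il s01).2.
Qed.

End Strip.

(** * Homotopy classes of curves *)

Section Groupoid.
Context {R : realType} {X : topologicalType}.
Local Notation I := (I01 R).

Local Notation "p ~~> q" := (path_homotopic p q) (at level 70).

Lemma path_of_subproof0 (u : R -> X) : (u \o (val : I -> R)) zero = u 0.
Proof. by []. Qed.

Lemma path_of_subproof1 (u : R -> X) : (u \o (val : I -> R)) one = u 1.
Proof. by []. Qed.

Lemma path_of_continuous (u : R -> X) :
  continuous u -> continuous (u \o (val : I -> R)).
Proof.
by move=> cu t; apply: continuous_comp; [exact: val01_continuous|exact: cu].
Qed.

Definition path_of (u : R -> X) (cu : continuous u) : {path I from u 0 to u 1} :=
  mk_path (path_of_continuous cu) (path_of_subproof0 u) (path_of_subproof1 u).

(* Both paths are images of curves in the plane with the same endpoints. *)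
Lemma plane_homotopic (F : R * R -> X) (phi psi : R -> R * R) (x y : X)
    (p q : {path I from x to y}) :
  continuous F -> continuous phi -> continuous psi ->
  phi 0 = psi 0 -> phi 1 = psi 1 ->
  (forall t : I, p t = F (phi (val t))) ->
  (forall t : I, q t = F (psi (val t))) -> p ~~> q.
Proof.
move=> cF cphi cpsi e0 e1 pE qE.
exists (fun st => F ((1 - val st.1) *: phi (val st.2) + val st.1 *: psi (val st.2))).
split.
- have c1 : continuous (fun st : I * I => val st.1 : R).
    by move=> st; apply: (continuous_comp (f := fst));
      [exact: fst_continuous|exact: val01_continuous].
  have c2 (a : R -> R * R) : continuous a ->
      continuous (fun st : I * I => a (val st.2) : R * R).
    move=> ca st; apply: (continuous_comp (f := fun st : I * I => val st.2 : R));
      last exact: ca.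
    by apply: (continuous_comp (f := snd));
      [exact: snd_continuous|exact: val01_continuous].
  move=> st; apply: continuous_comp; last exact: cF.
  apply: cvgD; apply: cvgZ; [|exact: c2|exact: c1|exact: c2].
  exact: (continuous_subl c1).
- by move=> t; rewrite /= subr0 scale1r scale0r addr0 -pE.
- by move=> t; rewrite /= subrr scale1r scale0r add0r -qE.
- move=> s; rewrite /= -e0 -scalerDl subrK scale1r -[RHS](path_zero (s := p)) pE.
  by rewrite val_zero01.
- move=> s; rewrite /= -e1 -scalerDl subrK scale1r -[RHS](path_one (s := p)) pE.
  by rewrite val_one01.
Qed.

(** This law and the next ones are needed beyond loops, because [conj_paths] composes paths with
    distinct endpoints. *)
Lemma path_concatl1 (x y : X) (p : {path I from x to y}) :
  path_concat (cst x : {path I from x to x}) p ~~> p.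
Proof.
apply: (@reparam_homotopic _ _ x y x y p _ _ (fun r => Num.max 0 (2 * r - 1)) id).
- apply: max_continuous_real; first exact: cst_continuous_real.
  exact/continuous_subr/continuous_mull/id_continuous_real.
- exact: id_continuous_real.
- by apply/max_idPl; lra.
- have -> : Num.max 0 (2 * 1 - 1) = 2 * 1 - 1 :> R by apply/max_idPr; lra.
  by rewrite /=; lra.
- move=> t; rewrite /= /path_concat_fun /=; have := I01_bound t.
  rewrite /=; move: (sval t) => r r01.
  case: (leP r 2^-1) => r2.
    have -> : Num.max 0 (2 * r - 1) = 0 by apply/max_idPl; lra.
    by rewrite clamp_le0 ?path_zero.
  by have -> : Num.max 0 (2 * r - 1) = 2 * r - 1 by apply/max_idPr; lra.
- by move=> t; rewrite clamp_val.
Qed.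

Lemma path_concatVl (x y : X) (p : {path I from x to y}) :
  path_concat (path_reverse p) p ~~> (cst y : {path I from y to y}).
Proof.
apply: (@reparam_homotopic _ _ y y x y p _ _
  (fun r => Num.max (1 - 2 * r) (2 * r - 1)) (cst 1)).
- apply: max_continuous_real.
    exact/continuous_subl/continuous_mull/id_continuous_real.
  exact/continuous_subr/continuous_mull/id_continuous_real.
- exact: cst_continuous_real.
- have -> : Num.max (1 - 2 * 0) (2 * 0 - 1) = 1 - 2 * 0 :> R.
    by apply/max_idPl; lra.
  by rewrite /= mulr0 subr0.
- have -> : Num.max (1 - 2 * 1) (2 * 1 - 1) = 2 * 1 - 1 :> R.
    by apply/max_idPr; lra.
  by rewrite /=; lra.
- move=> t; rewrite /= /path_concat_fun /=; have := I01_bound t.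
  rewrite /=; move: (sval t) => r r01.
  case: (leP r 2^-1) => r2.
    have -> : Num.max (1 - 2 * r) (2 * r - 1) = 1 - 2 * r by apply/max_idPl; lra.
    by rewrite /= /path_reverse_fun val_clamp //; lra.
  by have -> : Num.max (1 - 2 * r) (2 * r - 1) = 2 * r - 1 by apply/max_idPr; lra.
- by move=> t; rewrite clamp_ge1 ?path_one.
Qed.

Lemma path_concatE (x y z : X) (p : {path I from x to y}) (q : {path I from y to z})
    (t : I) : path_concat p q t =
  if val t <= 2^-1 then p (clamp (2 * val t)) else q (clamp (2 * val t - 1)).
Proof. by []. Qed.

Lemma path_concatA (x y z w : X) (p : {path I from x to y})
    (q : {path I from y to z}) (r : {path I from z to w}) :
  path_concat (path_concat p q) r ~~> path_concat p (path_concat q r).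
Proof.
(* [phi] takes the subdivision 0, 1/4, 1/2, 1 of the left side to the subdivision 0, 1/2, 3/4, 1 of
   the right side. Its slopes 2, 1, 1/2 decrease, so it is a minimum of affine functions. *)
pose phi (t : R) := Num.min (2 * t) (Num.min (t + 4^-1) ((t + 1) / 2)).
have phi1 t : t <= 4^-1 -> phi t = 2 * t.
  by move=> t4; apply/min_idPl; rewrite le_min; apply/andP; split; lra.
have phi2 t : 4^-1 <= t -> t <= 2^-1 -> phi t = t + 4^-1.
  move=> t4 t2; rewrite /phi.
  have -> : Num.min (t + 4^-1) ((t + 1) / 2) = t + 4^-1 by apply/min_idPl; lra.
  by apply/min_idPr; lra.
have phi3 t : 2^-1 <= t -> phi t = (t + 1) / 2.
  move=> t2; rewrite /phi.
  have -> : Num.min (t + 4^-1) ((t + 1) / 2) = (t + 1) / 2.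
    by apply/min_idPr; lra.
  by apply/min_idPr; lra.
apply: (@reparam_homotopic _ _ x w x w (path_concat p (path_concat q r)) _ _
  phi id).
- apply: min_continuous_real.
    exact/continuous_mull/id_continuous_real.
  apply: min_continuous_real.
    by apply: continuousDr; [exact: id_continuous_real|exact: cst_continuous_real].
  apply: continuousMr; last exact: cst_continuous_real.
  by apply: continuousDr; [exact: id_continuous_real|exact: cst_continuous_real].
- exact: id_continuous_real.
- by rewrite phi1 ?mulr0 //; lra.
- by rewrite phi3 /=; lra.
- move=> t; have := I01_bound t; rewrite !path_concatE.
  move: (val t) => u u01.
  have [u2|u2] := leP u 2^-1.
    rewrite val_clamp; last by lra.
    have [u4|u4] := leP (2 * u) 2^-1.
      rewrite phi1; last by lra.
      rewrite val_clamp; last by lra.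
      by rewrite u4.
    rewrite phi2; [|lra..].
    rewrite val_clamp; last by lra.
    rewrite ifF; last by apply/negbTE; lra.
    rewrite val_clamp; last by lra.
    rewrite ifT; last by lra.
    by congr (q (clamp _)); lra.
  rewrite phi3; last by lra.
  rewrite val_clamp; last by lra.
  rewrite ifF; last by apply/negbTE; lra.
  rewrite val_clamp; last by lra.
  rewrite ifF; last by apply/negbTE; lra.
  by congr (r (clamp _)); lra.
- by move=> t; rewrite clamp_val.
Qed.

Definition seg (p q : R * R) (t : R) : R * R := p + t *: (q - p).

Lemma seg0 p q : seg p q 0 = p. Proof. by rewrite /seg scale0r addr0. Qed.

Lemma seg1 p q : seg p q 1 = q. Proof. by rewrite /seg scale1r addrC subrK. Qed.

Lemma seg_continuous p q : continuous (seg p q).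
Proof.
by move=> t; apply: cvgD; [exact: cvg_cst|apply: cvgZ; [exact: cvg_id|exact: cvg_cst]].
Qed.

End Groupoid.

(** * Classes of curves closed up at the base point *)

Section Theta.
Context {R : realType} {X : topologicalType} (x : X).
Local Notation I := (I01 R).
Local Notation "p ~~> q" := (path_homotopic p q) (at level 70).
Local Notation ht := (@path_homotopic_trans R X _ _ _ _ _).
Local Notation hs := (@path_homotopic_sym R X _ _ _ _).
Local Notation hr := (@path_homotopic_refl R X _ _ _).
Local Notation hc := (@path_concat_homotopic R X _ _ _ _ _ _ _).

Variable d : forall y : X, {path I from x to y}.

(* The class of the loop that follows [u] between two fixed paths to its
   endpoints ([1] if [u] is not continuous). *)
Definition theta (u : R -> X) : pi1 R x :=
  match pselect (continuous u) with
  | left cu => pi1_class (path_concat (d (u 0))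
                 (path_concat (path_of cu) (path_reverse (d (u 1)))))
  | right _ => 1%g
  end.

Lemma conj_paths (y z w : X) (a : {path I from y to z}) (b : {path I from z to w})
    (c : {path I from y to w}) : path_concat a b ~~> c ->
  path_concat (path_concat (d y) (path_concat a (path_reverse (d z))))
    (path_concat (d z) (path_concat b (path_reverse (d w)))) ~~>
  path_concat (d y) (path_concat c (path_reverse (d w))).
Proof.
move=> abc; apply: ht (path_concatA _ _ _) _; apply: hc; first exact: hr.
apply: ht (path_concatA _ _ _) _.
apply: ht (hc (hr) _) _.
  apply: ht (hs (path_concatA _ _ _)) _.
  apply: ht (hc (path_concatVl _) hr) _.
  exact: path_concatl1.
by apply: ht (hs (path_concatA _ _ _)) _; apply: hc abc hr.
Qed.

(** The endpoints match only up to propositional equality. The homotopy is therefore asked for paths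
    of the right types with the prescribed values, and [main] transports it along the three
    equalities. *)
Lemma thetaM (u v w : R -> X) (cu : continuous u) (cv : continuous v)
    (cw : continuous w) (uv : v 0 = u 1) (uw : w 0 = u 0) (vw : w 1 = v 1) :
  (forall a : {path I from u 0 to u 1}, forall b : {path I from u 1 to v 1},
   forall c : {path I from u 0 to v 1},
   (forall t, a t = u (val t)) -> (forall t, b t = v (val t)) ->
   (forall t, c t = w (val t)) -> path_concat a b ~~> c) ->
  (theta u * theta v = theta w)%g.
Proof.
move=> H; rewrite /theta.
case: pselect => // {}cu; case: pselect => // {}cv; case: pselect => // {}cw.
have main (b0 c0 c1 : X) (b : {path I from b0 to v 1}) (c : {path I from c0 to c1})
   (e1 : b0 = u 1) (e2 : c0 = u 0) (e3 : c1 = v 1) :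
   (forall t, b t = v (val t)) -> (forall t, c t = w (val t)) ->
   pi1_mul (pi1_class (path_concat (d (u 0)) (path_concat (path_of cu) (path_reverse (d (u 1))))))
     (pi1_class (path_concat (d b0) (path_concat b (path_reverse (d (v 1)))))) =
   pi1_class (path_concat (d c0) (path_concat c (path_reverse (d c1)))).
  case: _ / (esym e1) b => b; case: _ / (esym e2) c; case: _ / (esym e3) => c bv cw'.
  rewrite pi1_mul_class; apply/pi1_classP/conj_paths; exact: H.
exact: main.
Qed.

(** Triangles in the plane can be filled, so their images give relations. Every relation in the
    fundamental group that is used later comes from this one. *)
Lemma theta_seg (F : R * R -> X) p q r : continuous F ->
  (theta (F \o seg p q) * theta (F \o seg q r) = theta (F \o seg p r))%g.
Proof.
move=> cF.
have cs a b : continuous (F \o seg a b).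
  by move=> t; apply: continuous_comp; [exact: seg_continuous|exact: cF].
apply: thetaM => //=; rewrite ?seg0 ?seg1 //.
move=> a b c aE bE cE.
(* [phi] is the broken line from p through q to r, run at double speed and written as a single
   continuous formula. *)
apply: (plane_homotopic (F := F) (phi := fun t => p + Num.min 1 (2 * t) *: (q - p) +
    Num.max 0 (2 * t - 1) *: (r - q)) (psi := seg p r)) => //.
- have cid := @id_continuous_real R; have cc := @cst_continuous_real R.
  have c1 : continuous (fun t : R => Num.min 1 (2 * t)).
    by apply: min_continuous_real; [exact: cc|exact: continuous_mull].
  have c2 : continuous (fun t : R => Num.max 0 (2 * t - 1)).
    by apply: max_continuous_real; [exact: cc|exact/continuous_subr/continuous_mull].
  move=> t; apply: cvgD; last by apply: cvgZ; [exact: c2|exact: cvg_cst].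
  by apply: cvgD; [exact: cvg_cst|apply: cvgZ; [exact: c1|exact: cvg_cst]].
- exact: seg_continuous.
- rewrite seg0 mulr0 (min_idPr ler01) sub0r (max_idPl _) ?scale0r ?addr0 //; lra.
- rewrite seg1 mulr1 (min_idPl _) ?(max_idPr _); [|lra..].
  have -> : 2 - 1 = 1 :> R by lra.
  by rewrite !scale1r [p + _]addrC subrK addrC subrK.
- move=> t; rewrite path_concatE; have := I01_bound t; move: (val t) => s s01.
  have [s2|s2] := leP s 2^-1.
    rewrite aE val_clamp /=; last by lra.
    by rewrite (min_idPr _) ?(max_idPl _) ?scale0r ?addr0 //; lra.
  rewrite bE val_clamp /=; last by lra.
  rewrite (min_idPl _) ?(max_idPr _); [|lra..].
  by rewrite scale1r [p + _]addrC subrK.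
Qed.

Lemma theta_eq01 (u v : R -> X) : continuous u -> continuous v ->
  (forall t, 0 <= t <= 1 -> u t = v t) -> theta u = theta v.
Proof.
move=> cu cv uv.
pose F (p : R * R) := u p.1.
have cF : continuous F.
  by move=> p; apply: (continuous_comp (f := fst)); [exact: fst_continuous|exact: cu].
have c1 : theta (fun=> v 1) = 1%g.
  apply: (@mulgI _ (theta (fun=> v 1))); rewrite mulg1.
  by apply: (@theta_seg (fun=> v 1) 0 0 0) => z; exact: cvg_cst.
(* A constant curve is appended to [u] so that [thetaM] applies with [v] as the composite; it takes
   care of the different endpoint types of [u] and [v]. *)
rewrite -[LHS]mulg1 -c1.
have i01 : 0 <= (0 : R) <= 1 by rewrite lexx ler01.
have i11 : 0 <= (1 : R) <= 1 by rewrite lexx ler01.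
apply: thetaM => //; rewrite ?uv //; first by move=> z; exact: cvg_cst.
move=> a b c aE bE cE.
apply: (plane_homotopic (F := F) (phi := fun t => (Num.min 1 (2 * t), 0))
  (psi := fun t => (t, 0))) => //.
- apply: pair_continuous; last exact: cst_continuous_real.
  apply: min_continuous_real; first exact: cst_continuous_real.
  exact/continuous_mull/id_continuous_real.
- by apply: pair_continuous; [exact: id_continuous_real|exact: cst_continuous_real].
- by rewrite mulr0 (min_idPr ler01).
- by rewrite mulr1 (min_idPl _) //; lra.
- move=> t; rewrite path_concatE /F; have := I01_bound t.
  move: (val t) => s s01; rewrite [(_, _).1]/=.
  have [s2|s2] := leP s 2^-1.
    have -> : Num.min 1 (2 * s) = 2 * s by apply/min_idPr; lra.
    by rewrite aE val_clamp ?uv //; lra.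
  have -> : Num.min 1 (2 * s) = 1 by apply/min_idPl; lra.
  by rewrite bE uv.
- by move=> t; rewrite cE /F /= uv // I01_bound.
Qed.

Lemma theta_cst (y : X) : theta (fun=> y) = 1%g.
Proof.
apply: (@mulgI _ (theta (fun=> y))); rewrite mulg1.
by apply: (@theta_seg (fun=> y) 0 0 0) => z; exact: cvg_cst.
Qed.

Lemma theta_loop (p : {path I from x to x}) :
  theta (p \o @clamp R) =
  (pi1_class (d x) * pi1_class p * (pi1_class (d x))^-1)%g.
Proof.
have cp : continuous (p \o @clamp R).
  by move=> t; apply: continuous_comp; [exact: clamp_continuous|exact: cts_fun].
rewrite /theta; case: pselect => // {}cp.
have e0 : (p \o @clamp R) 0 = x by rewrite /= clamp_le0 ?path_zero.
have e1 : (p \o @clamp R) 1 = x by rewrite /= clamp_ge1 ?path_one.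
have main (y z : X) (q : {path I from y to z}) (ey : y = x) (ez : z = x) :
   (forall t, q t = p t) ->
   pi1_class (path_concat (d y) (path_concat q (path_reverse (d z)))) =
   (pi1_class (d x) * pi1_class p * (pi1_class (d x))^-1)%g.
  case: _ / (esym ey) q; case: _ / (esym ez) => q qp.
  have -> : q = p by apply/path_eqP.
  rewrite -mulgA.
  transitivity (pi1_mul (pi1_class (d x)) (pi1_mul (pi1_class p) (pi1_inv (pi1_class (d x))))) => //.
  by rewrite pi1_inv_class !pi1_mul_class.
by apply: (main _ _ (path_of cp) e0 e1) => t; exact: (congr1 p (clamp_val t)).
Qed.

End Theta.

(** * Subdivision of intervals and quotient topology *)

Section Tools.
Context {R : realType}.

(** Compactness of an interval in the form of Cousin's lemma: the supremum of the points reachable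
    from [a] is itself reachable, and it can be passed unless it is [b]. It replaces subdivisions
    and Lebesgue numbers for both paths and squares. *)
Lemma cousin (P : R -> R -> Prop) :
  (forall a m b, a <= m -> m <= b -> P a m -> P m b -> P a b) ->
  (forall t, exists2 e, 0 < e & forall a b, t - e < a -> a <= t -> t <= b ->
     b < t + e -> P a b) ->
  forall a b, a <= b -> P a b.
Proof.
move=> Padd Ploc a b ab.
pose S := [set c | a <= c <= b /\ P a c].
have Sa : S a.
  split; first by rewrite lexx.
  by have [e e0 Pe] := Ploc a; apply: Pe => //; lra.
have supS : has_sup S by split; [exists a|exists b => c [/andP[]]].
have aS : a <= sup S by apply: ub_le_sup => //; case: supS.
have Sb : sup S <= b by apply: ge_sup; [exists a|move=> c [/andP[]]].
have [e e0 Pe] := Ploc (sup S).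
have [c [/andP[ac cb] Pac] cS] := sup_adherent e0 supS.
have cs : c <= sup S by apply: ub_le_sup; [case: supS|split => //; rewrite ac].
have Ps : P a (sup S).
  by apply: (Padd _ c) => //; apply: Pe => //; lra.
have [sb|sb] := ltP (sup S) b; last by have -> : b = sup S by lra.
pose c' := Num.min b (sup S + e / 2).
have c'b : c' <= b by rewrite ge_min lexx.
have sc' : sup S < c' by rewrite lt_min sb /=; lra.
have c'e : c' < sup S + e by rewrite gt_min; apply/orP; right; lra.
have : S c'.
  split; first by rewrite c'b andbT; lra.
  by apply: (Padd _ (sup S)) => //; [exact: ltW|apply: Pe => //; lra].
by move=> /(ub_le_sup supS.2); lra.
Qed.

Lemma for_continuous_near_eq (Y Z : topologicalType) (f g : Y -> Z) (y : Y) :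
  (\forall z \near y, f z = g z) -> {for y, continuous f} -> {for y, continuous g}.
Proof.
move=> fg cf W; rewrite -(nbhs_singleton fg) => /cf nW.
have {}nW : \forall z \near y, W (f z) by exact: nW.
suff : \forall z \near y, W (g z) by [].
near=> z; have <- : f z = g z by near: z.
by near: z.
Unshelve. all: end_near. Qed.

Lemma for_pair_continuous (Y Z T : topologicalType) (f : Y -> Z) (g : Y -> T) (y : Y) :
  {for y, continuous f} -> {for y, continuous g} ->
  {for y, continuous (fun z => (f z, g z))}.
Proof. by move=> cf cg; exact: (cvg_pair cf cg). Qed.

(* A product of a quotient map with the line is again a quotient map. *)
Lemma quotient_line_continuous (Z X Y : topologicalType) (q : Z -> X) (U : set X)
    (C : X * R -> Y) :
  (forall W : set X, open W <-> open (q @^-1` W)) -> open U ->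
  (forall z s, U (q z) -> {for (z, s), continuous (fun zs : Z * R => C (q zs.1, zs.2))}) ->
  forall z s, U (q z) -> {for (q z, s), continuous C}.
Proof.
move=> hq oU cC z s Uz W /=; rewrite nbhsE => -[B [oB Bs] BW].
have : nbhs (z, s) ((fun zs : Z * R => C (q zs.1, zs.2)) @^-1` B).
  by apply: cC => //; exact: open_nbhs_nbhs.
move=> [[A1 A2] /= [nA1 /nbhs_ballP[e /= e0 eA2]] A12].
pose J := `[s - e / 2, s + e / 2]%classic : set R.
have Js' s' : J s' -> A2 s'.
  move=> Js'; apply: eA2; move: Js'; rewrite /J /ball /= in_itv /=.
  by rewrite ltr_norml => /andP[? ?]; apply/andP; split; lra.
(* Tube argument: the preimage of [O] under [q] is open because [J] is compact, hence [O] is open in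
   the quotient. This bypasses the failure of products of quotient maps to be quotient maps in
   general. *)
pose O := U `&` [set y | J `<=` (fun s' => B (C (y, s')))].
have oO : open O.
  apply/hq; rewrite openE => z' [Uz' Jz'].
  apply: filterI; first by apply: open_nbhs_nbhs; split => //; exact/hq.
  have /compact_near_coveringP cJ : compact J by exact: segment_compact.
  apply: (cJ Z (nbhs z') (fun z'' s' => B (C (q z'', s')))) => s' s'J.
  have : nbhs (z', s') ((fun zs : Z * R => C (q zs.1, zs.2)) @^-1` B).
    by apply: cC => //; apply: open_nbhs_nbhs; split => //; exact: Jz' s'J.
  move=> [[D1 D2] /= [nD1 nD2] D12]; exists (D2, D1) => //= -[s'' z''] [/= ? ?].
  exact: (D12 (z'', s'')).
apply: (@filterS _ _ _ (O `*` ball s (e / 2))).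
  move=> [y s'] [[_ yO] /= s'b]; apply/BW/yO; rewrite /J /= in_itv /=.
  by move: s'b; rewrite /ball /= ltr_norml => /andP[? ?]; apply/andP; split; lra.
exists (O, ball s (e / 2)) => //=; split.
  apply: open_nbhs_nbhs; split => //; split => // s' /Js' s'A.
  by apply: (A12 (z, s')); split => //; exact: nbhs_singleton nA1.
by apply: nbhsx_ballx; lra.
Qed.

End Tools.

(** * Generators of the fundamental group *)

Section Generation.
Context {R : realType} {l : nat} (l_gt0 : (0 < l)%N).
Local Notation X := (surface R l).
Local Notation S := (@strip R l).
Local Notation nu := ((4 * l)%:R : R).
Local Notation glued := (@glued R l).
Local Notation fl t := ((Num.floor t)%:~R : R).

Let cS : continuous S := @strip_continuous R l l_gt0.
Let gS : glued S := @strip_glued R l l_gt0.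

(** The boolean treats both families of sides at once: side 4i + c is glued, reversed, to the side
    two places further on. *)
Lemma strip_pair (i : nat) (c : bool) s : (i < l)%N -> 0 <= s <= 1 ->
  S (1, (4 * i + c)%:R + s) = S (1, (4 * i + c + 3)%:R - s).
Proof.
move=> il s01; have [] := glued_nat gS il s01.
by case: c; rewrite ?addn0 -?addnA.
Qed.

Lemma glued_pair (A : Type) (F : R * R -> A) :
  (forall r t, 1 <= r -> F (r, t) = F (1, t)) ->
  (forall r t, r <= 0 -> F (r, t) = F (0, 0)) ->
  (forall r t, F (r, t + nu) = F (r, t)) ->
  (forall (i : nat) (c : bool) s, (i < l)%N -> 0 <= s <= 1 ->
    F (1, (4 * i + c)%:R + s) = F (1, (4 * i + c + 3)%:R - s)) ->
  glued F.
Proof.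
move=> F1 F0 Fp Fs; split=> // i s il s01.
have := Fs i false s il s01; have := Fs i true s il s01.
by rewrite addn0 -addnA.
Qed.

(** For data defined on a chart only: the constant [b0] fills the complement, so that
    [strip_descent] applies to a total function. *)
Lemma glued_chart (B : Type) (A : set (R * R)) (f : R * R -> B) (b0 : B) :
  glued A ->
  (forall r t, 1 <= r -> A (r, t) -> f (r, t) = f (1, t)) ->
  (forall r t, r <= 0 -> A (r, t) -> f (r, t) = f (0, 0)) ->
  (forall r t, A (r, t) -> f (r, t + nu) = f (r, t)) ->
  (forall (i : nat) (c : bool) s, (i < l)%N -> 0 <= s <= 1 ->
    A (1, (4 * i + c)%:R + s) ->
    f (1, (4 * i + c)%:R + s) = f (1, (4 * i + c + 3)%:R - s)) ->
  glued (fun p => if `[< A p >] then f p else b0).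
Proof.
move=> gA f1 f0 fp fs; apply: glued_pair.
- by move=> r t r1; rewrite -(glued_ge1 gA t r1); case: asboolP => // /f1 ->.
- by move=> r t r0; rewrite -(glued_le0 gA t r0); case: asboolP => // /f0 ->.
- by move=> r t; rewrite (glued_periodic gA); case: asboolP => // /fp ->.
- move=> i c s il s01.
  have <- : A (1, (4 * i + c)%:R + s) = A (1, (4 * i + c + 3)%:R - s).
    by have [] := glued_nat gA il s01; case: c; rewrite ?addn0 -?addnA.
  by case: asboolP => // /fs ->.
Qed.

Lemma floor_near (t : R) : fl t < t ->
  \forall t' \near t, fl t' = fl t /\ fl t' < t'.
Proof.
move=> tt; have := floor_itv t; rewrite rmorphD /= => /andP[_ t1].
near=> t'.
have t't : fl t < t' by near: t'; exact: lt_nbhsr.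
have t't1 : t' < fl t + 1%:~R by near: t'; exact: lt_nbhsl.
have -> : Num.floor t' = Num.floor t.
  by apply: floor_def; rewrite rmorphD /= ltW.
by split.
Unshelve. all: end_near. Qed.

Lemma floor_natP (n : nat) (t : R) : n%:R <= t < n%:R + 1 -> fl t = n%:R.
Proof.
by move=> nt; have -> : Num.floor t = n%:Z; [apply: floor_def; rewrite rmorphD|].
Qed.

Lemma floorD_nu (t : R) : Num.floor (t + nu) = Num.floor t + (4 * l)%N%:Z.
Proof.
apply: floor_def; have := floor_itv t.
have -> : (Num.floor t + (4 * l)%N%:Z + 1)%:~R = fl t + nu + 1 by rewrite !rmorphD.
have -> : (Num.floor t + (4 * l)%N%:Z)%:~R = fl t + nu by rewrite rmorphD.
have -> : (Num.floor t + 1)%:~R = fl t + 1 by rewrite rmorphD.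
lra.
Qed.

Lemma floor_period (t : R) : fl (t + nu) = fl t + nu.
Proof. by rewrite floorD_nu rmorphD. Qed.

Variables (x : X) (d : forall y : X, {path (I01 R) from x to y}).
Local Notation theta := (theta d).

Lemma strip_seg_continuous p q : continuous (S \o seg p q).
Proof. by move=> t; apply: continuous_comp; [exact: seg_continuous|exact: cS]. Qed.

(** A potential on the strip: by [theta_lam] the class of the image of a segment is a quotient of
    two of its values. It does not descend to the surface; its jumps between glued points of the
    sides are the generators. *)
Definition lam (p : R * R) : pi1 R x := theta (S \o seg 0 p).
Local Notation L t := (lam (1%R, t%R)).

Lemma theta_lam p q : theta (S \o seg p q) = ((lam p)^-1 * lam q)%g.
Proof. by rewrite /lam -(theta_seg d 0 p q cS) mulKg. Qed.

Lemma lam_le0 r t : r <= 0 -> lam (r, t) = 1%g.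
Proof.
move=> r0; rewrite -(theta_cst d (S (0, 0))); apply: theta_eq01.
- exact: strip_seg_continuous.
- by move=> z; exact: cvg_cst.
move=> s s01; rewrite /= /seg.
rewrite (surjective_pairing (0 + _)) (glued_le0 gS) //=.
by rewrite add0r subr0 /GRing.scale /=; nra.
Qed.

Lemma lam_periodicz r t (n : int) : lam (r, t + n%:~R * nu) = lam (r, t).
Proof.
have := theta_lam (0, n%:~R * nu) (r, t + n%:~R * nu).
rewrite lam_le0 // invg1 mul1g => <-.
rewrite /lam; congr theta; apply/funext => s /=.
rewrite /seg (surjective_pairing (_ + _ *: _)) [RHS]/= (surjective_pairing (0 + _)).
rewrite -[RHS](glued_periodicz _ _ n gS); congr (S (_, _)) => /=.
by rewrite /GRing.scale /=; ring.
Qed.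

(** Two glued sides have the same image curve, so the jump between paired points is constant along
    the side. The midpoint values serve as the definition of the generator, and the values at s = 0
    and s = 1 relate the corners. *)
Lemma lam_pair (i : int) (c : bool) s : 0 <= s <= 1 ->
  (L (4 * i%:~R + c%:R + s) / L (4 * i%:~R + c%:R + 3 - s) =
   L (4 * i%:~R + c%:R + 2^-1) / L (4 * i%:~R + c%:R + 5 / 2))%g.
Proof.
move=> s01; set u : R := 4 * i%:~R + c%:R.
have pr v : 0 <= v <= 1 -> S (1, u + v) = S (1, u + 3 - v).
  move=> v01; rewrite /u; have [] := glued_int l_gt0 i gS v01.
  case: c {u} => [_ e|e _] /=; first by rewrite e; congr (S (1, _)); rewrite /=; ring.
  by rewrite addr0 e; congr (S (1, _)); rewrite /=; ring.
have : theta (S \o seg (1, u + 2^-1) (1, u + s)) =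
       theta (S \o seg (1, u + 5 / 2) (1, u + 3 - s)).
  apply: theta_eq01; [exact: strip_seg_continuous..|move=> v v01 /=].
  rewrite /seg (surjective_pairing (_ + _ *: _)) [RHS](f_equal S (surjective_pairing _)) /=.
  rewrite /GRing.scale /= subrr mulr0 addr0.
  have -> : u + 2^-1 + v * (u + s - (u + 2^-1)) = u + (2^-1 + v * (s - 2^-1)) by ring.
  rewrite pr; first by congr (S (1, _)); lra.
  by nra.
rewrite !theta_lam => /(congr1 (fun g => L (u + 2^-1) * g / L (u + 3 - s))%g).
by rewrite mulVKg !mulgA mulgK => ->.
Qed.

Variable H : set (pi1 R x).
Hypothesis H1 : H 1%g.
Hypothesis HM : forall g h, H g -> H h -> H (g * h)%g.
Hypothesis HV : forall g, H g -> H (g^-1)%g.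

Definition restr (u : R -> X) (a b : R) : R -> X := fun s => u (a + s * (b - a)).

Lemma restr_continuous u a b : continuous u -> continuous (restr u a b).
Proof.
move=> cu s; apply: (@continuous_comp _ _ _ (fun s : R => a + s * (b - a)) u); last exact: cu.
apply: continuousDr; first exact: cst_continuous_real.
by apply: continuousMr; [exact: id_continuous_real|exact: cst_continuous_real].
Qed.

(** All strip coordinates of the endpoints are allowed. Hence consecutive intervals can be composed
    through any common coordinate of the middle point. *)
Definition in_H (u : R -> X) (a b : R) : Prop := forall p q,
  S p = u a -> S q = u b -> H (lam p * theta (restr u a b) / lam q)%g.

Lemma in_H_add u a m b : continuous u -> in_H u a m -> in_H u m b -> in_H u a b.
Proof.
move=> cu Ham Hmb p q pa qb; have [z zm] := strip_surj l_gt0 (u m).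
have := HM (Ham _ _ pa zm) (Hmb _ _ zm qb).
rewrite -[(lam z * _ / _)%g]mulgA divgKA.
have cu1 : continuous (fun p : R * R => u p.1).
  by move=> z'; apply: (continuous_comp (f := fst)); [exact: fst_continuous|exact: cu].
have <- : (theta (restr u a m) * theta (restr u m b) = theta (restr u a b))%g.
  exact: (theta_seg d (a, 0) (m, 0) (b, 0) cu1).
by rewrite !mulgA.
Qed.

(** The segments from p to c p descend to the chart and sweep a short curve into the point [y0]. The
    square [FF] has the curve as bottom edge, a constant top edge, and sides of classes (lam p)^-1
    lam (c p) and (lam q)^-1 lam (c q). So the element to be placed in [H] equals lam (c p) / lam (c
    q). *)
Lemma chart_local (A : set (R * R)) (c : R * R -> R * R) (y0 : X) :
  open A -> (forall p, A p -> {for p, continuous c}) -> glued A ->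
  glued (fun p => if `[< A p >] then fun s : R => S (seg p (c p) (val (clamp s)))
                  else fun=> y0) ->
  (forall p, A p -> S (c p) = y0) ->
  (forall p q, A p -> A q -> H (lam (c p) / lam (c q))%g) ->
  forall u : R -> X, continuous u -> forall p t, A p -> S p = u t ->
  exists2 e, 0 < e & forall a b, t - e < a -> a <= t -> t <= b -> b < t + e ->
    in_H u a b.
Proof.
move=> oA cc gA gF cy0 HA u cu p0 t Ap0 p0t.
set F := (fun p => _ : R -> X) in gF.
(* [rho] is an arbitrary section, in general not continuous. [US] and [FS] make the choice
   irrelevant, and continuity is recovered on the strip through [quotient_line_continuous]. *)
pose rho (y : X) := projT1 (cid (strip_surj l_gt0 y)).
have rhoK y : S (rho y) = y by exact: projT2 (cid (strip_surj l_gt0 y)).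
pose U := A \o rho : set X.
have US p : U (S p) = A p.
  by apply: (strip_descent l_gt0 gA); rewrite rhoK.
have FS p : F (rho (S p)) = F p by apply: (strip_descent l_gt0 gF); rewrite rhoK.
have oU : open U.
  apply/(strip_open l_gt0); have -> : S @^-1` U = A by apply/seteqP; split=> p; rewrite /= US.
  by [].
pose C (ys : X * R) := F (rho ys.1) ys.2.
have FA p s : A p -> F p s = S (seg p (c p) (val (clamp s))).
  by move=> Ap; rewrite /F; case: asboolP.
have cC p s : U (S p) -> {for (S p, s), continuous C}.
  apply: (quotient_line_continuous (strip_open l_gt0) oU) => {p s}p s.
  rewrite US => Ap.
  have cD : {for (p, s), continuous (fun ps : (R * R) * R =>
      S (seg ps.1 (c ps.1) (val (clamp ps.2))))}.
    apply: continuous_comp; last exact: cS.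
    have c1 : {for (p, s), continuous (fun ps : (R * R) * R => c ps.1)}.
      by apply: continuous_comp; [exact: fst_continuous|exact: cc].
    apply: cvgD; first exact: fst_continuous.
    apply: cvgZ; last by apply: cvgB; [exact: c1|exact: fst_continuous].
    apply: (@continuous_comp _ _ _ snd (fun s : R => val (clamp s) : R)); first exact: snd_continuous.
    by apply: continuous_comp; [exact: clamp_continuous|exact: val01_continuous].
  apply: for_continuous_near_eq cD.
  have nA : \forall z \near (p, s), A z.1 by apply: fst_continuous; exact: open_nbhs_nbhs.
  near=> z; rewrite /C FS FA //; near: z; exact: nA.
have Ut : U (u t) by rewrite -p0t US.
have [e /= e0 eU] : exists2 e : R, 0 < e & ball t e `<=` u @^-1` U.
  by apply/nbhs_ballP; apply: cu; exact: open_nbhs_nbhs.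
exists e => // a b ta a_t tb bt p q pa qb.
have abU v : a <= v <= b -> U (u v).
  by move=> vab; apply: eU; rewrite /ball /= ltr_norml; lra.
pose cl (v : R) := a + val (clamp v) * (b - a).
have clab v : a <= cl v <= b.
  by have := I01_bound (clamp v); rewrite /cl; move: (val _) => w; nra.
pose FF (sv : R * R) := C (u (cl sv.2), sv.1).
have cFF : continuous FF.
  move=> [s v]; have [z zE] := strip_surj l_gt0 (u (cl v)).
  apply: (@continuous_comp _ _ _ (fun sv : R * R => (u (cl sv.2), sv.1)) C).
    apply: for_pair_continuous; last exact: fst_continuous.
    apply: (@continuous_comp _ _ _ snd (u \o cl)); first exact: snd_continuous.
    apply: (@continuous_comp _ _ _ cl u); last exact: cu.
    apply: continuousDr; first exact: cst_continuous_real.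
    apply: continuousMr; last exact: cst_continuous_real.
    by move=> w; apply: continuous_comp; [exact: clamp_continuous|exact: val01_continuous].
  by rewrite /= -zE; apply: cC; rewrite zE; apply: abU.
have side (y : X) (z : R * R) : S z = y -> U y ->
    theta (fun s => C (y, s)) = ((lam z)^-1 * lam (c z))%g.
  move=> <-; rewrite US => Az; rewrite -theta_lam; apply: theta_eq01.
  - have -> : (fun s => C (S z, s)) = (fun s => S (seg z (c z) (val (clamp s)))).
      by apply/funext => s; rewrite /C FS FA.
    move=> s; apply: (@continuous_comp _ _ _ (fun s => val (clamp s)) (S \o seg z (c z))).
      by apply: continuous_comp; [exact: clamp_continuous|exact: val01_continuous].
    exact: strip_seg_continuous.
  - exact: strip_seg_continuous.
  - by move=> s s01; rewrite /C FS FA // val_clamp.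
have segE (f : R * R -> X) z w (g : R -> X) :
    (forall s, f (z + s *: (w - z)) = g s) -> f \o seg z w = g.
  by move=> fg; apply/funext => s; rewrite /= -fg.
have top : theta (FF \o seg (1, 0) (1, 1)) = 1%g.
  rewrite -[RHS](theta_cst d y0); congr theta; apply: segE => v.
  rewrite /FF /GRing.scale /= /GRing.scale /= subrr mulr0 addr0.
  set w := _ + _; have [z zE] := strip_surj l_gt0 (u (cl w)).
  have Az : A z by rewrite -US zE; apply: abU.
  by rewrite -zE /C FS FA // clamp_ge1 // val_one01 seg1 cy0.
have left_ : theta (FF \o seg (0, 0) (1, 0)) = ((lam p)^-1 * lam (c p))%g.
  rewrite -(side (u a)) //; last by apply: abU; rewrite lexx; lra.
  congr theta; apply: segE => v.
  rewrite /FF /GRing.scale /= /GRing.scale /= !subr0 mulr1 mulr0 !add0r.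
  by rewrite /cl clamp_le0 // val_zero01 mul0r addr0.
have right_ : theta (FF \o seg (0, 1) (1, 1)) = ((lam q)^-1 * lam (c q))%g.
  rewrite -(side (u b)) //; last by apply: abU; rewrite lexx; lra.
  congr theta; apply: segE => v.
  rewrite /FF /GRing.scale /= /GRing.scale /= subrr !subr0 mulr1 mulr0 !add0r addr0.
  by rewrite /cl clamp_ge1 // val_one01 mul1r addrC subrK.
have bot : theta (restr u a b) = theta (FF \o seg (0, 0) (0, 1)).
  apply: theta_eq01; first exact: restr_continuous.
    by move=> v; apply: continuous_comp; [exact: seg_continuous|exact: cFF].
  move=> v v01; rewrite /= /FF /seg /GRing.scale /= /GRing.scale /=.
  rewrite !subr0 mulr1 mulr0 !add0r.
  have clv : cl v = a + v * (b - a) by rewrite /cl val_clamp.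
  have [z zE] := strip_surj l_gt0 (u (cl v)).
  have Az : A z by rewrite -US zE; apply: abU.
  by rewrite -zE /C FS FA // clamp_le0 // val_zero01 seg0 zE clv.
rewrite bot -(theta_seg d (0, 0) (1, 1) (0, 1) cFF).
rewrite -(theta_seg d (0, 0) (1, 0) (1, 1) cFF) top left_ mulg1.
have -> : theta (FF \o seg (1, 1) (0, 1)) = ((lam q)^-1 * lam (c q))^-1%g.
  apply: (@mulIg _ (theta (FF \o seg (0, 1) (1, 1)))).
  rewrite [RHS](congr1 _ right_) mulVg (theta_seg d (1, 1) (0, 1) (1, 1) cFF).
  rewrite -(theta_cst d (FF (1, 1))); congr theta; apply: segE => v.
  by rewrite subrr scaler0 addr0.
rewrite invgM invgK !mulgA mulgV mul1g mulgK; apply: HA.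
  by rewrite -US pa; apply: abU; lra.
by rewrite -US qb; apply: abU; lra.
Unshelve. all: end_near. Qed.

Lemma strip_seg_le0 (r t r' t' s : R) : r <= 0 -> r' <= 0 -> 0 <= s <= 1 ->
  S (seg (r, t) (r', t') s) = S (0, 0).
Proof.
move=> r0 r'0 s01; rewrite /seg (surjective_pairing (_ + _ *: _)) (glued_le0 gS) //=.
by rewrite /GRing.scale /=; nra.
Qed.

Lemma clamp01 (s : R) : 0 <= val (clamp s) <= 1.
Proof. exact: I01_bound. Qed.

Lemma center_local (u : R -> X) : continuous u -> forall p t, p.1 < 1 -> S p = u t ->
  exists2 e, 0 < e & forall a b, t - e < a -> a <= t -> t <= b -> b < t + e ->
    in_H u a b.
Proof.
(* The whole line r = 0 lies over the centre. Keeping the angle makes the segments radial, so that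
   their images are unchanged by t -> t + nu; segments to the fixed point (0, 0) would not have this
   property. *)
apply: (@chart_local [set p | p.1 < 1] (fun p => (0, p.2)) (S (0, 0))).
- by apply: (@open_comp _ _ fst [set r : R | r < 1]); [move=> ? _; exact: fst_continuous|exact: open_lt].
- by move=> p _; apply: for_pair_continuous; [exact: cvg_cst|exact: snd_continuous].
- apply: glued_pair => //=.
  + by move=> r t r1; rewrite ltxx; apply/propext; split => //; lra.
  + by move=> r t r0; apply/propext; split; lra.
- apply: glued_chart => //=.
  + apply: glued_pair => //=.
      by move=> r t r1; rewrite ltxx; apply/propext; split => //; lra.
    by move=> r t r0; apply/propext; split; lra.
  + by move=> r t r1 r2; exfalso; lra.
  + by move=> r t r0 _; apply/funext => s; rewrite !strip_seg_le0 //; exact: clamp01.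
  + move=> r t _; apply/funext => s; rewrite /seg (surjective_pairing (_ + _ *: _)).
    rewrite [RHS](f_equal S (surjective_pairing _)) -[RHS](glued_periodic gS).
    by congr (S (_, _)); rewrite /= /GRing.scale /=; ring.
  + by move=> i c s _ _; rewrite ltxx.
- by move=> p _; rewrite (glued_le0 gS).
- by move=> p q _ _; rewrite !lam_le0 // mulgV.
Qed.

(* The sectors of the strip with angle in [A] are retracted onto the boundary
   points with angle in [g @` A]. *)
Lemma rim_local (A : set R) (g : R -> R) (y0 : X) :
  (forall t, A t -> \forall t' \near t, A t' /\ g t' = g t) ->
  (forall t, A (t + nu) = A t) -> (forall t, A t -> g (t + nu) = g t + nu) ->
  (forall (i : nat) (c : bool) s, (i < l)%N -> 0 <= s <= 1 ->
    A ((4 * i + c)%:R + s) = A ((4 * i + c + 3)%:R - s)) ->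
  (forall (i : nat) (c : bool) s, (i < l)%N -> 0 <= s <= 1 ->
    A ((4 * i + c)%:R + s) -> exists2 s', 0 <= s' <= 1 &
      g ((4 * i + c)%:R + s) = (4 * i + c)%:R + s' /\
      g ((4 * i + c + 3)%:R - s) = (4 * i + c + 3)%:R - s') ->
  (forall t, A t -> S (1, g t) = y0) ->
  (forall t t', A t -> A t' -> H (L (g t) / L (g t'))%g) ->
  forall u : R -> X, continuous u -> forall p t, 0 < p.1 -> A p.2 -> S p = u t ->
  exists2 e, 0 < e & forall a b, t - e < a -> a <= t -> t <= b -> b < t + e ->
    in_H u a b.
Proof.
move=> nA pA pg sA sg gy HA u cu p t p0 Ap.
have gB : glued (fun p => 0 < p.1 /\ A p.2).
  apply: glued_pair => /=.
  - by move=> r v r1; apply/propext; split => -[? ?]; split => //; lra.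
  - by move=> r v r0; apply/propext; split => -[? ?]; lra.
  - by move=> r v; rewrite pA.
  - by move=> i c s il s01; rewrite sA.
apply: (@chart_local [set p | 0 < p.1 /\ A p.2] (fun p => (1, g p.2)) y0) => //.
- rewrite openE => -[r v] /= [r0 Av].
  have n1 : \forall z \near (r, v), 0 < z.1.
    have nr : nbhs r [set r' : R | 0 < r'] by apply: open_nbhs_nbhs; split => //; exact: open_gt.
    exact: (@fst_continuous R R (r, v) _ nr).
  have n2 : \forall z \near (r, v), A z.2 /\ g z.2 = g v.
    exact: (@snd_continuous R R (r, v) _ (nA _ Av)).
  suff : \forall z \near (r, v), 0 < z.1 /\ A z.2 by [].
  near=> z; split; first by near: z.
  by have [] : A z.2 /\ g z.2 = g v by near: z.
- move=> [r v] [_ /= Av]; apply: for_pair_continuous; first exact: cvg_cst.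
  apply: (@for_continuous_near_eq _ _ (fun=> g v)); last exact: cvg_cst.
  have nAv : \forall z \near (r, v), A z.2 /\ g z.2 = g v.
    exact: (@snd_continuous R R (r, v) _ (nA _ Av)).
  by near=> z; have [] : A z.2 /\ g z.2 = g v by near: z.
- apply: glued_chart => //=.
  + move=> r v r1 [_ Av]; apply/funext => s; rewrite /seg.
    rewrite (surjective_pairing (_ + _ *: _)) [RHS](f_equal S (surjective_pairing _)).
    have := clamp01 s; rewrite /= /GRing.scale /=; move: (Num.max _ _) => w w01.
    by rewrite [LHS](glued_ge1 gS) ?[RHS](glued_ge1 gS) //; nra.
  + by move=> r v r0 [/= ? _]; exfalso; lra.
  + move=> r v [_ /= Av]; apply/funext => s; rewrite /seg pg //.
    rewrite (surjective_pairing (_ + _ *: _)) [RHS](f_equal S (surjective_pairing _)).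
    rewrite -[RHS](glued_periodic gS).
    by congr (S (_, _)); rewrite /= /GRing.scale /=; ring.
  + move=> i c s il s01 [_ /= As]; apply/funext => v; rewrite /seg.
    have [s' s'01 [-> ->]] := sg i c s il s01 As.
    rewrite (surjective_pairing (_ + _ *: _)) [RHS](f_equal S (surjective_pairing _)).
    have := clamp01 v; rewrite /= /GRing.scale /=; move: (Num.max _ _) => w w01.
    rewrite subrr mulr0 addr0.
    have -> : (4 * i + c)%:R + s + w * ((4 * i + c)%:R + s' - ((4 * i + c)%:R + s)) =
      (4 * i + c)%:R + (s + w * (s' - s)) :> R by ring.
    have -> : (4 * i + c + 3)%:R - s + w * ((4 * i + c + 3)%:R - s' - ((4 * i + c + 3)%:R - s)) =
      (4 * i + c + 3)%:R - (s + w * (s' - s)) :> R by ring.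
    by apply: strip_pair => //; nra.
- by move=> q [_ /gy].
- by move=> q q' [_ Aq] [_ Aq']; exact: HA.
Unshelve. all: end_near. Qed.

Hypothesis Hgen : forall (i : nat) (c : bool), (i < l)%N ->
  H (L ((4 * i + c)%:R + 2^-1) / L ((4 * i + c)%:R + 5 / 2))%g.

Lemma Hgen_int (i : int) (c : bool) :
  H (L (4 * i%:~R + c%:R + 2^-1) / L (4 * i%:~R + c%:R + 5 / 2))%g.
Proof.
have l0 : (l%:Z != 0) by rewrite eqz_nat -lt0n.
have [j jl ji] : exists2 j : nat, (j < l)%N & i = (i %/ l)%Z * l%:Z + j%:Z.
  exists `|(i %% l)%Z|%N.
    by rewrite -ltz_nat gez0_abs ?modz_ge0 // ltz_pmod.
  by rewrite gez0_abs ?modz_ge0 // -divz_eq.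
have e (t : R) : lam (1, 4 * i%:~R + t) = lam (1, 4 * j%:R + t).
  rewrite -(lam_periodicz 1 (4 * j%:R + t) (i %/ l)%Z); congr (lam (_, _)).
  by rewrite [in LHS]ji rmorphD rmorphM /= natrM; ring.
rewrite -!addrA !e; have := Hgen c jl.
by rewrite natrD natrM -!addrA.
Qed.

(** Let c_0, ..., c_4 be the values at the corners of a block of four sides. The gluings give
    c_0/c_3 = c_1/c_2 = a and c_1/c_4 = c_2/c_3 = b, so quotients of consecutive values are words in
    a and b. *)
Lemma H_corners (k k' : int) : H (L k%:~R / L k'%:~R)%g.
Proof.
have Hstep (n : int) : H (L n%:~R / L (n%:~R + 1))%g.
  have := divz_eq n 4; set i := (n %/ 4)%Z.
  have /andP[m0 m4] : 0 <= (n %% 4)%Z < 4 by rewrite modz_ge0 // ltz_pmod.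
  move: (n %% 4)%Z m0 m4 => m m0 m4 ->.
  pose c (j : R) := L (4 * i%:~R + j).
  have Ha := Hgen_int i false; have Hb := Hgen_int i true.
  set a := (_ / _)%g in Ha; set b := (_ / _)%g in Hb.
  have i0 : 0 <= (0 : R) <= 1 by rewrite lexx ler01.
  have i1 : 0 <= (1 : R) <= 1 by rewrite lexx ler01.
  have e03 : (c 0 / c 3 = a)%g.
    by rewrite /a -(lam_pair i false i0) /= /c; congr (L _ / L _)%g; ring.
  have e12 : (c 1%R / c 2 = a)%g.
    by rewrite /a -(lam_pair i false i1) /= /c; congr (L _ / L _)%g; ring.
  have e14 : (c 1%R / c 4 = b)%g.
    by rewrite /b -(lam_pair i true i0) /= /c; congr (L _ / L _)%g; ring.
  have e23 : (c 2 / c 3 = b)%g.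
    by rewrite /b -(lam_pair i true i1) /= /c; congr (L _ / L _)%g; ring.
  have d12 : H (c 1%R / c 2)%g by rewrite e12.
  have d23 : H (c 2 / c 3)%g by rewrite e23.
  have d01 : H (c 0 / c 1%R)%g.
    rewrite -(divgKA (c 3)) -(divgKA (c 2) (c 3)) e03 -invgF e23 -[(c 2 / c 1%R)%g]invgF e12.
    exact: (HM Ha (HM (HV Hb) (HV Ha))).
  have d34 : H (c 3 / c 4)%g.
    rewrite -(divgKA (c 2)) -(divgKA (c 1%R) (c 2)) e14 -[(c 3 / c 2)%g]invgF e23 -[(c 2 / c 1%R)%g]invgF e12.
    exact: (HM (HV Hb) (HM (HV Ha) Hb)).
  have : [|| m == 0, m == 1, m == 2 | m == 3] by lia.
  have E (v : R) (w : int) : H (c w%:~R / c (w%:~R + 1))%g ->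
      H (L ((i * 4 + w)%:~R) / L ((i * 4 + w)%:~R + 1))%g.
    by rewrite /c rmorphD rmorphM /= mulrC addrA.
  case/or4P => /eqP ->; apply: (E 0) => /=.
  - by rewrite add0r.
  - by have -> : 1%:~R + 1 = 2 :> R by lra.
  - by have -> : 2%:~R + 1 = 3 :> R by lra.
  - by have -> : 3%:~R + 1 = 4 :> R by lra.
have Hn (n : nat) (k0 : int) : H (L k0%:~R / L (k0%:~R + n%:R))%g.
  elim: n => [|n IH]; first by rewrite addr0 mulgV.
  have := HM IH (Hstep (k0 + n%:Z)).
  by rewrite rmorphD /= divgKA -natr1 addrA.
have [kk|kk] := leP k k'.
  have [n ->] : exists n : nat, k' = k + n%:Z by exists `|k' - k|%N; lia.
  by rewrite rmorphD; exact: Hn.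
have [n ->] : exists n : nat, k = k' + n%:Z by exists `|k - k'|%N; lia.
by rewrite rmorphD -invgF; apply: HV; exact: Hn.
Qed.

Lemma corner_eq (k : int) : S (1, k%:~R) = S (1, 0).
Proof.
have step (n : int) : S (1, n%:~R) = S (1, n%:~R + 1).
  have := divz_eq n 4; set i := (n %/ 4)%Z.
  have /andP[m0 m4] : 0 <= (n %% 4)%Z < 4 by rewrite modz_ge0 // ltz_pmod.
  move: (n %% 4)%Z m0 m4 => m m0 m4 ->.
  have i0 : 0 <= (0 : R) <= 1 by rewrite lexx ler01.
  have i1 : 0 <= (1 : R) <= 1 by rewrite lexx ler01.
  have [e03 e14] := glued_int l_gt0 i gS i0.
  have [e12 e23] := glued_int l_gt0 i gS i1.
  pose c (j : R) := S (1, 4 * i%:~R + j).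
  have {}e03 : c 0 = c 3 by rewrite /c e03; congr (S (1, _)); ring.
  have {}e12 : c 1 = c 2 by rewrite /c e12; congr (S (1, _)); ring.
  have {}e14 : c 1 = c 4 by move: e14; rewrite addr0 subr0.
  have {}e23 : c 2 = c 3.
    move: e23; have -> : 4 * i%:~R + 1 + 1 = 4 * i%:~R + 2 :> R by ring.
    by have -> : 4 * i%:~R + 4 - 1 = 4 * i%:~R + 3 :> R by ring.
  have : [|| m == 0, m == 1, m == 2 | m == 3] by lia.
  have E (v : R) (w : int) : c w%:~R = c (w%:~R + 1) ->
      S (1, (i * 4 + w)%:~R) = S (1, (i * 4 + w)%:~R + 1).
    by rewrite /c rmorphD rmorphM /= mulrC addrA.
  case/or4P => /eqP ->; apply: (E 0) => /=.
  - by rewrite add0r e03 -e23 -e12.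
  - by have -> : 1%:~R + 1 = 2 :> R by lra.
  - by have -> : 2%:~R + 1 = 3 :> R by lra.
  - by rewrite -[c 3%:~R]e23 -e12 e14; congr (c _); lra.
have nat_case (n : nat) (k0 : int) : S (1, k0%:~R) = S (1, k0%:~R + n%:R).
  elim: n => [|n ->]; first by rewrite addr0.
  by have := step (k0 + n%:Z); rewrite rmorphD /= => ->; rewrite -natr1 addrA.
case: k => n; first by have := nat_case n 0; rewrite add0r.
by rewrite NegzE (nat_case n.+1) mulrNz -pmulrn addNr.
Qed.

(** The condition says that t + 1/2 is not an integer, that is, t is not the midpoint of a side;
    then the nearest corner [fl (t + 2^-1)] is locally constant. All corners are one point of the
    surface. *)
Lemma corner_local (u : R -> X) : continuous u ->
  forall p t, 0 < p.1 -> fl (p.2 + 2^-1) < p.2 + 2^-1 -> S p = u t ->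
  exists2 e, 0 < e & forall a b, t - e < a -> a <= t -> t <= b -> b < t + e ->
    in_H u a b.
Proof.
apply: (@rim_local (fun t => fl (t + 2^-1) < t + 2^-1) (fun t => fl (t + 2^-1)) (S (1, 0))).
- move=> t /floor_near nt.
  have : {for t, continuous (fun t : R => t + 2^-1)}.
    by apply: continuousDr; [exact: id_continuous_real|exact: cst_continuous_real].
  move=> /(_ _ nt) {}nt.
  have {}nt : \forall t' \near t, fl (t' + 2^-1) = fl (t + 2^-1) /\
      fl (t' + 2^-1) < t' + 2^-1 by exact: nt.
  by near=> t'; have [] : fl (t' + 2^-1) = fl (t + 2^-1) /\
      fl (t' + 2^-1) < t' + 2^-1 by near: t'.
- by move=> t; rewrite addrAC floor_period ltrD2r.
- by move=> t _; rewrite addrAC floor_period.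
- move=> i c s il s01; set n := (4 * i + c)%N.
  have n3 : (n + 3)%:R = n%:R + 3 :> R by rewrite natrD.
  have [s2|s2|->] := ltgtP s 2^-1.
  + rewrite (@floor_natP n); last by lra.
    by rewrite (@floor_natP (n + 3)) ?n3; [apply/propext; split; lra|lra].
  + have n1 : n.+1%:R = n%:R + 1 :> R by rewrite natr1.
    have n2 : n.+2%:R = n%:R + 2 :> R by rewrite -natr1 n1; lra.
    rewrite (@floor_natP n.+1) ?n1; last by lra.
    by rewrite (@floor_natP n.+2) ?n3 ?n2; [apply/propext; split; lra|lra].
  + have n1 : n.+1%:R = n%:R + 1 :> R by rewrite natr1.
    rewrite (@floor_natP n.+1) ?n1; last by lra.
    by rewrite (@floor_natP (n + 3)) ?n3; [apply/propext; split; lra|lra].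
- move=> i c s il s01; set n := (4 * i + c)%N.
  have n3 : (n + 3)%:R = n%:R + 3 :> R by rewrite natrD.
  have n1 : n.+1%:R = n%:R + 1 :> R by rewrite natr1.
  have n2 : n.+2%:R = n%:R + 2 :> R by rewrite -natr1 n1; lra.
  have [s2|s2|->] := ltgtP s 2^-1 => ns.
  + exists 0; first by lra.
    rewrite (@floor_natP n); last by lra.
    by rewrite (@floor_natP (n + 3)) ?n3; [split|]; lra.
  + exists 1; first by lra.
    rewrite (@floor_natP n.+1) ?n1; last by lra.
    by rewrite (@floor_natP n.+2) ?n3 ?n2; [split|]; lra.
  + by move: ns; rewrite (@floor_natP n.+1) ?n1; lra.
- move=> t _; apply: (corner_eq (Num.floor (t + 2^-1))).
- by move=> t t' _ _; exact: H_corners.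
Unshelve. all: end_near. Qed.

Lemma floor_side (n : nat) (s : R) : 0 <= s <= 1 ->
  [/\ (fl (n%:R + s) < n%:R + s) = (0 < s < 1),
      (fl ((n + 3)%:R - s) < (n + 3)%:R - s) = (0 < s < 1),
      0 < s < 1 -> fl (n%:R + s) = n%:R &
      0 < s < 1 -> fl ((n + 3)%:R - s) = n%:R + 2].
Proof.
move=> s01.
have n3 : (n + 3)%:R = n%:R + 3 :> R by rewrite natrD.
have n1 : n.+1%:R = n%:R + 1 :> R by rewrite natr1.
have n2 : n.+2%:R = n%:R + 2 :> R by rewrite -natr1 n1; lra.
have [s0|s0] := leP s 0.
  have -> : s = 0 by lra.
  rewrite (@floor_natP n); last by lra.
  by rewrite (@floor_natP (n + 3)) ?n3; [split|]; lra.
have [s1|s1] := leP 1 s.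
  have -> : s = 1 by lra.
  rewrite (@floor_natP n.+1) ?n1; last by lra.
  by rewrite (@floor_natP n.+2) ?n3 ?n2; [split|]; lra.
rewrite (@floor_natP n); last by lra.
by rewrite (@floor_natP n.+2) ?n3 ?n2; [split|]; lra.
Qed.

Lemma sector_glued : glued (fun p : R * R => 0 < p.1 /\ fl p.2 < p.2).
Proof.
apply: glued_pair => /=.
- by move=> r v r1; apply/propext; split => -[? ?]; split => //; lra.
- by move=> r v r0; apply/propext; split => -[? ?]; lra.
- by move=> r v; rewrite floor_period ltrD2r.
- by move=> i c s il s01; have [-> -> _ _] := floor_side (4 * i + c) s01.
Qed.

(** [f] is the coset of [H] through the value at the midpoint of the side. By [Hgen] it agrees on
    glued sides, so as a set-valued function it descends to the surface. *)
Lemma H_sides (t t' : R) : S (1, fl t + 2^-1) = S (1, fl t' + 2^-1) ->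
  H (L (fl t + 2^-1) / L (fl t' + 2^-1))%g.
Proof.
pose f (p : R * R) := [set h | H (L (fl p.2 + 2^-1) / h)%g].
have gf : glued (fun p => if `[< 0 < p.1 /\ fl p.2 < p.2 >] then f p else set0).
  apply: glued_chart => //=; first exact: sector_glued.
  - by move=> r v r0 [r1 _]; exfalso; move: r1 => /=; lra.
  - move=> r v _; rewrite /f /= floor_period.
    by have := lam_periodicz 1 (fl v + 2^-1) 1; rewrite mul1r addrAC => ->.
  - move=> i c s il s01 [_ /= fs]; have [e1 _ e3 e4] := floor_side (4 * i + c) s01.
    have {}fs : 0 < s < 1 by rewrite -e1.
    rewrite /f /= e3 // e4 //.
    have := Hgen c il; have -> : (4 * i + c)%:R + 5 / 2 = (4 * i + c)%:R + 2 + 2^-1 :> R by lra.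
    move=> Hic; apply/seteqP; split=> h /= Hh.
      by rewrite -(divgKA (L ((4 * i + c)%:R + 2^-1))); apply: HM Hh; rewrite -invgF; apply: HV.
    by rewrite -(divgKA (L ((4 * i + c)%:R + 2 + 2^-1))); apply: HM Hh.
have fm v : fl (fl v + 2^-1) = fl v.
  have -> // : Num.floor (fl v + 2^-1) = Num.floor v.
  by apply: floor_def; rewrite rmorphD /=; lra.
move=> /(strip_descent l_gt0 gf) /=; rewrite !fm.
have A v : `[< 0 < (1 : R) /\ fl v < fl v + 2^-1 >] by apply/asboolP; split; lra.
rewrite !A => /(congr1 (fun B => B (L (fl t' + 2^-1)))) /=.
by rewrite /f /= !fm mulgV => ->.
Qed.

(** Different pairs of sides retract to different midpoints, whereas [rim_local] has a single
    target. The chart therefore keeps only the sectors whose midpoint lies over that of the given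
    point. *)
Lemma side_local (u : R -> X) : continuous u ->
  forall p t, 0 < p.1 -> fl p.2 < p.2 -> S p = u t ->
  exists2 e, 0 < e & forall a b, t - e < a -> a <= t -> t <= b -> b < t + e ->
    in_H u a b.
Proof.
move=> cu p t p1 p2; pose y0 := S (1, fl p.2 + 2^-1).
apply: (@rim_local [set v | fl v < v /\ S (1, fl v + 2^-1) = y0] (fun v => fl v + 2^-1) y0) => //.
- move=> v [/floor_near nv yv].
  near=> v'; have [e vv] : fl v' = fl v /\ fl v' < v' by near: v'.
  by rewrite /= e; move: vv; rewrite e; split.
- move=> v; apply/propext => /=; rewrite floor_period addrAC (glued_periodic gS).
  by rewrite ltrD2r.
- by move=> v _; rewrite floor_period addrAC.
- move=> i c s il s01; apply/propext => /=.
  have [e1 e2 e3 e4] := floor_side (4 * i + c) s01.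
  rewrite e1 e2; have [s0|] := boolP (0 < s < 1); last by split=> -[].
  rewrite e3 // e4 //.
  have h01 : 0 <= (2^-1 : R) <= 1 by lra.
  rewrite (strip_pair c il h01).
  by have -> : (4 * i + c + 3)%:R - 2^-1 = (4 * i + c)%:R + 2 + 2^-1 :> R by rewrite natrD; lra.
- move=> i c s il s01 [/= fs _]; have [e1 e2 e3 e4] := floor_side (4 * i + c) s01.
  rewrite e1 in fs; exists (2^-1); first by lra.
  rewrite e3 // e4 //; split => //.
  by rewrite natrD; lra.
- by move=> v [].
- by move=> v v' [_ /= ev] [_ /= ev']; apply: H_sides; rewrite ev ev'.
Unshelve. all: end_near. Qed.

Lemma strip_generation (g : pi1 R x) : H g.
Proof.
have [z zx] := strip_surj l_gt0 x.
have Hloop (p : {path (I01 R) from x to x}) :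
    H (lam z * theta (p \o @clamp R) / lam z)%g.
  have cp : continuous (p \o @clamp R).
    by move=> t; apply: continuous_comp; [exact: clamp_continuous|exact: cts_fun].
  have -> : p \o @clamp R = restr (p \o @clamp R) 0 1.
    by apply/funext => s; rewrite /restr add0r subr0 mulr1.
  suff : in_H (p \o @clamp R) 0 1.
    by move=> Hin; apply: Hin; rewrite zx /=; [rewrite clamp_le0 ?path_zero|rewrite clamp_ge1 ?path_one].
  apply: cousin ler01 => [a m b _ _|t]; first exact: in_H_add.
  have [[r v] pt] := strip_surj l_gt0 ((p \o @clamp R) t).
  have [r1|r1] := ltP r 1; first exact: (center_local cp (p := (r, v))).
  have [v1|v1] := ltP (fl v) v.
    by apply: (side_local cp (p := (r, v))) => //=; lra.
  apply: (corner_local cp (p := (r, v))) => //=; first by lra.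
  have /andP[fv _] := floor_itv v; have vE : v = fl v by lra.
  have -> : Num.floor (v + 2^-1) = Num.floor v.
    by apply: floor_def; rewrite rmorphD /=; lra.
  by rewrite -vE; lra.
(* Closing up a loop conjugates its class by [k]. The loop is taken in the class conjugated back, so
   that exactly [g] comes out. *)
pose k := (lam z * pi1_class (d x))%g.
have := Hloop (pi1_repr (k^-1 * g * k)%g).
rewrite theta_loop pi1_reprK -[pi1_class (d x)](mulKg (lam z)) -/k.
by rewrite !invgM !invgK !mulgA !(mulgV, mul1g, mulgK, mulgVK).
Qed.

End Generation.

(** * Flat bundles and their holonomy *)

Section Lifts.
Context {R : realType} {X : topologicalType} {K : groupType} {J : Type}.
Variables (U : J -> set X) (g : J -> X -> K).
Hypothesis U_open : forall i, open (U i).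
Hypothesis U_cover : forall y, exists i, U i y.
Hypothesis g_trans : forall i j y, U i y -> U j y ->
  \forall z \near y, ((g i z)^-1 * g j z = (g i y)^-1 * g j y)%g.
Local Notation I := (I01 R).

(* The [g i] are the discontinuous trivialisations of a flat [K]-bundle; a lift
   of [h] is a section of its pullback that is locally constant in each of them. *)
Definition is_lift (Y : topologicalType) (h : Y -> X) (s : Y -> K) : Prop :=
  forall y, exists2 i, U i (h y) &
    \forall z \near y, (s z * g i (h z) = s y * g i (h y))%g.

Lemma lift_chart (Y : topologicalType) (h : Y -> X) (s : Y -> K) y i :
  continuous h -> is_lift h s -> U i (h y) ->
  \forall z \near y, (s z * g i (h z) = s y * g i (h y))%g.
Proof.
move=> ch hs Ui; have [j Uj sj] := hs y.
have gji : \forall z \near y, ((g j (h z))^-1 * g i (h z) = (g j (h y))^-1 * g i (h y))%g.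
  exact: (ch y _ (g_trans Uj Ui)).
near=> z.
have e1 : (s z * g j (h z) = s y * g j (h y))%g by near: z.
have e2 : ((g j (h z))^-1 * g i (h z) = (g j (h y))^-1 * g i (h y))%g by near: z.
by rewrite -[X in (s z * X)%g](mulVKg (g j (h z))) mulgA e1 e2 -mulgA mulVKg.
Unshelve. all: end_near. Qed.

Lemma lift_comp (Y Z : topologicalType) (h : Y -> X) (s : Y -> K) (f : Z -> Y) :
  continuous f -> is_lift h s -> is_lift (h \o f) (s \o f).
Proof.
move=> cf hs z; have [i Ui si] := hs (f z); exists i => //.
exact: (cf z _ si).
Qed.

Lemma lift_scale (Y : topologicalType) (h : Y -> X) (s : Y -> K) (k : K) :
  is_lift h s -> is_lift h (fun y => k * s y)%g.
Proof.
move=> hs y; have [i Ui si] := hs y; exists i => //.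
by near=> z; rewrite -!mulgA; congr (k * _)%g; near: z.
Unshelve. all: end_near. Qed.

Lemma lift_cst (Y : topologicalType) (y : X) : is_lift (fun _ : Y => y) (fun=> 1%g).
Proof. by move=> z; have [i Ui] := U_cover y; exists i => //; near=> w. Unshelve. all: end_near. Qed.

Lemma locally_constant (T : Type) (f : R -> T) :
  (forall t, \forall t' \near t, f t' = f t) -> forall a b, f a = f b.
Proof.
move=> lf; suff le a b : a <= b -> f a = f b.
  by move=> a b; have [/le|/ltW/le] := leP a b.
apply: (@cousin R (fun a b => f a = f b)) => [{}a m {}b _ _ -> //|t].
have /nbhs_ballP[e /= e0 fe] := lf t; exists e => // {}a {}b ta a_t tb bt.
transitivity (f t); [|symmetry]; apply: fe; rewrite /ball /= ltr_norml; lra.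
Qed.

Lemma lift_uniq (u : R -> X) (s s' : R -> K) : continuous u ->
  is_lift u s -> is_lift u s' -> forall a b, ((s a)^-1 * s b = (s' a)^-1 * s' b)%g.
Proof.
move=> cu us us' a b.
have : (s' a / s a = s' b / s b)%g.
  apply: (@locally_constant _ (fun t => s' t / s t)%g) => t.
  have [i Ui] := U_cover (u t).
  have ns := lift_chart cu us Ui; have ns' := lift_chart cu us' Ui.
  near=> z.
  have e : (s z * g i (u z) = s t * g i (u t))%g by near: z.
  have e' : (s' z * g i (u z) = s' t * g i (u t))%g by near: z.
  by rewrite -(mulgKA (g i (u z))) e e' mulgKA.
move=> /(congr1 (fun k => (s' a)^-1 * k * s b)%g).
by rewrite !mulgA mulVg mul1g mulgVK => ->.
Unshelve. all: end_near. Qed.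

Lemma lift_paste (Y : topologicalType) (f : Y -> R) (m : R) (h h1 h2 : Y -> X)
    (s1 s2 : Y -> K) : continuous f -> continuous h1 -> continuous h2 ->
  (forall y, f y <= m -> h y = h1 y) -> (forall y, m <= f y -> h y = h2 y) ->
  (forall y, f y = m -> s1 y = s2 y) ->
  is_lift h1 s1 -> is_lift h2 s2 ->
  is_lift h (fun y => if f y <= m then s1 y else s2 y).
Proof.
move=> cf c1 c2 e1 e2 e12 l1 l2 y.
have [fy|fy|fy] := ltgtP (f y) m.
- have [i Ui si] := l1 y; exists i; first by rewrite e1 // ltW.
  have nf : \forall z \near y, f z < m by exact: (cf y _ (lt_nbhsl fy)).
  near=> z; have fz : f z < m by near: z.
  by rewrite (ltW fz) !e1 ?ltW //; near: z.
- have [i Ui si] := l2 y; exists i; first by rewrite e2 // ltW.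
  have nf : \forall z \near y, m < f z by exact: (cf y _ (lt_nbhsr fy)).
  near=> z; have fz : m < f z by near: z.
  by rewrite leNgt fz /= !e2 ?ltW //; near: z.
- have [i Ui] := U_cover (h y); exists i => //.
  have U1 : U i (h1 y) by rewrite -e1 ?fy.
  have U2 : U i (h2 y) by rewrite -e2 ?fy.
  have n1 := lift_chart c1 l1 U1; have n2 := lift_chart c2 l2 U2.
  near=> z; have [fz|/ltW fz] := leP (f z) m.
    by rewrite (e1 z) // (e1 y) ?fy //; near: z.
  by rewrite (e2 z) // (e2 y) ?fy // e12 //; near: z.
Unshelve. all: end_near. Qed.

Definition cl (a b v : R) : R := Num.max a (Num.min v b).

Lemma cl_continuous a b : continuous (cl a b).
Proof.
apply: max_continuous_real; first exact: cst_continuous_real.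
by apply: min_continuous_real; [exact: id_continuous_real|exact: cst_continuous_real].
Qed.

Lemma cl_le a m b v : a <= m -> m <= b -> v <= m -> cl a b v = cl a m v.
Proof. by move=> am mb vm; rewrite /cl (min_idPl vm) (min_idPl (le_trans vm mb)). Qed.

Lemma cl_ge a m b v : a <= m -> m <= b -> m <= v -> cl a b v = cl m b v.
Proof.
move=> am mb mv; have mw : m <= Num.min v b by rewrite le_min mv.
by rewrite /cl (max_idPr mw) (max_idPr (le_trans am mw)).
Qed.

Lemma cl_itv a b v : a <= b -> a <= cl a b v <= b.
Proof. by move=> ab; rewrite /cl le_max lexx /= ge_max ab ge_min lexx orbT. Qed.

Lemma cl_id a b v : a <= v <= b -> cl a b v = v.
Proof. by move=> /andP[av vb]; rewrite /cl (min_idPl vb) (max_idPr av). Qed.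

Definition box (a b c d : R) (p : R * R) : R * R := (cl a b p.1, cl c d p.2).

Lemma box_continuous a b c d : continuous (box a b c d).
Proof.
by apply: pair_continuous => p; apply: continuous_comp;
  [exact: fst_continuous|exact: cl_continuous|exact: snd_continuous|exact: cl_continuous].
Qed.

(** Restriction to a rectangle is expressed by composing with the retraction of the plane onto it,
    which avoids subspaces. *)
Definition box_lift (F : R * R -> X) (a b c d : R) : Prop :=
  exists s : R * R -> K, is_lift (F \o box a b c d) s.

Lemma box_lift_paste1 F a m b c d : continuous F -> a <= m -> m <= b ->
  box_lift F a m c d -> box_lift F m b c d -> box_lift F a b c d.
Proof.
move=> cF am mb [s1 l1] [s2 l2].
have cFb a' b' c' d' : continuous (F \o box a' b' c' d').
  by move=> p; apply: continuous_comp; [exact: box_continuous|exact: cF].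
have cm : continuous (fun t : R => (m, t)).
  by apply: pair_continuous; [exact: cst_continuous_real|exact: id_continuous_real].
(* By uniqueness the two lifts differ along the common edge by a constant left factor, which is
   normalized at (m, 0). *)
have sm t : (s1 (m, 0) / s2 (m, 0) * s2 (m, t) = s1 (m, t))%g.
  have -> : (s1 (m, t) = s1 (m, 0) * ((s1 (m, 0))^-1 * s1 (m, t)))%g by rewrite mulVKg.
  rewrite -mulgA; congr (_ * _)%g.
  apply: (@lift_uniq (fun t => F (m, cl c d t)) (fun t => s2 (m, t)) (fun t => s1 (m, t))).
  - move=> v; apply: (@continuous_comp _ _ _ (fun v => (m, cl c d v)) F); last exact: cF.
    by apply: for_pair_continuous; [exact: cst_continuous_real|exact: cl_continuous].
  - have -> : (fun t => F (m, cl c d t)) = (F \o box m b c d) \o (fun t => (m, t)).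
      by apply/funext => v; rewrite /= /box /= (@cl_id m b) // lexx.
    exact: (lift_comp cm l2).
  - have -> : (fun t => F (m, cl c d t)) = (F \o box a m c d) \o (fun t => (m, t)).
      by apply/funext => v; rewrite /= /box /= (@cl_id a m) // lexx am.
    exact: (lift_comp cm l1).
eexists; apply: (@lift_paste _ fst m _ (F \o box a m c d) (F \o box m b c d) s1
  (fun p => s1 (m, 0) / s2 (m, 0) * s2 p)%g) => //.
- exact: fst_continuous.
- by move=> [v w] /= vm; rewrite /box /= (cl_le am mb vm).
- by move=> [v w] /= vm; rewrite /box /= (cl_ge am mb vm).
- by move=> [v w] /= ->; rewrite sm.
- exact: lift_scale.
Qed.

Lemma box_lift_swap F a b c d :
  box_lift F a b c d -> box_lift (F \o (fun p => (p.2, p.1))) c d a b.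
Proof.
move=> [s ls]; exists (s \o (fun p => (p.2, p.1))).
have csw : continuous (fun p : R * R => (p.2, p.1)).
  by apply: pair_continuous; [exact: snd_continuous|exact: fst_continuous].
exact: (lift_comp csw ls).
Qed.

Lemma box_lift_paste2 F a b c m d : continuous F -> c <= m -> m <= d ->
  box_lift F a b c m -> box_lift F a b m d -> box_lift F a b c d.
Proof.
move=> cF cm md /box_lift_swap l1 /box_lift_swap l2.
have := box_lift_swap (box_lift_paste1 _ cm md l1 l2).
have -> : (F \o (fun p => (p.2, p.1))) \o (fun p : R * R => (p.2, p.1)) = F.
  by apply/funext => -[].
apply; move=> p; apply: continuous_comp; last exact: cF.
by apply: pair_continuous; [exact: snd_continuous|exact: fst_continuous].
Qed.

Lemma box_lift_local F (t v : R) : continuous F -> exists2 e, 0 < e &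
  forall a b c d, t - e < a -> a <= t -> t <= b -> b < t + e ->
    v - e < c -> c <= v -> v <= d -> d < v + e -> box_lift F a b c d.
Proof.
move=> cF; have [i Ui] := U_cover (F (t, v)).
have [e /= e0 eF] : exists2 e : R, 0 < e & ball (t, v) e `<=` F @^-1` U i.
  by apply/nbhs_ballP; apply: cF; exact: open_nbhs_nbhs.
exists e => // a b c d ta at_ tb bt vc cv vd dv.
have UF p : U i (F (box a b c d p)).
  apply: eF; have := @cl_itv a b p.1; have := @cl_itv c d p.2 => h2 h1.
  by split; rewrite /ball /= ltr_norml; lra.
exists (fun p => (g i (F (box a b c d p)))^-1)%g => p; exists i; first exact: UF.
by near=> q; rewrite !mulVg.
Unshelve. all: end_near. Qed.

Lemma box_lift_exists F a b c d : continuous F -> a <= b -> c <= d -> box_lift F a b c d.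
Proof.
move=> cF ab cd.
apply: (@cousin R (fun c d => box_lift F a b c d)) cd => [c' m d' cm md|v].
  exact: box_lift_paste2.
(* For a fixed height [v] the property carries its own bandwidth [e]. Adding horizontal intervals
   takes the smaller bandwidth, and the result is the local hypothesis for the vertical
   direction. *)
apply: (@cousin R (fun a b => exists2 e, 0 < e & forall c d, v - e < c -> c <= v ->
   v <= d -> d < v + e -> box_lift F a b c d)) ab => [a' m b' am mb [e e0 he] [e' e'0 he']|t].
  exists (Num.min e e'); first by rewrite lt_min e0.
  move=> c' d'; have m1 : Num.min e e' <= e by rewrite ge_min lexx.
  have m2 : Num.min e e' <= e' by rewrite ge_min lexx orbT.
  by move=> *; apply: (box_lift_paste1 cF am mb); [apply: he|apply: he']; lra.
have [e e0 he] := box_lift_local t v cF; exists e => // a' b' *.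
by exists e => // c' d' *; apply: he.
Qed.

Lemma lift_exists (u : R -> X) : continuous u ->
  exists s, is_lift (u \o (fun t => val (clamp t))) s.
Proof.
move=> cu; have cF : continuous (fun p : R * R => u p.1).
  by move=> p; apply: (continuous_comp (f := fst)); [exact: fst_continuous|exact: cu].
have [s ls] := box_lift_exists cF ler01 ler01.
exists (s \o (fun t => (t, 0))).
have c0 : continuous (fun t : R => (t, 0 : R)).
  by apply: pair_continuous; [exact: id_continuous_real|exact: cst_continuous_real].
exact: (lift_comp c0 ls).
Qed.

Let vcl (t : R) : R := val (clamp t).

Lemma vcl_continuous : continuous vcl.
Proof. by move=> t; apply: (@continuous_comp _ _ _ (@clamp R)); [exact: clamp_continuous|exact: val01_continuous]. Qed.

(** Parallel transport along [u]; by [lift_uniq] it does not depend on the lift. *)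
Definition tau (u : R -> X) : K :=
  match pselect (continuous u) with
  | left cu => let s := projT1 (cid (lift_exists cu)) in ((s 0)^-1 * s 1%R)%g
  | right _ => 1%g
  end.

Lemma tau_vcl (u : R -> X) s : continuous u -> is_lift (u \o vcl) s ->
  tau u = ((s 0)^-1 * s 1%R)%g.
Proof.
move=> cu us; rewrite /tau; case: pselect => // {}cu.
apply: (@lift_uniq (u \o vcl)) => //; last exact: projT2 (cid (lift_exists cu)).
by move=> t; apply: continuous_comp; [exact: vcl_continuous|exact: cu].
Qed.

Lemma tau_lift (u : R -> X) s : continuous u -> is_lift u s ->
  tau u = ((s 0)^-1 * s 1%R)%g.
Proof.
move=> cu us; rewrite (tau_vcl cu (lift_comp vcl_continuous us)) /=.
by rewrite /vcl clamp_le0 // clamp_ge1.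
Qed.

Definition tau_path (y z : X) (p : {path I from y to z}) : K := tau (p \o @clamp R).

Lemma path_clamp_continuous (y z : X) (p : {path I from y to z}) :
  continuous (p \o @clamp R).
Proof. by move=> t; apply: continuous_comp; [exact: clamp_continuous|exact: cts_fun]. Qed.

Lemma tau_pathE (y z : X) (p : {path I from y to z}) :
  exists2 s, is_lift (p \o @clamp R) s & tau_path p = ((s 0)^-1 * s 1%R)%g.
Proof.
have [s ls] := lift_exists (@path_clamp_continuous _ _ p); exists s.
  by move: ls; congr is_lift; apply/funext => t; exact: (congr1 p (clamp_val (clamp t))).
exact: tau_vcl (@path_clamp_continuous _ _ p) ls.
Qed.

Lemma lift_of_cst (y : X) (s : R -> K) : is_lift (fun=> y) s -> s 0 = s 1.
Proof.
move=> ls; apply: (@mulgI _ (s 0)^-1)%g; rewrite mulVg.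
have cy : continuous (fun _ : R => y) by move=> t; exact: cvg_cst.
by have := lift_uniq cy ls (@lift_cst R y) 0 1; rewrite mulVg => ->.
Qed.

Lemma tau_homotopic (y z : X) (p q : {path I from y to z}) :
  path_homotopic p q -> tau_path p = tau_path q.
Proof.
move=> [H [cH H0 H1 Hy Hz]].
have cF : continuous (fun v : R * R => H (clamp v.1, clamp v.2)).
  move=> v; apply: (@continuous_comp _ _ _ (fun v : R * R => (clamp v.1, clamp v.2)) H); last exact: cH.
  by apply: for_pair_continuous; apply: continuous_comp;
    [exact: fst_continuous|exact: clamp_continuous|exact: snd_continuous|exact: clamp_continuous].
have [s0 ls0] := box_lift_exists cF ler01 ler01.
have ls : is_lift (fun v : R * R => H (clamp v.1, clamp v.2)) s0.
  move: ls0; congr is_lift; apply/funext => -[v w] /=.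
  by rewrite -[cl 0 1 v]/(val (clamp v)) -[cl 0 1 w]/(val (clamp w)) !clamp_val.
have c1 (a : R) : continuous (fun t : R => (a, t)).
  by apply: pair_continuous; [exact: cst_continuous_real|exact: id_continuous_real].
have c2 (a : R) : continuous (fun t : R => (t, a)).
  by apply: pair_continuous; [exact: id_continuous_real|exact: cst_continuous_real].
have -> : tau_path p = ((s0 (0, 0)%R)^-1 * s0 (0, 1)%R)%g.
  apply: (tau_lift (s := s0 \o (fun t => (0, t)))); first exact: path_clamp_continuous.
  by move: (lift_comp (c1 0) ls); congr is_lift; apply/funext => t; rewrite /= clamp_le0.
have -> : tau_path q = ((s0 (1, 0)%R)^-1 * s0 (1, 1)%R)%g.
  apply: (tau_lift (s := s0 \o (fun t => (1, t)))); first exact: path_clamp_continuous.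
  by move: (lift_comp (c1 1) ls); congr is_lift; apply/funext => t; rewrite /= clamp_ge1.
congr (_^-1 * _)%g.
  apply: (@lift_of_cst y (s0 \o (fun t => (t, 0)))).
  by move: (lift_comp (c2 0) ls); congr is_lift; apply/funext => t; rewrite /= (@clamp_le0 _ 0).
apply: (@lift_of_cst z (s0 \o (fun t => (t, 1)))).
by move: (lift_comp (c2 1) ls); congr is_lift; apply/funext => t; rewrite /= (@clamp_ge1 _ 1).
Qed.

Lemma tau_concat (y z w : X) (p : {path I from y to z}) (q : {path I from z to w}) :
  tau_path (path_concat p q) = (tau_path p * tau_path q)%g.
Proof.
have [s ls ->] := tau_pathE (path_concat p q).
have cd (b : R) : continuous (fun t : R => (b + vcl t) / 2).
  apply: continuousMr; last exact: cst_continuous_real.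
  by apply: continuousDr; [exact: cst_continuous_real|exact: vcl_continuous].
have v01 t : 0 <= vcl t <= 1 by exact: I01_bound.
have -> : tau_path p = ((s 0)^-1 * s (2^-1)%R)%g.
  have l1 : is_lift (p \o @clamp R) (s \o (fun t => (0 + vcl t) / 2)).
    move: (lift_comp (cd 0) ls); congr is_lift; apply/funext => t.
    rewrite [LHS]/= path_concatE; have := v01 t.
    rewrite val_clamp ?add0r; last by have := v01 t; lra.
    move=> vt; rewrite ifT; last by lra.
    have -> : 2 * (vcl t / 2) = vcl t by lra.
    by rewrite /vcl clamp_val.
  rewrite /tau_path (tau_lift (@path_clamp_continuous _ _ p) l1) /= /vcl clamp_le0 // clamp_ge1 //.
  by rewrite val_zero01 val_one01 !add0r mul0r mul1r.
have -> : tau_path q = ((s (2^-1)%R)^-1 * s 1%R)%g.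
  have l1 : is_lift (q \o @clamp R) (s \o (fun t => (1 + vcl t) / 2)).
    move: (lift_comp (cd 1) ls); congr is_lift; apply/funext => t.
    rewrite [LHS]/= path_concatE; have vt := v01 t.
    rewrite val_clamp; last by lra.
    case: ifPn => h; last first.
      have -> : 2 * ((1 + vcl t) / 2) - 1 = vcl t by lra.
      by rewrite /vcl clamp_val.
    have v0 : vcl t = 0 by lra.
    rewrite v0 clamp_ge1 ?path_one; last by lra.
    by rewrite /= -[clamp t]clamp_val -/(vcl t) v0 clamp_le0 // path_zero.
  rewrite /tau_path (tau_lift (@path_clamp_continuous _ _ q) l1) /= /vcl clamp_le0 // clamp_ge1 //.
  rewrite val_zero01 val_one01 addr0 mul1r.
  by have -> : (1 + 1) / 2 = 1 :> R by lra.
by rewrite mulgA mulgK.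
Qed.

Lemma tau_reverse (y z : X) (p : {path I from y to z}) :
  tau_path (path_reverse p) = ((tau_path p)^-1)%g.
Proof.
have [s ls ->] := tau_pathE p.
rewrite /tau_path (tau_lift (s := s \o (fun t => 1 - t)) (@path_clamp_continuous _ _ _)).
  by rewrite /= subr0 subrr invgM invgK.
have c1 : continuous (fun t : R => 1 - t) by apply: continuous_subl; exact: id_continuous_real.
move: (lift_comp c1 ls); congr is_lift; apply/funext => t /=.
rewrite /path_reverse_fun; congr (p _); apply: val_inj.
have [t0|t0] := leP t 0.
  by rewrite [clamp t]clamp_le0 // val_zero01 subr0 !clamp_ge1 //; lra.
have [t1|t1] := leP 1 t.
  by rewrite [clamp t]clamp_ge1 // val_one01 subrr !clamp_le0 //; lra.
by rewrite (@val_clamp _ t) //; lra.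
Qed.

Variable x : X.

Definition tau_hom (a : pi1 R x) : K := tau_path (pi1_repr a).

Lemma tau_hom_class (p : {path I from x to x}) : tau_hom (pi1_class p) = tau_path p.
Proof. exact/tau_homotopic/pi1_repr_class. Qed.

Lemma tau_homM (a b : pi1 R x) : tau_hom (a * b)%g = (tau_hom a * tau_hom b)%g.
Proof. by rewrite -tau_concat; exact: tau_hom_class. Qed.

Lemma tau_hom_theta (d : forall y : X, {path I from x to y}) (u : R -> X) :
  continuous u ->
  tau_hom (theta d u) = (tau_path (d (u 0%R)) * tau u / tau_path (d (u 1%R)))%g.
Proof.
move=> cu; rewrite /theta; case: pselect => // cu'.
rewrite tau_hom_class !tau_concat tau_reverse mulgA; congr (_ * _ / _)%g.
have [s ls] := lift_exists cu.
rewrite (tau_vcl cu ls) /tau_path.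
have -> : path_of cu' \o @clamp R = u \o vcl by [].
by apply: tau_lift ls => t; apply: continuous_comp; [exact: vcl_continuous|exact: cu].
Qed.

End Lifts.

(** * The flat bundle over the surface given by a solution of the relation *)

Section Bundle.
Context {R : realType} {l : nat} (l_gt0 : (0 < l)%N) {K : groupType}.
Local Notation X := (surface R l).
Local Notation S := (@strip R l).
Local Notation nu := ((4 * l)%:R : R).
Local Notation glued := (@glued R l).
Local Notation fl t := ((Num.floor t)%:~R : R).

Variables al be : nat -> K.
Hypothesis rel : (\prod_(i < l) (al i * (be i)^-1 * (al i)^-1 * be i) = 1)%g.

Let step (i : nat) : K := ((be i)^-1 * al i * be i * (al i)^-1)%g.

(** Passing a block of four sides multiplies the corner value on the left by [step i]. The relation
    [rel] says that these factors close up after [l] blocks, which makes the corner values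
    periodic. *)
Fixpoint corner_base (i : nat) : K :=
  if i is j.+1 then (step j * corner_base j)%g else 1%g.

Lemma corner_base_l : corner_base l = 1%g.
Proof.
suff E n : corner_base n = (\prod_(i < n) (al i * (be i)^-1 * (al i)^-1 * be i))^-1%g.
  by rewrite E rel invg1.
elim: n => [|n IH] /=; first by rewrite big_ord0 invg1.
by rewrite big_ord_recr /= invgM IH /step !invgM !invgK !mulgA.
Qed.

(* The corner [j] of the [i]th block of four sides has index [n = 4 i + j]. *)
Definition corner_val (n : nat) : K :=
  let i := (n %/ 4)%N in
  match (n %% 4)%N with
  | 0 => corner_base i
  | 1 => (al i * be i * (al i)^-1 * corner_base i)%g
  | 2 => (be i * (al i)^-1 * corner_base i)%g
  | _ => ((al i)^-1 * corner_base i)%g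
  end.

Definition side_val (n : nat) : K :=
  let i := (n %/ 4)%N in
  match (n %% 4)%N with 0 => al i | 1 => be i | _ => 1%g end.

Definition nat_mod (k : int) : nat := `|(k %% (4 * l)%N)%Z|%N.

Lemma nat_mod_period k (n : int) : nat_mod (k + n * (4 * l)%N) = nat_mod k.
Proof. by rewrite /nat_mod addrC modzMDl. Qed.

Lemma nat_mod_small n : (n < 4 * l)%N -> nat_mod n = n.
Proof. by move=> nl; rewrite /nat_mod modz_small //= ltz_nat. Qed.

Definition cornerf (t : R) : K := corner_val (nat_mod (Num.floor (t + 2^-1))).
Definition sidef (t : R) : K := side_val (nat_mod (Num.floor t)).

Lemma div4 i j : (j < 4)%N -> ((4 * i + j) %/ 4 = i)%N /\ ((4 * i + j) %% 4 = j)%N.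
Proof. by move=> j4; rewrite mulnC divnMDl // divn_small // addn0 modnMDl modn_small. Qed.

Lemma sideE i (j : nat) : (i < l)%N -> (j < 4)%N ->
  side_val (nat_mod (4 * i + j)%N) = match j with 0 => al i | 1 => be i | _ => 1%g end.
Proof.
move=> il j4; rewrite nat_mod_small; last by lia.
by rewrite /side_val; have [-> ->] := div4 i j4.
Qed.

Lemma cornerE i (j : nat) : (i < l)%N -> (j < 5)%N ->
  corner_val (nat_mod (4 * i + j)%N) = match j with 0 => corner_base i
  | 1 => (al i * be i * (al i)^-1 * corner_base i)%g
  | 2 => (be i * (al i)^-1 * corner_base i)%g
  | 3 => ((al i)^-1 * corner_base i)%g
  | _ => corner_base i.+1 end.
Proof.
move=> il; rewrite ltnS leq_eqVlt => /orP[/eqP ->|j4].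
  have [il1|il1] := ltnP i.+1 l.
    rewrite nat_mod_small; last by lia.
    have -> : (4 * i + 4 = 4 * i.+1 + 0)%N by lia.
    by rewrite /corner_val; have [-> ->] := @div4 i.+1 0 isT.
  have -> : i.+1 = l by lia.
  rewrite corner_base_l.
  have -> : (4 * i + 4 = 4 * l)%N by lia.
  by rewrite /nat_mod modzz.
rewrite nat_mod_small; last by lia.
rewrite /corner_val; have [-> ->] := div4 i j4.
by case: j j4 => [|[|[|[|]]]].
Qed.

(** This is the condition for the transition function between sides and corners to descend to the
    surface. Solving it for corners 3, 2, 1 and 4 of a block, in this order, gives the formulas of
    [corner_val] and the factor [step]. *)
Lemma side_corner i (c e : bool) : (i < l)%N ->
  ((side_val (nat_mod (4 * i + c)%N))^-1 * corner_val (nat_mod (4 * i + c + e)%N) =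
   (side_val (nat_mod (4 * i + c + 2)%N))^-1 * corner_val (nat_mod (4 * i + c + 3 - e)%N))%g.
Proof.
move=> il.
have -> : (4 * i + c + e = 4 * i + (c + e))%N by rewrite addnA.
have -> : (4 * i + c + 2 = 4 * i + (c + 2))%N by rewrite addnA.
have -> : (4 * i + c + 3 - e = 4 * i + (c + 3 - e))%N by case: c e => -[]; lia.
rewrite !sideE ?cornerE //; try by case: c e => -[].
case: c e => -[] /=; rewrite ?invg1 ?mul1g ?mulgA ?mulVg ?mul1g ?mulKg //.
Qed.

Let cS : continuous S := @strip_continuous R l l_gt0.
Let gS : glued S := @strip_glued R l l_gt0.

Lemma nat_modD4l (k : int) : nat_mod (k + (4 * l)%N) = nat_mod k.
Proof. by rewrite -(nat_mod_period k 1) mul1r. Qed.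

Lemma floor_natZ (n : nat) (t : R) : n%:R <= t < n%:R + 1 -> Num.floor t = n.
Proof. by move=> nt; apply: floor_def; rewrite rmorphD. Qed.

Lemma sidef_period t : sidef (t + nu) = sidef t.
Proof. by rewrite /sidef floorD_nu nat_modD4l. Qed.

Lemma cornerf_period t : cornerf (t + nu) = cornerf t.
Proof. by rewrite /cornerf addrAC floorD_nu nat_modD4l. Qed.

Inductive chart := Disc | Sides | Corners.

Definition dom (i : chart) : set (R * R) :=
  match i with
  | Disc => [set p | p.1 < 1]
  | Sides => [set p | 0 < p.1 /\ fl p.2 < p.2]
  | Corners => [set p | 0 < p.1 /\ fl (p.2 + 2^-1) < p.2 + 2^-1]
  end.

Definition triv (i : chart) (p : R * R) : K :=
  match i with Disc => 1%g | Sides => sidef p.2 | Corners => cornerf p.2 end.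

Lemma half_glued : glued (dom Corners).
Proof.
apply: glued_pair => /=.
- by move=> r v r1; apply/propext; split => -[? ?]; split => //; lra.
- by move=> r v r0; apply/propext; split => -[? ?]; lra.
- by move=> r v; rewrite addrAC floor_period ltrD2r.
- move=> i c s il s01; set n := (4 * i + c)%N.
  have n3 : (n + 3)%:R = n%:R + 3 :> R by rewrite natrD.
  have n1 : n.+1%:R = n%:R + 1 :> R by rewrite natr1.
  have n2 : n.+2%:R = n%:R + 2 :> R by rewrite -natr1 n1; lra.
  congr (_ /\ is_true _); have [s2|s2|->] := ltgtP s 2^-1.
  + rewrite (@floor_natP _ n); last by lra.
    by rewrite (@floor_natP _ (n + 3)) ?n3; lra.
  + rewrite (@floor_natP _ n.+1) ?n1; last by lra.
    by rewrite (@floor_natP _ n.+2) ?n3 ?n2; lra.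
  + rewrite (@floor_natP _ n.+1) ?n1; last by lra.
    by rewrite (@floor_natP _ (n + 3)) ?n3; lra.
Qed.

Lemma dom_glued i : glued (dom i).
Proof.
case: i; [|exact: sector_glued|exact: half_glued].
apply: glued_pair => //=.
- by move=> r t r1; rewrite ltxx; apply/propext; split => //; lra.
- by move=> r t r0; apply/propext; split; lra.
Qed.

Lemma gluedI (A B : set (R * R)) : glued A -> glued B -> glued (A `&` B).
Proof.
move=> gA gB; split.
- by move=> r t r1; rewrite /setI /= (glued_ge1 gA t r1) (glued_ge1 gB t r1).
- by move=> r t r0; rewrite /setI /= (glued_le0 gA t r0) (glued_le0 gB t r0).
- by move=> r t; rewrite /setI /= (glued_periodic gA) (glued_periodic gB).
- move=> i s il s01; rewrite /setI /=.
  have [a1 a2] := glued_nat gA il s01; have [b1 b2] := glued_nat gB il s01.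
  by rewrite a1 a2 b1 b2.
Qed.

Lemma trans_glued i j : glued (fun p => if `[< (dom i `&` dom j) p >] then
  ((triv i p)^-1 * triv j p)%g else 1%g).
Proof.
apply: (glued_chart (f := fun p => (triv i p)^-1 * triv j p)%g).
- by apply: gluedI; exact: dom_glued.
- by case: i j => -[].
- move=> r t r0 [di dj].
  have E k : dom k (r, t) -> k = Disc by case: k => //= -[? _]; exfalso; lra.
  by rewrite (E _ di) (E _ dj).
- by move=> r t _; case: i j => -[] /=; rewrite ?sidef_period ?cornerf_period.
move=> k c s kl s01 [].
(* On the rim r = 1 the disc chart is absent, so only the transition between sides and corners has
   to respect the gluing. There [e] tells which end of the side is nearer. *)
have main : dom Sides (1, (4 * k + c)%:R + s) -> dom Corners (1, (4 * k + c)%:R + s) ->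
  ((sidef ((4 * k + c)%:R + s))^-1 * cornerf ((4 * k + c)%:R + s) =
   (sidef ((4 * k + c + 3)%:R - s))^-1 * cornerf ((4 * k + c + 3)%:R - s))%g.
  move=> [_ /= d1] [_ /= d2].
  have n3 m : (m + 3)%:R = m%:R + 3 :> R by rewrite natrD.
  have n2 m : (m + 2)%:R = m%:R + 2 :> R by rewrite natrD.
  have n1 m : (m + 1)%:R = m%:R + 1 :> R by rewrite natrD.
  have [e1 e2 e3 e4] := floor_side (4 * k + c) s01; rewrite e1 in d1.
  pose e := 2^-1 < s.
  have e0 : ~~ (s == 2^-1).
    apply/eqP => sE; move: d2; rewrite sE (@floor_natP _ (4 * k + c + 1)) ?n1; lra.
  have a1 : Num.floor ((4 * k + c)%:R + s) = (4 * k + c)%N by apply: floor_natZ; lra.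
  have a2 : Num.floor ((4 * k + c + 3)%:R - s) = (4 * k + c + 2)%N.
    by apply: floor_natZ; rewrite n3 n2; lra.
  have := side_corner c e kl; rewrite /sidef /cornerf a1 a2 /e.
  have [s2|s2] := ltP 2^-1 s.
    have -> : Num.floor ((4 * k + c)%:R + s + 2^-1) = (4 * k + c + 1)%N.
      by apply: floor_natZ; rewrite n1; lra.
    have -> : Num.floor ((4 * k + c + 3)%:R - s + 2^-1) = (4 * k + c + 2)%N.
      by apply: floor_natZ; rewrite n2 n3; lra.
    by have -> : (4 * k + c + 3 - true = 4 * k + c + 2)%N by rewrite addnS subSS subn0.
  have {}s2 : s < 2^-1 by lra.
  have -> : Num.floor ((4 * k + c)%:R + s + 2^-1) = (4 * k + c)%N.
    by apply: floor_natZ; lra.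
  have -> : Num.floor ((4 * k + c + 3)%:R - s + 2^-1) = (4 * k + c + 3)%N.
    by apply: floor_natZ; rewrite n3; lra.
  by rewrite addn0 subn0.
case: i j => -[] //=; rewrite ?ltxx ?mulVg //.
move=> d1 d2; have := main d2 d1 => /(congr1 (fun g : K => g^-1)%g).
by rewrite !invgM !invgK.
Qed.

(** Any set-theoretic section will do: changing it changes the trivialisations [chart_triv], but by
    [chart_transE] not their transition functions. *)
Definition sec (y : X) : R * R := projT1 (cid (strip_surj l_gt0 y)).

Lemma secK y : S (sec y) = y. Proof. exact: projT2 (cid (strip_surj l_gt0 y)). Qed.

Definition chart_set (i : chart) : set X := [set y | dom i (sec y)].
Definition chart_triv (i : chart) (y : X) : K := triv i (sec y).

Lemma chart_setE i p : chart_set i (S p) = dom i p.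
Proof. by apply: (strip_descent l_gt0 (dom_glued i)); rewrite secK. Qed.

Lemma chart_transE i j p : dom i p -> dom j p ->
  ((chart_triv i (S p))^-1 * chart_triv j (S p) = (triv i p)^-1 * triv j p)%g.
Proof.
move=> ip jp; have /(strip_descent l_gt0 (trans_glued i j)) := secK (S p).
have := chart_setE i p; have := chart_setE j p; rewrite /chart_set /= => jE iE.
by rewrite !asboolT; [| split..]; rewrite ?iE ?jE.
Qed.

Lemma triv_near i p : dom i p -> \forall q \near p, dom i q /\ triv i q = triv i p.
Proof.
case: p => r t; case: i => /=.
- move=> r1; have nr : nbhs r [set r' : R | r' < 1].
    by apply: open_nbhs_nbhs; split => //; exact: open_lt.
  have n1 : \forall z \near (r, t), z.1 < 1 by exact: (@fst_continuous R R (r, t) _ nr).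
  by near=> z; split => //; near: z.
- move=> [r0 ft].
  have nr : nbhs r [set r' : R | 0 < r'].
    by apply: open_nbhs_nbhs; split => //; exact: open_gt.
  have n1 : \forall z \near (r, t), 0 < z.1 by exact: (@fst_continuous R R (r, t) _ nr).
  have n2 : \forall z \near (r, t), fl z.2 = fl t /\ fl z.2 < z.2.
    exact: (@snd_continuous R R (r, t) _ (floor_near ft)).
  near=> z; have [e lt] : fl z.2 = fl t /\ fl z.2 < z.2 by near: z.
  split; first by split => //; near: z.
  by rewrite /sidef (intr_inj e).
- move=> [r0 ft].
  have nr : nbhs r [set r' : R | 0 < r'].
    by apply: open_nbhs_nbhs; split => //; exact: open_gt.
  have n1 : \forall z \near (r, t), 0 < z.1 by exact: (@fst_continuous R R (r, t) _ nr).
  have ch : continuous (fun z : R * R => z.2 + 2^-1).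
    apply: continuousDr; first exact: snd_continuous.
    by move=> z; exact: cvg_cst.
  have n2 : \forall z \near (r, t), fl (z.2 + 2^-1) = fl (t + 2^-1) /\ fl (z.2 + 2^-1) < z.2 + 2^-1.
    exact: (ch (r, t) _ (floor_near ft)).
  near=> z; have [e lt] : fl (z.2 + 2^-1) = fl (t + 2^-1) /\ fl (z.2 + 2^-1) < z.2 + 2^-1.
    by near: z.
  split; first by split => //; near: z.
  by rewrite /cornerf (intr_inj e).
Unshelve. all: end_near. Qed.

Lemma chart_open i : open (chart_set i).
Proof.
apply/(strip_open l_gt0); have -> : S @^-1` chart_set i = dom i.
  by apply/seteqP; split => p; rewrite /= chart_setE.
rewrite openE => p ip; have n := triv_near ip.
suff : \forall q \near p, dom i q by [].
by near=> q; have [] : dom i q /\ triv i q = triv i p by near: q.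
Unshelve. all: end_near.
Qed.

Lemma chart_cover y : exists i, chart_set i y.
Proof.
rewrite /chart_set /=; case: (sec y) => r t.
have [r1|r1] := ltP r 1; first by exists Disc.
have [t1|t1] := ltP (fl t) t; first by exists Sides; split => //=; lra.
exists Corners; split; rewrite /=; first by lra.
have /andP[ft _] := floor_itv t; have tE : t = fl t by lra.
have -> : Num.floor (t + 2^-1) = Num.floor t by apply: floor_def; rewrite rmorphD /=; lra.
by rewrite -tE; lra.
Qed.

Lemma chart_trans i j y : chart_set i y -> chart_set j y -> \forall z \near y,
  ((chart_triv i z)^-1 * chart_triv j z = (chart_triv i y)^-1 * chart_triv j y)%g.
Proof.
have [p <-] := strip_surj l_gt0 y; rewrite !chart_setE => ip jp.
pose W := [set z | [/\ chart_set i z, chart_set j z &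
  ((chart_triv i z)^-1 * chart_triv j z = (triv i p)^-1 * triv j p)%g]].
have oW : open W.
  apply/(strip_open l_gt0); rewrite openE => q [].
  rewrite !chart_setE => iq jq; rewrite chart_transE // => eq.
  have ni := triv_near iq; have nj := triv_near jq.
  suff : \forall z \near q, W (S z) by [].
  near=> z.
  have [iz ei] : dom i z /\ triv i z = triv i q by near: z.
  have [jz ej] : dom j z /\ triv j z = triv j q by near: z.
  by split; rewrite ?chart_setE ?chart_transE // ei ej.
have Wp : W (S p) by split; rewrite ?chart_setE ?chart_transE.
rewrite chart_transE //.
have nW : \forall z \near S p, W z by exact: (open_nbhs_nbhs (conj oW Wp)).
by near=> z; have [] : W z by near: z.
Unshelve. all: end_near.
Qed.

Local Notation lift := (is_lift chart_set chart_triv).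

(** The flat section over the strip that is 1 at the centre. The case distinction only selects some
    chart containing p; [strip_secE] shows that every such chart gives the same value. *)
Definition strip_sec (p : R * R) : K :=
  if p.1 < 1 then 1%g
  else if fl p.2 < p.2 then (sidef p.2 / chart_triv Sides (S p))%g
  else (cornerf p.2 / chart_triv Corners (S p))%g.

Lemma strip_secE i p : dom i p ->
  strip_sec p = (triv i p / chart_triv i (S p))%g.
Proof.
move=> ip.
have tr j : dom j p -> (triv j p / chart_triv j (S p) = triv i p / chart_triv i (S p))%g.
  move=> jp; have := chart_transE jp ip => e.
  rewrite -[triv i p](mulVKg (triv j p)) -e !mulgA mulgK.
  by [].
rewrite /strip_sec; case: ifPn => p1.
  by rewrite -(tr Disc) //= /chart_triv /= invg1 mulg1.
have p1' : 1 <= p.1 by rewrite leNgt.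
case: ifPn => p2; first by apply: (tr Sides); split => //=; lra.
apply: (tr Corners); split => /=; first by lra.
have /andP[ft _] := floor_itv p.2; have tE : p.2 = fl p.2 by move: p2; rewrite -leNgt; lra.
have -> : Num.floor (p.2 + 2^-1) = Num.floor p.2 by apply: floor_def; rewrite rmorphD /=; lra.
by rewrite -tE; lra.
Qed.

Lemma strip_sec_lift : lift S strip_sec.
Proof.
move=> p; have [i] := chart_cover (S p); rewrite chart_setE => ip; exists i.
  by rewrite chart_setE.
have n := triv_near ip; near=> q.
have [iq e] : dom i q /\ triv i q = triv i p by near: q.
by rewrite (strip_secE iq) (strip_secE ip) !mulgVK e.
Unshelve. all: end_near.
Qed.

Section Holonomy.
Variables (x : X) (d : forall y : X, {path (I01 R) from x to y}).

Lemma surface_rep : exists2 f : pi1 R x -> K,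
  (forall a b, f (a * b) = f a * f b)%g &
  forall i, (i < l)%N ->
    f (lam d (1%R, ((4 * i)%:R + 2^-1)%R) / lam d (1%R, ((4 * i)%:R + 5 / 2)%R))%g = al i /\
    f (lam d (1%R, ((4 * i + 1)%:R + 2^-1)%R) / lam d (1%R, ((4 * i + 1)%:R + 5 / 2)%R))%g = be i.
Proof.
pose f0 := @tau_hom R X K chart chart_set chart_triv chart_open chart_cover chart_trans x.
pose k := tau_path chart_open chart_cover chart_trans (d (S 0)).
have f0M : forall a b, (f0 (a * b) = f0 a * f0 b)%g by exact: tau_homM.
have f01 : f0 1%g = 1%g by apply: (@mulgI _ (f0 1%g)); rewrite -f0M !mulg1.
have f0V a : (f0 a^-1 = (f0 a)^-1)%g by apply: (@mulgI _ (f0 a)); rewrite -f0M !mulgV.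
have flam p : (f0 (lam d p) = k * strip_sec p / tau_path chart_open chart_cover chart_trans (d (S p)))%g.
  have cs := @strip_seg_continuous R l l_gt0 0 p.
  rewrite /f0 /lam tau_hom_theta //=.
  rewrite (tau_lift _ _ _ cs (lift_comp (@seg_continuous R 0 p) strip_sec_lift)) /=.
  by rewrite seg0 seg1 /strip_sec /= ltr01 invg1 mul1g.
exists (fun a => k^-1 * f0 a * k)%g => [a b|i il].
  by rewrite f0M !mulgA mulgK.
(* The midpoints of two glued sides are one point of the surface, so the transports along the base
   paths cancel. What remains is the quotient of the two side values, and the second of them is
   1. *)
have key n (c : bool) : n = (4 * i + c)%N ->
    (k^-1 * f0 (lam d (1%R, (n%:R + 2^-1)%R) / lam d (1%R, (n%:R + 5 / 2)%R)) * k =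
     side_val (nat_mod (4 * i + c)%N))%g.
  move=> ->; rewrite f0M f0V !flam.
  have sE : S (1, (4 * i + c)%:R + 2^-1) = S (1, (4 * i + c)%:R + 5 / 2).
    rewrite (strip_pair l_gt0 c il); last by lra.
    by congr (S (1, _)); rewrite natrD; lra.
  have f1 : Num.floor ((4 * i + c)%:R + 2^-1 : R) = (4 * i + c)%N by apply: floor_natZ; lra.
  have f2 : Num.floor ((4 * i + c)%:R + 5 / 2 : R) = (4 * i + c + 2)%N.
    by apply: floor_natZ; rewrite natrD; lra.
  rewrite !(@strip_secE Sides) /=; last 2 first.
  - split => //=; rewrite f2.
    have -> : (Posz (4 * i + c + 2))%:~R = (4 * i + c)%:R + 2 :> R by rewrite -natrD.
    lra.
  - by split => //=; rewrite f1; lra.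
  rewrite -sE /sidef f1 f2.
  have -> : (4 * i + c + 2 = 4 * i + (c + 2))%N by rewrite addnA.
  rewrite [side_val (nat_mod (4 * i + (c + 2))%N)]sideE //; last by case: c {sE f1 f2}.
  have -> : match (c + 2)%N with 0 => al i | 1 => be i | _ => 1%g end = 1%g by case: c {sE f1 f2}.
  by rewrite mul1g !invgM !invgK !mulgA !(mulVg, mul1g, mulgVK).
split.
  by rewrite (key _ false (esym (addn0 _))) sideE.
by rewrite (key _ true) // sideE.
Qed.

End Holonomy.

End Bundle.

(** * The presentation of the surface group *)

Section PresentationDef.
Local Open Scope group_scope.

(** The generation clause makes the morphism of the last clause unique, so this is the universal
    property of the one-relator group, quantified over all groups. *)
Definition surface_presentation (l : nat) (G : groupType) (a b : nat -> G) : Prop :=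
  [/\ forall H : set G, H 1 -> (forall g h, H g -> H h -> H (g * h)) ->
        (forall g, H g -> H g^-1) -> (forall i, (i < l)%N -> H (a i) /\ H (b i)) ->
        forall g, H g,
      \prod_(i < l) [~ a i, b i] = 1 &
      forall (K : groupType) (a' b' : nat -> K), \prod_(i < l) [~ a' i, b' i] = 1 ->
        exists2 f : G -> K, forall g h, f (g * h) = f g * f h &
          forall i, (i < l)%N -> f (a i) = a' i /\ f (b i) = b' i].

End PresentationDef.

Section Presentation.
Context {R : realType} {l : nat} (l_gt0 : (0 < l)%N) (x : surface R l).
Local Notation S := (@strip R l).
Local Open Scope group_scope.

Lemma base_path (y : surface R l) : {path (I01 R) from x to y}.
Proof.
pose p := projT1 (cid (strip_surj l_gt0 x)); pose q := projT1 (cid (strip_surj l_gt0 y)).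
have px : S p = x := projT2 (cid (strip_surj l_gt0 x)).
have qy : S q = y := projT2 (cid (strip_surj l_gt0 y)).
have P := path_of (@strip_seg_continuous R l l_gt0 p q).
by move: P; rewrite /= seg0 seg1 px qy.
Qed.

Lemma pi1_presentation : exists a b : nat -> pi1 R x, surface_presentation l a b.
Proof.
pose d := base_path.
pose L t := lam d (1%R, t).
pose al i := L ((4 * i)%:R + 2^-1)%R / L ((4 * i)%:R + 5 / 2)%R.
pose be i := L ((4 * i + 1)%:R + 2^-1)%R / L ((4 * i + 1)%:R + 5 / 2)%R.
(* Crossing a block gives the quotient al be^-1 al^-1 be of corner values. Under the convention
   [~ x, y] = x^-1 y^-1 x y this is the commutator of al^-1 and be. *)
exists (fun i => (al i)^-1), be; split.
- move=> H H1 HM HV Hab; apply: (strip_generation l_gt0 (d := d) H1 HM HV) => i c il.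
  have [/HV aH bH] := Hab i il; rewrite invgK in aH.
  by case: c; rewrite ?addn0.
- pose c n := L (n%:R)%R.
  have i0 : (0 <= (0 : R) <= 1)%R by rewrite lexx ler01.
  have i1 : (0 <= (1 : R) <= 1)%R by rewrite lexx ler01.
  have n4 (i m : nat) : ((4 * i + m)%:R = 4 * i%:R + m%:R :> R)%R by rewrite natrD natrM.
  have nn (i : nat) : ((i : int)%:~R = i%:R :> R)%R by [].
  have e03 i : c (4 * i)%N / c (4 * i + 3)%N = al i.
    have := lam_pair l_gt0 d i false i0; rewrite nn /c /al /L !n4 natrM /= !addr0 subr0.
    by [].
  have e12 i : c (4 * i + 1)%N / c (4 * i + 2)%N = al i.
    have := lam_pair l_gt0 d i false i1; rewrite nn /c /al /L !n4 natrM /= !addr0 => <-.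
    by congr (_ / lam d (_, _)); rewrite /=; lra.
  have e14 i : c (4 * i + 1)%N / c (4 * i + 4)%N = be i.
    have := lam_pair l_gt0 d i true i0; rewrite nn /c /be /L !n4 /= addr0 subr0 => <-.
    by congr (_ / lam d (_, _)); rewrite /=; lra.
  have e23 i : c (4 * i + 2)%N / c (4 * i + 3)%N = be i.
    have := lam_pair l_gt0 d i true i1; rewrite nn /c /be /L !n4 /= => <-.
    by congr (lam d (_, _) / lam d (_, _)); rewrite /=; lra.
  have step i : [~ (al i)^-1, be i] = c (4 * i)%N / c (4 * i.+1)%N.
    rewrite commgEl invgK /conjg -{1}e03 -{1}e23 -e12 -e14 !invgM !invgK.
    have -> : (4 * i.+1 = 4 * i + 4)%N by lia.
    by rewrite !mulgA !mulgVK.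
  (* The product telescopes around the polygon and closes up because corners 0 and 4l have the same
     value. *)
  suff E n : \prod_(i < n) [~ (al i)^-1, be i] = c 0%N / c (4 * n)%N.
    have := lam_periodicz l_gt0 d 1 0 1; rewrite mul1r add0r => cl.
    by rewrite E /c /L -cl mulgV.
  elim: n => [|n IH]; first by rewrite big_ord0 muln0 mulgV.
  by rewrite big_ord_recr /= IH step mulgA mulgVK.
- move=> K a' b' rel.
  have rel' : \prod_(i < l) ((a' i)^-1 * (b' i)^-1 * ((a' i)^-1)^-1 * b' i) = 1.
    by rewrite -[RHS]rel; apply: eq_bigr => i _; rewrite invgK commgEl /conjg !mulgA.
  have [f fM fE] := @surface_rep R l l_gt0 K (fun i => (a' i)^-1) b' rel' x d.
  exists f => // i il; have [ea eb] := fE i il; split => //.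
  have f1 : f 1 = 1 by apply: (@mulgI _ (f 1)); rewrite -fM !mulg1.
  apply: (@mulgI _ (f (al i))); rewrite -fM mulgV f1.
  by rewrite -[LHS](mulVg (a' i)); congr (_ * _); symmetry; exact: ea.
Qed.

End Presentation.

(** * Extension of invariant quasimorphisms *)

Section Hyers.
Context {R : realType}.
Implicit Types (D w : R).

Lemma bounded_multiples (w C : R) : (forall n : nat, `|n%:R * w| <= C) -> w = 0.
Proof.
move=> wC; apply/eqP; apply: contraT => w0.
have nw : 0 < `|w| by rewrite normr_gt0.
have C0 : 0 <= C by have := wC 0%N; rewrite mul0r normr0.
have := wC (Num.bound (C / `|w|)); rewrite normrM normr_nat -ler_pdivlMr //.
by rewrite leNgt archi_boundP // divr_ge0 // ltW.
Qed.

Lemma hyers (f : nat -> R) D : (forall m n, `|f (m + n)%N - f m - f n| <= D) ->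
  exists w, forall n, `|f n - n%:R * w| <= D.
Proof.
move=> fD; have D0 : 0 <= D by apply: le_trans (fD 0 0)%N.
have fM m n : `|f (m.+1 * n)%N - m.+1%:R * f n| <= m%:R * D.
  elim: m => [|m IH]; first by rewrite mul1n mul1r subrr normr0 mul0r.
  have := fD n (m.+1 * n)%N; rewrite -mulSn; move: IH; rewrite !ler_norml -!natr1.
  by move: (m%:R) (f _) (f _) (f _) => a b c d; nra.
have key m n : (f n.+1 - D) / n.+1%:R <= (f m.+1 + D) / m.+1%:R.
  rewrite ler_pdivrMr // mulrAC ler_pdivlMr //.
  have := fM m n.+1; have := fM n m.+1; rewrite mulnC !ler_norml -!natr1.
  move: (f (m.+1 * n.+1)%N) (f m.+1) (f n.+1) (ler0n R m) (ler0n R n).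
  by move: (m%:R) (n%:R) => a b c d e ? ?; nra.
pose S := [set (f n.+1 - D) / n.+1%:R | n in [set: nat]].
have S0 : S !=set0 by exists ((f 1%N - D) / 1); exists 0%N.
have supS : has_sup S by split => //; exists ((f 1%N + D) / 1) => _ [n _ <-]; exact: key.
exists (sup S) => -[|n].
  by rewrite mul0r subr0; have := fD 0%N 0%N; rewrite addn0 !ler_norml; lra.
have h1 : (f n.+1 - D) / n.+1%:R <= sup S by apply: ub_le_sup; [case: supS|exists n].
have h2 : sup S <= (f n.+1 + D) / n.+1%:R by apply: ge_sup => // _ [m _ <-]; exact: key.
move: h1 h2; rewrite ler_pdivrMr // ler_pdivlMr // mulrC ler_norml; lra.
Qed.

Lemma hyers_int (f : int -> R) D : (forall m n, `|f (m + n) - f m - f n| <= D) ->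
  exists w, forall n, `|f n - n%:~R * w| <= 3 * D.
Proof.
move=> fD; have D0 : 0 <= D by apply: le_trans (fD 0 0).
have [w wf] := @hyers (fun n => f n%:Z) D (fun m n => fD m n).
exists w => -[] n; first by apply: le_trans (wf n) _; lra.
have := fD 0 0; have := fD n.+1 (- n.+1%:Z); have := wf n.+1.
rewrite subrr add0r NegzE mulrNz -pmulrn !ler_norml mulNr.
by move: (f 0) (f _) (f _) (_ * w) => a b c d; lra.
Qed.

(** For fixed n the slope [w n] in the first variable is additive in n up to an error that stays
    bounded after multiplication by every m. Hence it is exactly additive, and so linear. *)
Lemma bihyers (f : int -> int -> R) D :
  (forall m m' n, `|f (m + m') n - f m n - f m' n| <= D) ->
  (forall m n n', `|f m (n + n') - f m n - f m n'| <= D) ->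
  exists w C, forall m n, `|f m n - m%:~R * n%:~R * w| <= C.
Proof.
move=> f1 f2; have D0 : 0 <= D by apply: le_trans (f1 0 0 0).
have [w wf] : exists w : int -> R, forall n m, `|f m n - m%:~R * w n| <= 3 * D.
  have H n := hyers_int (fun m m' => f1 m m' n).
  by exists (fun n => projT1 (cid (H n))) => n m; exact: (projT2 (cid (H n))).
have wD n n' : w (n + n') = w n + w n'.
  suff : w (n + n') - w n - w n' = 0 by lra.
  apply: (@bounded_multiples _ (10 * D)) => m.
  have := f2 m n n'; have := wf (n + n') m; have := wf n m; have := wf n' m.
  rewrite -pmulrn !mulrDr !mulrN !ler_norml.
  by move: (f _ _) (f _ _) (f _ _) (_ * w _) (_ * w _) (_ * w _) => *; lra.
have w0 : w 0 = 0 by have := wD 0 0; rewrite addr0; lra.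
have wn (n : nat) : w n = n%:R * w 1.
  elim: n => [|n IH]; first by rewrite w0 mul0r.
  by rewrite -addn1 PoszD wD IH natrD mulrDl mul1r.
have wz (n : int) : w n = n%:~R * w 1.
  case: n => n; first exact: wn.
  have := wD n.+1 (- n.+1%:Z); rewrite subrr w0 NegzE wn mulrNz -pmulrn; lra.
by exists (w 1), (3 * D) => m n; rewrite -mulrA -wz.
Qed.

End Hyers.

Section Powers.
Context {G : groupType}.
Local Open Scope group_scope.
Implicit Types x : G.

Lemma expgzS x (n : int) : expgz x (n + 1) = expgz x n * x.
Proof.
case: n => n; first by rewrite -PoszD addn1 /= expgSr.
case: n => [|n]; first by rewrite /= mulVg.
have -> : (Negz n.+1 + 1 = Negz n)%R by lia.
by rewrite /= (expgS x n.+1) invgM mulgVK.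
Qed.

Lemma expgzD x (m n : int) : expgz x (m + n) = expgz x m * expgz x n.
Proof.
have pos (n' : nat) m' : expgz x (m' + n'%:Z) = expgz x m' * expgz x n'.
  elim: n' => [|n' IH]; first by rewrite addr0 /= mulg1.
  by rewrite -addn1 PoszD addrA expgzS IH expgzS mulgA.
case: n => n; first exact: pos.
apply: (@mulIg _ (expgz x n.+1)); rewrite -pos -mulgA -[X in _ = _ * X]pos NegzE.
by rewrite subrK addNr mulg1.
Qed.

Lemma expgzN x (n : int) : expgz x (- n) = (expgz x n)^-1.
Proof. by apply: (@mulIg _ (expgz x n)); rewrite -expgzD addNr mulVg. Qed.

Lemma expgz1 x : expgz x 1 = x. Proof. by []. Qed.

End Powers.

Section Morphisms.
Context {G K : groupType} {f : G -> K} (fM : forall g h, (f (g * h) = f g * f h)%g).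
Local Open Scope group_scope.

Lemma hom1 : f 1 = 1.
Proof. by apply: (@mulgI _ (f 1)); rewrite -fM !mulg1. Qed.

Lemma homV g : f g^-1 = (f g)^-1.
Proof. by apply: (@mulgI _ (f g)); rewrite -fM !mulgV hom1. Qed.

Lemma homR g h : f [~ g, h] = [~ f g, f h].
Proof. by rewrite !commgEl /conjg !fM !homV. Qed.

Lemma hom_expgz g (n : int) : f (expgz g n) = expgz (f g) n.
Proof.
have pos (m : nat) : f (g ^+ m) = f g ^+ m.
  by elim: m => [|m IH]; rewrite ?hom1 // !expgS fM IH.
by case: n => n /=; rewrite ?homV pos.
Qed.

End Morphisms.

Section Homogenization.
Context {R : realType} {G : groupType}.
Implicit Types f F : G -> R^o.

Lemma homogeneous_unique f F : homogeneous f -> homogeneous F ->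
  (exists C : R, forall x, `|f x - F x| <= C) -> f = F.
Proof.
move=> hf hF [C fC]; apply/funext => x; apply/eqP; rewrite -subr_eq0; apply/eqP.
apply: (@bounded_multiples R _ C) => n; have := fC (expgz x n).
by rewrite hf hF -mulrBr.
Qed.

Lemma homogenization f : quasimorphism f ->
  exists2 F : G -> R^o, @Q R G F & exists C : R, forall x, `|F x - f x| <= C.
Proof.
move=> [D fD]; have D0 : 0 <= D by apply: le_trans (fD 1%g 1%g).
have H x : exists w : R, forall n : int, `|f (expgz x n) - n%:~R * w| <= 3 * D.
  by apply: hyers_int => m n; rewrite expgzD.
pose F x := projT1 (cid (H x)).
have FH x n : `|f (expgz x n) - n%:~R * F x| <= 3 * D := projT2 (cid (H x)) n.
have F1 x : `|F x - f x| <= 3 * D by have := FH x 1; rewrite expgz1 mul1r distrC.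
exists F; last by exists (3 * D).
split.
  exists (10 * D) => x y; have := F1 x; have := F1 y; have := F1 (x * y)%g; have := fD x y.
  by rewrite !ler_norml; lra.
move=> x n; apply/eqP; rewrite -subr_eq0; apply/eqP.
have expM (m : nat) : expgz (expgz x n) m = expgz x (n * m%:Z).
  elim: m => [|m IH]; first by rewrite mulr0.
  by rewrite -addn1 PoszD expgzD IH mulrDr mulr1 expgzD expgz1.
apply: (@bounded_multiples R _ (6 * D)) => m.
have := FH (expgz x n) m; have := FH x (n * m%:Z); rewrite expM rmorphM /= !ler_norml -!pmulrn.
by rewrite mulrBr mulrA [m%:R * n%:~R]mulrC; move: (f _) (_ * F _) (_ * F _) => *; lra.
Qed.

End Homogenization.

Section CommutatorSubgroup.
Context {G : groupType}.
Local Open Scope group_scope.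
Local Notation inN g := (g \in @commutator_subgroup G).

Lemma N1 : inN (1 : G). Proof. by case: (@commutator_subgroup_closed G). Qed.

Lemma NF (g h : G) : inN g -> inN h -> inN (g / h).
Proof. by case: (@commutator_subgroup_closed G) => _; apply. Qed.

Lemma NV (g : G) : inN g -> inN (g^-1).
Proof. by move=> gN; rewrite -(div1g g); apply: NF => //; exact: N1. Qed.

Lemma NM (g h : G) : inN g -> inN h -> inN (g * h).
Proof. by move=> gN hN; rewrite -[h]invgK; apply: NF => //; exact: NV. Qed.

Lemma NR (g h : G) : inN [~ g, h].
Proof. by rewrite unfold_in; apply/mem_set => H [_]; apply; exists g, h. Qed.

Lemma NJ (g h : G) : inN g -> inN (h * g * h^-1).
Proof.
move=> gN; have -> : h * g * h^-1 = [~ h^-1, g^-1] * g.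
  by rewrite commgEl /conjg !invgK !mulgA mulgVK.
by apply: NM => //; exact: NR.
Qed.

Lemma commutator_ind (P : G -> Prop) : P 1 -> (forall g h, P g -> P h -> P (g / h)) ->
  (forall g h, P [~ g, h]) -> forall g, inN g -> P g.
Proof.
move=> P1 PF PR g; rewrite unfold_in => /set_mem gN.
by apply: gN; split => //; move=> _ [a [b ->]].
Qed.

End CommutatorSubgroup.

(** * Normal forms up to bounded error *)

Section Extension.
Context {R : realType} {G : groupType}.
Local Notation N := (commutator_group G).
Local Notation inN g := (g \in @commutator_subgroup G).
Local Open Scope group_scope.

(** Lets a function on N be evaluated at explicit words of G without carrying membership proofs. *)
Definition extend0 (f : N -> R) (g : G) : R :=
  if insub g is Some y then f y else 0%R.

Lemma extend0E f (y : N) : extend0 f (val y) = f y.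
Proof. by rewrite /extend0 valK. Qed.

Lemma NP (g : G) : inN g -> exists y : N, val y = g.
Proof. by move=> gN; exists (Sub g gN); rewrite SubK. Qed.

Lemma val_expgz (y : N) (n : int) : val (expgz y n) = expgz (val y) n.
Proof. by apply: hom_expgz => g h; exact: valM. Qed.

Variables (f : N -> R^o) (D : R).
Hypothesis fD : forall y z : N, (`|f (y * z)%g - f y - f z| <= D)%R.
Hypothesis fh : homogeneous f.
Hypothesis fc : conj_invariant (S := @commutator_subgroup G) (N := N) f.
Local Notation ft := (extend0 f).

Lemma extend0M g h : inN g -> inN h -> (`|ft (g * h)%g - ft g - ft h| <= D)%R.
Proof. by move=> /NP[y <-] /NP[z <-]; rewrite -valM !extend0E. Qed.

Lemma extend0J g h : inN g -> ft (h * g * h^-1) = ft g.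
Proof.
move=> gN; have [z zE] := NP (NJ h gN); have [y yE] := NP gN.
by rewrite -zE -yE !extend0E; apply: (fc (g := h)); rewrite zE yE.
Qed.

Lemma extend0V g : inN g -> ft g^-1 = (- ft g)%R.
Proof.
move=> /NP[y <-]; rewrite -(homV (fun g h : N => valM g h)) !extend0E.
by have := fh y (- 1); rewrite mulN1r => <-; rewrite expgzN expgz1.
Qed.

Lemma extend01 : ft 1 = 0%R.
Proof.
have e : val (1 : N) = 1 :> G by exact: val1.
rewrite -e extend0E; have := fh 1 0; rewrite mul0r => <-.
by [].
Qed.

(** A calculus of error terms: families in N on which [f] is uniformly bounded are closed under
    products and, since [f] is invariant, under conjugation by arbitrary families of elements of
    G. *)
Definition bdd (T : Type) (u : T -> G) : Prop :=
  (forall t, inN (u t)) /\ exists C : R, forall t, (`|ft (u t)| <= C)%R.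

Lemma bdd_comp (T T' : Type) (u : T -> G) (p : T' -> T) : bdd u -> bdd (u \o p).
Proof. by move=> [uN [C uC]]; split=> [t|]; [exact: uN|exists C => t; exact: uC]. Qed.

Lemma bdd1 (T : Type) : bdd (fun _ : T => 1).
Proof. by split=> [t|]; [exact: N1|exists 0%R => t; rewrite extend01 normr0]. Qed.

Lemma bddM (T : Type) (u v : T -> G) : bdd u -> bdd v -> bdd (fun t => u t * v t).
Proof.
move=> [uN [C uC]] [vN [C' vC]]; split=> [t|]; first exact: NM.
exists (C + C' + D)%R => t; have := extend0M (uN t) (vN t); have := uC t; have := vC t.
by rewrite !ler_norml; lra.
Qed.

Lemma bddJ (T : Type) (u v : T -> G) : bdd u -> bdd (fun t => v t * u t * (v t)^-1).
Proof.
move=> [uN [C uC]]; split=> [t|]; first exact: NJ.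
by exists C => t; rewrite extend0J.
Qed.

Lemma eq_bdd (T : Type) (u v : T -> G) : (forall t, u t = v t) -> bdd u -> bdd v.
Proof. by move=> /funext ->. Qed.

Lemma bddR (T : Type) (u u' v : T -> G) : bdd (fun t => [~ u t, v t]) ->
  bdd (fun t => [~ u' t, v t]) -> bdd (fun t => [~ u t * u' t, v t]).
Proof.
move=> b b'; apply: eq_bdd (bddM (bddJ (fun t => (u' t)^-1) b) b') => t.
by rewrite !commgEl /conjg !invgK !invgM !mulgA !mulgK.
Qed.

Variables (x : nat -> G) (n : nat).
Hypothesis xb : forall i j, (i < n)%N -> (j < n)%N ->
  bdd (fun t : int * int => [~ expgz (x i) t.1, expgz (x j) t.2]).

Fixpoint word (m : nat) (k : nat -> int) : G :=
  if m is m'.+1 then word m' k * expgz (x m') (k m') else 1.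

Lemma word_comm m j : (m <= n)%N -> (j < n)%N ->
  bdd (fun t : (nat -> int) * int => [~ word m t.1, expgz (x j) t.2]).
Proof.
move=> + jn; elim: m => [_|m IH mn] /=.
  by apply: eq_bdd (@bdd1 _) => t; rewrite comm1g.
apply: bddR; first exact: IH (ltnW mn).
exact: (bdd_comp (fun t : (nat -> int) * int => (t.1 m, t.2)) (xb mn jn)).
Qed.

Lemma word_mul m : (m <= n)%N -> bdd (fun t : (nat -> int) * (nat -> int) =>
  word m t.1 * word m t.2 * (word m (fun i => t.1 i + t.2 i)%R)^-1).
Proof.
elim: m => [_|m IH mn] /=; first by apply: eq_bdd (@bdd1 _) => t; rewrite !mul1g invg1.
(* Collecting the powers of [x m] costs the commutator of the second word with the power [- t.1 m]
   of [x m], conjugated by the sum word. *)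
have bc := bdd_comp (fun t : (nat -> int) * (nat -> int) => (t.2, (- t.1 m)%R))
  (word_comm (ltnW mn) mn).
apply: eq_bdd (bddM (IH (ltnW mn))
  (bddJ (fun t : (nat -> int) * (nat -> int) => word m (fun i => t.1 i + t.2 i)%R) bc)) => -[k k'] /=.
rewrite expgzD commgEl /conjg expgzN !invgM !invgK !mulgA !mulgVK.
by rewrite !mulgK.
Qed.

End Extension.

(** * The alternating form attached to an invariant quasimorphism *)

Section Criterion.
Context {R : realType} {G : groupType} (x : nat -> G) (n : nat) (ab : G -> nat -> int).
Local Notation N := (commutator_group G).
Local Notation inN g := (g \in @commutator_subgroup G).
Hypothesis abM : forall g h i, ab (g * h)%g i = ab g i + ab h i.
Hypothesis abx : forall i j, (i < n)%N -> ab (x i) j = (i == j).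
Hypothesis x_gen : forall H : set G, H 1%g -> (forall g h, H g -> H h -> H (g * h)%g) ->
  (forall g, H g -> H (g^-1)%g) -> (forall i, (i < n)%N -> H (x i)) -> forall g, H g.
Local Open Scope group_scope.

Lemma ab1 i : ab 1 i = 0%R.
Proof. by have := abM 1 1 i; rewrite mulg1; lia. Qed.

Lemma abV g i : ab g^-1 i = (- ab g i)%R.
Proof. by have := abM g g^-1 i; rewrite mulgV ab1; lia. Qed.

Lemma ab_N g : inN g -> forall i, ab g i = 0%R.
Proof.
move: g; apply: commutator_ind => [i|g h g0 h0 i|g h i]; first exact: ab1.
  by rewrite abM abV g0 h0.
by rewrite commgEl /conjg !abM !abV; lia.
Qed.

Lemma word0 m : word x m (fun=> 0%R) = 1.
Proof. by elim: m => [|m IH] //=; rewrite IH mul1g. Qed.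

Lemma word_delta m i : word x m (fun j => Posz (i == j)) = if (i < m)%N then x i else 1.
Proof.
elim: m => [|m IH] //; rewrite -[LHS]/(word x m _ * expgz (x m) (Posz (i == m))) IH.
have [->|im] := eqVneq i m; first by rewrite ltnn ltnSn mul1g.
by rewrite ltnS [in RHS]leq_eqVlt (negbTE im) /= mulg1.
Qed.

Lemma word_mulN k k' : inN (word x n k * word x n k' / word x n (fun i => k i + k' i)%R).
Proof.
(* The zero function satisfies every boundedness hypothesis, so [word_mul] can be used just for its
   membership half. *)
pose z (y : N) : R^o := 0%R.
have zD (y y' : N) : (`|z (y * y')%g - z y - z y'| <= 0)%R by rewrite /z !subr0 normr0.
have zh : homogeneous z by move=> y m; rewrite /z mulr0.
have zc : conj_invariant (S := @commutator_subgroup G) (N := N) z by [].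
have zx i j : (i < n)%N -> (j < n)%N ->
    bdd z (fun t : int * int => [~ expgz (x i) t.1, expgz (x j) t.2]).
  move=> _ _; split=> [t|]; first exact: NR.
  by exists 0%R => t; rewrite /extend0; case: insub => [y|]; rewrite normr0.
by have [] := word_mul zD zh zc zx (leqnn n) => /(_ (k, k')).
Qed.

Lemma word_section g : inN (g / word x n (ab g)).
Proof.
pose H := [set g | inN (g / word x n (ab g))].
apply: (x_gen (H := H)) => [|g1 g2 h1 h2|g1 h1|i im]; rewrite /H /=.
- have -> : ab 1 = (fun=> 0%R) by apply/funext => i; exact: ab1.
  by rewrite word0 mulgV N1.
- have -> : ab (g1 * g2) = (fun i => ab g1 i + ab g2 i)%R by apply/funext => i; exact: abM.
  have := NM h1 (NM (NJ (word x n (ab g1)) h2) (word_mulN (ab g1) (ab g2))).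
  by rewrite !mulgA !mulgVK.
- have -> : ab g1^-1 = (fun i => - ab g1 i)%R by apply/funext => i; exact: abV.
  have := word_mulN (fun i => - ab g1 i)%R (ab g1).
  have -> : (fun i => - ab g1 i + ab g1 i)%R = (fun=> 0%R) by apply/funext => i; rewrite addNr.
  rewrite word0 divg1 => w.
  have := NM (NJ (word x n (ab g1))^-1 (NV h1)) (NV w).
  by rewrite !invgM !invgK !mulgA mulVg mul1g mulgK.
- have -> : ab (x i) = (fun j => Posz (i == j)) by apply/funext => j; exact: abx.
  by rewrite word_delta im mulgV N1.
Qed.

Lemma extension_criterion (f : N -> R^o) : Q_invariant R N f ->
  (forall i j, (i < n)%N -> (j < n)%N -> exists C : R, forall k m,
    (`|extend0 f [~ expgz (x i) k, expgz (x j) m]| <= C)%R) ->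
  Q_restriction R N f.
Proof.
move=> [[[D fD] fh] fc] fx.
have xb i j : (i < n)%N -> (j < n)%N ->
    bdd f (fun t : int * int => [~ expgz (x i) t.1, expgz (x j) t.2]).
  by move=> im jm; split=> [t|]; [exact: NR|have [C xC] := fx i j im jm; exists C => -[]].
have [wN [C wC]] := word_mul fD fh fc xb (leqnn n).
pose F g : R := extend0 f (g / word x n (ab g)).
have qF : quasimorphism F.
  exists (C + D + D)%R => g h; rewrite /F.
  have -> : ab (g * h) = (fun i => ab g i + ab h i)%R by apply/funext => i; exact: abM.
  set u := word x n (ab g); set v := word x n (ab h); set w := word x n _.
  have gN : inN (g / u) := word_section g; have hN : inN (h / v) := word_section h.
  (* The N-part of a product is the product of the N-parts, one of them conjugated, times the error
     of the words, on which [f] is bounded by [C]. *)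
  have e : g * h / w = (g / u) * ((u * (h / v) * u^-1) * (u * v / w)).
    by rewrite !mulgA !mulgVK.
  have cN := wN (ab g, ab h); have cC := wC (ab g, ab h); rewrite -/u -/v -/w /= in cN cC.
  have := extend0M fD gN (NM (NJ u hN) cN); have := extend0M fD (NJ u hN) cN.
  rewrite -e (extend0J fc _ hN) !ler_norml in cC *.
  by move: cC; move: (extend0 f _) (extend0 f _) (extend0 f _) (extend0 f _) (extend0 f _) => *; lra.
have [Fh QF [E FE]] := homogenization qF; exists Fh => //.
(* On N the word is trivial because [ab] vanishes there. So [f] and the restriction of [Fh] are
   homogeneous functions at bounded distance, hence equal. *)
apply: homogeneous_unique => //.
  by move=> y m; rewrite /= val_expgz; case: QF => _ ->.
exists E => y; have := FE (val y); rewrite /= distrC /F.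
have -> : ab (val y) = (fun=> 0%R) by apply/funext => i; apply: ab_N; exact: valP.
by rewrite word0 divg1 extend0E.
Qed.

(* The error bound makes [w] the form on the abelianization of [G] that is the
   obstruction to extending [f]. *)
Definition has_form (f : N -> R^o) (w : nat -> nat -> R) : Prop :=
  forall i j, (i < n)%N -> (j < n)%N -> exists C : R, forall k m : int,
    (`|extend0 f [~ expgz (x i) k, expgz (x j) m] - k%:~R * m%:~R * w i j| <= C)%R.

(** A commutator with a product in one argument is a product of two commutators, one of them
    conjugated. By invariance [f] is then biadditive in the exponents up to the defect [D]. *)
Lemma has_form_exists f : Q_invariant R N f -> exists w, has_form f w.
Proof.
move=> [[[D fD] fh] fc].
have H i j : exists w : R, exists C : R, forall k m : int,
    (`|extend0 f [~ expgz (x i) k, expgz (x j) m] - k%:~R * m%:~R * w| <= C)%R.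
  apply: (@bihyers R _ D) => k m p; rewrite expgzD.
    have -> : [~ expgz (x i) k * expgz (x i) m, expgz (x j) p] =
      (expgz (x i) m)^-1 * [~ expgz (x i) k, expgz (x j) p] * ((expgz (x i) m)^-1)^-1 *
      [~ expgz (x i) m, expgz (x j) p].
      by rewrite !commgEl /conjg !invgK !invgM !mulgA !mulgK.
    rewrite -(extend0J fc ((expgz (x i) m)^-1) (NR (expgz (x i) k) (expgz (x j) p))).
    by apply: extend0M fD _ _ _ _; [apply: NJ; exact: NR|exact: NR].
  have -> : [~ expgz (x i) k, expgz (x j) m * expgz (x j) p] =
    [~ expgz (x i) k, expgz (x j) p] *
    ((expgz (x j) p)^-1 * [~ expgz (x i) k, expgz (x j) m] * ((expgz (x j) p)^-1)^-1).
    by rewrite !commgEl /conjg !invgK !invgM !mulgA !mulgK.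
  rewrite -(extend0J fc ((expgz (x j) p)^-1) (NR (expgz (x i) k) (expgz (x j) m))).
  rewrite -addrA [(- _ - _)%R]addrC addrA.
  by apply: extend0M fD _ _ _ _; [exact: NR|apply: NJ; exact: NR].
by exists (fun i j => projT1 (cid (H i j))) => i j _ _; exact: (projT2 (cid (H i j))).
Qed.

Lemma has_form_unique f w w' i j : has_form f w -> has_form f w' ->
  (i < n)%N -> (j < n)%N -> w i j = w' i j.
Proof.
move=> fw fw' im jm; have [C h] := fw i j im jm; have [C' h'] := fw' i j im jm.
apply/eqP; rewrite -subr_eq0; apply/eqP; apply: (@bounded_multiples R _ (C + C')) => k.
have := h k 1%R; have := h' k 1%R; rewrite !mulr1 -pmulrn !ler_norml mulrBr.
by move: (extend0 f _) (_ * w _ _)%R (_ * w' _ _)%R => *; lra.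
Qed.

Lemma extend0D (f g : N -> R^o) y : extend0 (f + g)%R y = (extend0 f y + extend0 g y)%R.
Proof. by rewrite /extend0; case: insub => // ; rewrite addr0. Qed.

Lemma extend0Z (c : R) (f : N -> R^o) y : extend0 (c *: f)%R y = (c * extend0 f y)%R.
Proof. by rewrite /extend0; case: insub => // ; rewrite mulr0. Qed.

Lemma has_formD f g w v : has_form f w -> has_form g v ->
  has_form (f + g)%R (fun i j => w i j + v i j)%R.
Proof.
move=> fw gv i j im jm; have [C h] := fw i j im jm; have [C' h'] := gv i j im jm.
exists (C + C')%R => k m; have := h k m; have := h' k m.
rewrite extend0D !ler_norml mulrDr.
by move: (extend0 f _) (extend0 g _) (_ * w _ _)%R (_ * v _ _)%R => *; lra.
Qed.

Lemma has_formZ c f w : has_form f w -> has_form (c *: f)%R (fun i j => c * w i j)%R.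
Proof.
move=> fw i j im jm; have [C h] := fw i j im jm; exists (`|c| * C)%R => k m.
rewrite extend0Z mulrCA -mulrBr normrM.
by apply: ler_wpM2l.
Qed.

Lemma has_form_alternating f w i j : Q_invariant R N f -> has_form f w ->
  (i < n)%N -> (j < n)%N -> w j i = (- w i j)%R.
Proof.
move=> [[[D fD] fh] fc] fw im jm.
have [C h] := fw i j im jm; have [C' h'] := fw j i jm im.
apply/eqP; rewrite -subr_eq0 opprK; apply/eqP; apply: (@bounded_multiples R _ (C + C')) => k.
have := h 1%R k; have := h' k 1%R; rewrite -(invgR (expgz (x i) 1%R)) extend0V //; last exact: NR.
rewrite !mulr1 !mul1r -pmulrn !ler_norml mulrDr.
by move: (extend0 f _) (_ * w _ _)%R (_ * w _ _)%R => *; lra.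
Qed.

(** Conjugation by g changes [F] by at most 4D, uniformly over all powers of an element, and
    homogeneity turns this into equality. *)
Lemma Q_restriction_invariant f : Q_restriction R N f -> Q_invariant R N f.
Proof.
move=> [F [[D FD] Fh] ->]; split; first split.
- by exists D => y z; have := FD (val y) (val z); rewrite -valM.
- by move=> y k; have := Fh (val y) k; rewrite -val_expgz.
move=> g y z zE /=; rewrite zE.
have Fg : (`|F (g^-1)%g + F g| <= D + D)%R.
  have := FD g (g^-1)%g; have := FD 1 1; rewrite mulg1 mulgV !ler_norml; lra.
apply/eqP; rewrite -subr_eq0; apply/eqP; apply: (@bounded_multiples R _ (4 * D)) => k.
have J : expgz (g * val y * g^-1) k = g * expgz (val y) k * g^-1.
  have fM u v : g * (u * v) * g^-1 = (g * u * g^-1) * (g * v * g^-1) by rewrite !mulgA mulgVK.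
  by rewrite -(hom_expgz fM).
have := FD (g * expgz (val y) k) (g^-1); have := FD g (expgz (val y) k).
rewrite mulrBr -[(k%:R * F _)%R](Fh _ k) -[(k%:R * F (val y))%R](Fh _ k) J; move: Fg.
rewrite !ler_norml.
by move: (F _) (F _) (F _) (F _) (F _) => *; lra.
Qed.

Lemma Q_restriction_form f : Q_restriction R N f -> has_form f (fun _ _ => 0%R).
Proof.
move=> fr; have [[[D' fD'] fh] fc] := Q_restriction_invariant fr.
case: fr => F [[D FD] Fh] fE i j im jm; exists (4 * D)%R => k m.
rewrite mulr0 subr0; set u := expgz _ k; set v := expgz _ m.
have [z zE] := NP (NR u v); rewrite -zE extend0E fE /= zE.
have := FD (v * u) [~ u, v]; have := FD u v; have := FD v u.
rewrite -commgC !ler_norml.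
by move: (F _) (F _) (F _) (F _) => *; lra.
Qed.

End Criterion.

(** * Heisenberg groups *)

(** The carrier is the same for all forms; the parameters in the type keep the group laws apart.
    Only the first [n] entries of a sequence enter the cocycle, and [B] may be any matrix: the
    commutator alternates it. *)
Definition heisenberg {R : realType} (n : nat) (B : nat -> nat -> R) : Type :=
  (R * (nat -> int))%type.

Section Heisenberg.
Context {R : realType} (n : nat) (B : nat -> nat -> R).
Local Notation heisenberg := (heisenberg n B).

HB.instance Definition _ := gen_eqMixin heisenberg.
HB.instance Definition _ := gen_choiceMixin heisenberg.

Definition biform (v w : nat -> int) : R :=
  \sum_(i < n) \sum_(j < n) (v i)%:~R * B i j * (w j)%:~R.

Lemma biformDl u v w : biform (fun i => u i + v i) w = biform u w + biform v w.
Proof.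
rewrite -big_split; apply: eq_bigr => i _; rewrite -big_split; apply: eq_bigr => j _.
by rewrite /= rmorphD !mulrDl.
Qed.

Lemma biformDr u v w : biform u (fun i => v i + w i) = biform u v + biform u w.
Proof.
rewrite -big_split; apply: eq_bigr => i _; rewrite -big_split; apply: eq_bigr => j _.
by rewrite /= rmorphD mulrDr.
Qed.

Lemma biform0l w : biform (fun=> 0) w = 0.
Proof. by rewrite /biform big1 // => i _; rewrite big1 // => j _; rewrite !mul0r. Qed.

Lemma biform0r v : biform v (fun=> 0) = 0.
Proof. by rewrite /biform big1 // => i _; rewrite big1 // => j _; rewrite mulr0. Qed.

Lemma biform_delta i j (k m : int) : (i < n)%N -> (j < n)%N ->
  biform (fun i' => k * (i == i')%:Z) (fun j' => m * (j == j')%:Z) = k%:~R * m%:~R * B i j.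
Proof.
move=> im jm; rewrite /biform (bigD1 (Ordinal im)) //= [X in _ + X]big1 ?addr0; last first.
  move=> i' ii'; rewrite big1 // => j' _.
  have -> : (i == i') = false.
    by apply/negbTE; rewrite eq_sym; apply: contra ii' => /eqP ii'; apply/eqP/val_inj.
  by rewrite mulr0 !mul0r.
rewrite (bigD1 (Ordinal jm)) //= [X in _ + X]big1 ?addr0; last first.
  move=> j' jj'.
  have -> : (j == j') = false.
    by apply/negbTE; rewrite eq_sym; apply: contra jj' => /eqP jj'; apply/eqP/val_inj.
  by rewrite mulr0 mulr0.
by rewrite !eqxx !mulr1 mulrAC.
Qed.

Definition heis_mul (g h : heisenberg) : heisenberg :=
  (g.1 + h.1 + biform g.2 h.2, fun i => g.2 i + h.2 i).
Definition heis_one : heisenberg := (0, fun=> 0).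
Definition heis_inv (g : heisenberg) : heisenberg :=
  (biform g.2 g.2 - g.1, fun i => - g.2 i).

Lemma heis_mulA : associative heis_mul.
Proof.
move=> [s u] [t v] [r w]; rewrite /heis_mul /= biformDl biformDr; congr (_, _).
  by ring.
by apply/funext => i; rewrite addrA.
Qed.

Lemma heis_mul1 : left_id heis_one heis_mul.
Proof.
move=> [s u]; rewrite /heis_mul /= biform0l !add0r addr0; congr (_, _).
by apply/funext => i; rewrite add0r.
Qed.

Lemma heis_mulr1 : right_id heis_one heis_mul.
Proof.
move=> [s u]; rewrite /heis_mul /= biform0r !addr0; congr (_, _).
by apply/funext => i; rewrite addr0.
Qed.

Lemma biformNl u w : biform (fun i => - u i) w = - biform u w.
Proof.
have := biformDl (fun i => - u i) u w.
have -> : (fun i => - u i + u i) = (fun=> 0) by apply/funext => i; rewrite addNr.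
by rewrite biform0l; lra.
Qed.

Lemma biformNr u w : biform u (fun i => - w i) = - biform u w.
Proof.
have := biformDr u (fun i => - w i) w.
have -> : (fun i => - w i + w i) = (fun=> 0) by apply/funext => i; rewrite addNr.
by rewrite biform0r; lra.
Qed.

Lemma heis_mulV : left_inverse heis_one heis_inv heis_mul.
Proof.
move=> [s u]; rewrite /heis_mul /heis_inv /= biformNl; congr (_, _); first by ring.
by apply/funext => i; rewrite addNr.
Qed.

Lemma heis_mulrV : right_inverse heis_one heis_inv heis_mul.
Proof.
move=> [s u]; rewrite /heis_mul /heis_inv /= biformNr; congr (_, _); first by ring.
by apply/funext => i; rewrite addrN.
Qed.

HB.instance Definition _ :=
  isGroup.Build heisenberg heis_mulA heis_mul1 heis_mulr1 heis_mulV heis_mulrV.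

Lemma heisM (g h : heisenberg) :
  (g * h)%g = (g.1 + h.1 + biform g.2 h.2, fun i => g.2 i + h.2 i) :> heisenberg.
Proof. by []. Qed.

Lemma heisR (g h : heisenberg) :
  [~ g, h]%g = (biform g.2 h.2 - biform h.2 g.2, fun=> 0) :> heisenberg.
Proof.
apply: (@mulgI _ (h * g)%g); rewrite -commgC !heisM biform0r addr0; congr (_, _).
  by rewrite /=; ring.
by apply/funext => i; rewrite addr0 addrC.
Qed.

End Heisenberg.

(** * Lifts of circle homeomorphisms *)

Section PLMaps.
Context {R : realType}.

(* Monotone bijections of the line commuting with the unit translation, that is
   lifts of orientation-preserving bijections of the circle. *)
Record degree1 := Degree1 {
  deg_fun :> R -> R;
  deg_inv : R -> R;
  deg_K : cancel deg_fun deg_inv;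
  deg_VK : cancel deg_inv deg_fun;
  deg_le : {homo deg_fun : r s / r <= s};
  deg_D1 : forall r, deg_fun (r + 1) = deg_fun r + 1 }.

HB.instance Definition _ := gen_eqMixin degree1.
HB.instance Definition _ := gen_choiceMixin degree1.

Lemma degree1_eq (f g : degree1) : f =1 g -> f = g.
Proof.
case: f g => [f fi fK fVK fle f1] [g gi gK gVK gle g1] /= /funext fg.
subst g; have fgi : fi = gi by apply/funext => r; rewrite -{1}(gVK r) fK.
subst gi; congr Degree1; exact: Prop_irrelevance.
Qed.

Lemma deg_Dz (f : degree1) r (k : int) : f (r + k%:~R) = f r + k%:~R.
Proof.
have Dn (m : nat) s : f (s + m%:R) = f s + m%:R.
  by elim: m => [|m IH]; rewrite ?addr0 // -natr1 !addrA deg_D1 IH.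
case: k => k; first exact: Dn.
by rewrite NegzE mulrNz -pmulrn -[in RHS](subrK k.+1%:R r) Dn addrK.
Qed.

Lemma deg_id_subproof1 : {homo (@id R) : r s / r <= s}. Proof. by []. Qed.

Definition deg_one : degree1 :=
  @Degree1 id id (fun=> erefl) (fun=> erefl) deg_id_subproof1 (fun=> erefl).

Lemma deg_mul_subproof1 (f g : degree1) : cancel (f \o g) (deg_inv g \o deg_inv f).
Proof. by move=> r; rewrite /= !deg_K. Qed.
Lemma deg_mul_subproof2 (f g : degree1) : cancel (deg_inv g \o deg_inv f) (f \o g).
Proof. by move=> r; rewrite /= !deg_VK. Qed.
Lemma deg_mul_subproof3 (f g : degree1) : {homo f \o g : r s / r <= s}.
Proof. by move=> r s rs; apply/deg_le/deg_le. Qed.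
Lemma deg_mul_subproof4 (f g : degree1) r : (f \o g) (r + 1) = (f \o g) r + 1.
Proof. by rewrite /= !deg_D1. Qed.

Definition deg_mul (f g : degree1) : degree1 :=
  Degree1 (deg_mul_subproof1 f g) (deg_mul_subproof2 f g) (@deg_mul_subproof3 f g)
    (deg_mul_subproof4 f g).

Lemma deg_inv_subproof3 (f : degree1) : {homo deg_inv f : r s / r <= s}.
Proof.
move=> r s rs; rewrite leNgt; apply/negP => h; have := deg_le f (ltW h).
rewrite !deg_VK => sr; have e : r = s by apply/eqP; rewrite eq_le rs.
by move: h; rewrite e ltxx.
Qed.
Lemma deg_inv_subproof4 (f : degree1) r : deg_inv f (r + 1) = deg_inv f r + 1.
Proof. by apply: (can_inj (deg_K f)); rewrite deg_D1 !deg_VK. Qed.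

Definition deg_V (f : degree1) : degree1 :=
  Degree1 (deg_VK f) (deg_K f) (@deg_inv_subproof3 f) (deg_inv_subproof4 f).

Lemma deg_mulA : associative deg_mul. Proof. by move=> f g h; exact: degree1_eq. Qed.
Lemma deg_mul1 : left_id deg_one deg_mul. Proof. by move=> f; exact: degree1_eq. Qed.
Lemma deg_mulr1 : right_id deg_one deg_mul. Proof. by move=> f; exact: degree1_eq. Qed.
Lemma deg_mulV : left_inverse deg_one deg_V deg_mul.
Proof. by move=> f; apply: degree1_eq => r; rewrite /= deg_K. Qed.
Lemma deg_mulrV : right_inverse deg_one deg_V deg_mul.
Proof. by move=> f; apply: degree1_eq => r; rewrite /= deg_VK. Qed.

HB.instance Definition _ :=
  isGroup.Build degree1 deg_mulA deg_mul1 deg_mulr1 deg_mulV deg_mulrV.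

Lemma degM (f g : degree1) r : (f * g)%g r = f (g r). Proof. by []. Qed.

Lemma transl_subproof1 (a : R) : cancel (fun r => r + a) (fun r => r - a).
Proof. by move=> r; rewrite addrK. Qed.
Lemma transl_subproof2 (a : R) : cancel (fun r => r - a) (fun r => r + a).
Proof. by move=> r; rewrite subrK. Qed.
Lemma transl_subproof3 (a : R) : {homo (fun r => r + a) : r s / r <= s}.
Proof. by move=> r s rs; rewrite lerD2r. Qed.
Lemma transl_subproof4 (a r : R) : r + 1 + a = r + a + 1.
Proof. by rewrite addrAC. Qed.

Definition transl (a : R) : degree1 :=
  Degree1 (transl_subproof1 a) (transl_subproof2 a) (@transl_subproof3 a)
    (transl_subproof4 a).

(* The lift with two affine pieces per period, of slope [s1] on
   [[x0, x0 + m]] and [s2] on [[x0 + m, x0 + 1]], sending [x0] to [y0]. *)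
Definition pl_fun (x0 m y0 s1 s2 r : R) : R :=
  let k := (Num.floor (r - x0))%:~R in
  y0 + k + (if r - x0 - k <= m then s1 * (r - x0 - k) else s1 * m + s2 * (r - x0 - k - m)).

Lemma pl_fun1 (x0 m y0 s1 s2 : R) (k : int) (r : R) : 0 < m < 1 ->
  x0 + k%:~R <= r <= x0 + k%:~R + m ->
  pl_fun x0 m y0 s1 s2 r = y0 + k%:~R + s1 * (r - x0 - k%:~R).
Proof.
move=> m01 rk; have fk : Num.floor (r - x0) = k by apply: floor_def; rewrite rmorphD /=; lra.
by rewrite /pl_fun fk ifT //; lra.
Qed.

Definition pl_params (m s1 s2 : R) : Prop :=
  [/\ 0 < m < 1, 0 < s1, 0 < s2 & s1 * m + s2 * (1 - m) = 1].

Lemma pl_fun2 (x0 m y0 s1 s2 : R) (k : int) (r : R) : pl_params m s1 s2 ->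
  x0 + k%:~R + m <= r <= x0 + k%:~R + 1 ->
  pl_fun x0 m y0 s1 s2 r = y0 + k%:~R + s1 * m + s2 * (r - x0 - k%:~R - m).
Proof.
move=> [m01 s1p s2p s12] rk; have [r1|r1] := ltP r (x0 + k%:~R + 1); last first.
  have -> : r = x0 + k%:~R + 1 by lra.
  rewrite (@pl_fun1 _ _ _ _ _ (k + 1)) // ?rmorphD /=; last by lra.
  have -> : x0 + k%:~R + 1 - x0 - k%:~R - m = 1 - m by ring.
  have -> : x0 + k%:~R + 1 - x0 - (k%:~R + 1) = 0 by ring.
  by move: s12; move: (s1 * m) (s2 * (1 - m)) (k%:~R) => a b c; lra.
have fk : Num.floor (r - x0) = k by apply: floor_def; rewrite rmorphD /=; lra.
rewrite /pl_fun fk; case: ifPn => rm; last by rewrite addrA.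
have -> : r - x0 - k%:~R = m by lra.
by rewrite subrr mulr0 addr0.
Qed.

Lemma pl_cases (x0 m r : R) : exists k : int,
  (x0 + k%:~R <= r <= x0 + k%:~R + m) \/ (x0 + k%:~R + m <= r <= x0 + k%:~R + 1).
Proof.
exists (Num.floor (r - x0)); have := floor_itv (r - x0); rewrite rmorphD /= => h.
by have [h'|h'] := leP r (x0 + (Num.floor (r - x0))%:~R + m); [left|right]; lra.
Qed.

Lemma pl_D1 (x0 m y0 s1 s2 : R) : pl_params m s1 s2 -> forall r,
  pl_fun x0 m y0 s1 s2 (r + 1) = pl_fun x0 m y0 s1 s2 r + 1.
Proof.
move=> P r; have [m01 s1p s2p s12] := P; have [k [rk|rk]] := pl_cases x0 m r.
  rewrite (pl_fun1 _ _ _ m01 rk) (@pl_fun1 _ _ _ _ _ (k + 1)) ?rmorphD //=; last by lra.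
  have -> : r + 1 - x0 - (k%:~R + 1) = r - x0 - k%:~R by ring.
  lra.
rewrite (pl_fun2 _ P rk) (@pl_fun2 _ _ _ _ _ (k + 1)) ?rmorphD //=; last by lra.
have -> : r + 1 - x0 - (k%:~R + 1) - m = r - x0 - k%:~R - m by ring.
lra.
Qed.

Lemma pl_params_inv (m s1 s2 : R) : pl_params m s1 s2 ->
  pl_params (s1 * m) (s1^-1) (s2^-1).
Proof.
move=> [m01 s1p s2p s12]; have e : 1 - s1 * m = s2 * (1 - m) by lra.
have p1 : 0 < s1 * m by rewrite mulr_gt0 //; lra.
have p2 : 0 < s2 * (1 - m) by rewrite mulr_gt0 //; lra.
split; rewrite ?invr_gt0 //; first by lra.
by rewrite e !mulKf ?gt_eqF //; lra.
Qed.

Lemma pl_K (x0 m y0 s1 s2 : R) : pl_params m s1 s2 ->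
  cancel (pl_fun x0 m y0 s1 s2) (pl_fun y0 (s1 * m) x0 s1^-1 s2^-1).
Proof.
move=> P r; have [m01 s1p s2p s12] := P; have PV := pl_params_inv P.
have [sm01 _ _ _] := PV; have [k [rk|rk]] := pl_cases x0 m r.
  rewrite (pl_fun1 _ _ _ m01 rk); set d := r - x0 - k%:~R.
  have d0 : 0 <= d <= m by rewrite /d; lra.
  have sd : 0 <= s1 * d <= s1 * m by rewrite mulr_ge0 ?ler_wpM2l //; lra.
  rewrite (@pl_fun1 _ _ _ _ _ k) //; last by lra.
  have -> : y0 + k%:~R + s1 * d - y0 - k%:~R = s1 * d by ring.
  by rewrite mulKf ?gt_eqF // /d; lra.
rewrite (pl_fun2 _ P rk); set d := r - x0 - k%:~R - m.
have d0 : 0 <= d <= 1 - m by rewrite /d; lra.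
have sd : 0 <= s2 * d <= s2 * (1 - m) by rewrite mulr_ge0 ?ler_wpM2l //; lra.
rewrite (@pl_fun2 _ _ _ _ _ k) //; last by lra.
have -> : y0 + k%:~R + s1 * m + s2 * d - y0 - k%:~R - s1 * m = s2 * d by ring.
by rewrite !mulKf ?gt_eqF // /d; lra.
Qed.

Lemma pl_VK (x0 m y0 s1 s2 : R) : pl_params m s1 s2 ->
  cancel (pl_fun y0 (s1 * m) x0 s1^-1 s2^-1) (pl_fun x0 m y0 s1 s2).
Proof.
move=> P; have [_ s1p _ _] := P; have := @pl_K y0 (s1 * m) x0 s1^-1 s2^-1 (pl_params_inv P).
by rewrite mulKf ?gt_eqF // !invrK.
Qed.

Lemma pl_le (x0 m y0 s1 s2 : R) : pl_params m s1 s2 ->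
  {homo pl_fun x0 m y0 s1 s2 : r s / r <= s}.
Proof.
move=> P r s rs; have [m01 s1p s2p s12] := P.
have sg (c d d' : R) : 0 < c -> d <= d' -> c * d <= c * d' by move=> c0; rewrite ler_pM2l.
have [k rk] := pl_cases x0 m r; have [k' sk] := pl_cases x0 m s.
have bnd (v : R) (j : int) : (x0 + j%:~R <= v <= x0 + j%:~R + m) \/
    (x0 + j%:~R + m <= v <= x0 + j%:~R + 1) ->
    y0 + j%:~R <= pl_fun x0 m y0 s1 s2 v <= y0 + j%:~R + 1.
  have sm : 0 < s1 * m by rewrite mulr_gt0 //; lra.
  have sm' : 0 < s2 * (1 - m) by rewrite mulr_gt0 //; lra.
  case=> h; [rewrite (pl_fun1 _ _ _ m01 h)|rewrite (pl_fun2 _ P h)].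
    have h1 : s1 * (v - x0 - j%:~R) <= s1 * m by apply: sg => //; lra.
    have h2 : 0 <= s1 * (v - x0 - j%:~R) by rewrite mulr_ge0 //; lra.
    by move: h1 h2; move: (s1 * _) (s1 * m) (s2 * _) s12 sm sm' => *; lra.
  have h1 : s2 * (v - x0 - j%:~R - m) <= s2 * (1 - m) by apply: sg => //; lra.
  have h2 : 0 <= s2 * (v - x0 - j%:~R - m) by rewrite mulr_ge0 //; lra.
  lra.
have [kk|kk|ek] := ltgtP k k'.
- have : (k + 1)%:~R <= k'%:~R :> R by rewrite ler_int lezD1.
  by have := bnd r k rk; have := bnd s k' sk; rewrite rmorphD /=; lra.
- have : (k' + 1)%:~R <= k%:~R :> R by rewrite ler_int lezD1.
  rewrite rmorphD /= => h; have -> : r = s by case: rk sk => ? [] ?; lra.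
  by [].
subst k'; case: rk sk => rk [] sk.
- by rewrite (pl_fun1 _ _ _ m01 rk) (pl_fun1 _ _ _ m01 sk) lerD2l; apply: sg => //; lra.
- rewrite (pl_fun1 _ _ _ m01 rk) (pl_fun2 _ P sk).
  have h1 : s1 * (r - x0 - k%:~R) <= s1 * m by apply: sg => //; lra.
  have h2 : 0 <= s2 * (s - x0 - k%:~R - m) by rewrite mulr_ge0 //; lra.
  lra.
- have -> : r = s by lra.
  by [].
- by rewrite (pl_fun2 _ P rk) (pl_fun2 _ P sk) lerD2l; apply: sg => //; lra.
Qed.

Definition pl (x0 m y0 s1 s2 : R) (P : pl_params m s1 s2) : degree1 :=
  Degree1 (@pl_K x0 m y0 s1 s2 P) (@pl_VK x0 m y0 s1 s2 P) (@pl_le x0 m y0 s1 s2 P)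
    (@pl_D1 x0 m y0 s1 s2 P).

Lemma pl_paramsA : pl_params (8^-1) 7 (7^-1). Proof. by split; lra. Qed.
Lemma pl_paramsB : pl_params (6^-1) 5 (5^-1). Proof. by split; lra. Qed.

(** Each map fixes the break points of the other modulo 1: [mapA] fixes -1/12 and 1/12, [mapB] fixes
    1/16 and 3/16. The two composites thus have the same slope everywhere and differ by a constant,
    which is read off at 1/16, where they take the values -1/16 and -9/16. *)
Definition mapA : degree1 := pl (16^-1) (- 16^-1) pl_paramsA.
Definition mapB : degree1 := pl (- 12^-1) (- (2 / 3)) pl_paramsB.

(* Both sides commute with the unit translation, and are affine between the
   points -13/16, -1/12, 1/16, 1/12 and 3/16. *)
Lemma mapAB (r : R) : mapA (mapB r) = mapB (mapA r) + 2^-1.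
Proof.
have [mA _ _ _] := pl_paramsA; have [mB _ _ _] := pl_paramsB.
suff main (v : R) : - (13 / 16) <= v <= 3 / 16 -> mapA (mapB v) = mapB (mapA v) + 2^-1.
  have /andP[h1 h2] := floor_itv (r + 13 / 16); rewrite rmorphD /= in h2.
  move: (Num.floor _) h1 h2 => k h1 h2.
  rewrite -(subrK k%:~R r) (deg_Dz mapB) (deg_Dz mapA) (deg_Dz mapA) (deg_Dz mapB) main; last by lra.
  by rewrite addrAC.
move=> v01.
have A1 (u : R) : 16^-1 <= u <= 3 / 16 -> mapA u = 7 * u - 2^-1.
  by move=> h; rewrite [LHS](@pl_fun1 _ _ _ _ _ 0) //; lra.
have A2 (u : R) : - (13 / 16) <= u <= 16^-1 -> mapA u = u / 7 - 14^-1.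
  by move=> h; rewrite [LHS](@pl_fun2 _ _ _ _ _ (- 1)) //; [lra|exact: pl_paramsA|lra].
have B1 (u : R) : - 12^-1 <= u <= 12^-1 -> mapB u = 5 * u - 4^-1.
  by move=> h; rewrite [LHS](@pl_fun1 _ _ _ _ _ 0) //; lra.
have B2 (u : R) : 12^-1 <= u <= 11 / 12 -> mapB u = u / 5 + 3 / 20.
  by move=> h; rewrite [LHS](@pl_fun2 _ _ _ _ _ 0) //; [lra|exact: pl_paramsB|lra].
have B3 (u : R) : - (11 / 12) <= u <= - 12^-1 -> mapB u = u / 5 - 13 / 20.
  by move=> h; rewrite [LHS](@pl_fun2 _ _ _ _ _ (- 1)) //; [lra|exact: pl_paramsB|lra].
have [v1|v1] := leP v (- 12^-1).
  rewrite (B3 v); last by lra.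
  rewrite A2; last by lra.
  rewrite (A2 v); last by lra.
  by rewrite B3; lra.
have [v2|v2] := leP v (16^-1).
  rewrite (B1 v); last by lra.
  rewrite A2; last by lra.
  rewrite (A2 v); last by lra.
  by rewrite B1; lra.
have [v3|v3] := leP v (12^-1).
  rewrite (B1 v); last by lra.
  rewrite A1; last by lra.
  rewrite (A1 v); last by lra.
  by rewrite B1; lra.
rewrite (B2 v); last by lra.
rewrite A1; last by lra.
rewrite (A1 v); last by lra.
by rewrite B2; lra.
Qed.

Lemma mapAB_comm : [~ mapB^-1, mapA^-1]%g = transl (- 2^-1).
Proof.
rewrite commgEl /conjg !invgK; apply: (@mulIg _ mapA); apply: (@mulIg _ mapB).
rewrite !mulgA !mulgVK; apply: degree1_eq => r.
by rewrite ![in RHS]degM mapAB !degM /= addrK.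
Qed.

Lemma degree1_bound (f : degree1) (r : R) : `|f r - r - f 0| <= 1.
Proof.
have := floor_itv r; rewrite rmorphD /= => h; set k := Num.floor r in h.
have h1 : f k%:~R <= f r by apply: deg_le; lra.
have h2 : f r <= f (k%:~R + 1) by apply: deg_le; lra.
have e : f k%:~R = f 0 + k%:~R by rewrite -deg_Dz add0r.
move: h1 h2; rewrite deg_D1 e ler_norml; lra.
Qed.

Lemma degree1_quasi (f g : degree1) : `|(f * g)%g 0 - f 0 - g 0| <= 1.
Proof. by rewrite degM addrAC; exact: degree1_bound. Qed.

End PLMaps.

(** * Twisting by a cocycle on Z^2 *)

Section Twisted.
Context {R : realType}.
Local Notation deg := (@degree1 R).
Local Notation tz k := (@transl R k%:~R).

(* The central extension of Z^2 by the group of degree one maps, with cocycle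
   given by the integer translations. *)
Definition twisted : Type := (deg * (int * int))%type.

HB.instance Definition _ := gen_eqMixin twisted.
HB.instance Definition _ := gen_choiceMixin twisted.

Definition tw_mul (g h : twisted) : twisted :=
  ((g.1 * h.1 * tz (g.2.1 * h.2.2))%g, (g.2.1 + h.2.1, g.2.2 + h.2.2)).
Definition tw_one : twisted := (1%g, (0, 0)).
Definition tw_inv (g : twisted) : twisted :=
  ((g.1^-1 * tz (g.2.1 * g.2.2))%g, (- g.2.1, - g.2.2)).

Lemma tzE (k : int) r : tz k r = r + k%:~R. Proof. by []. Qed.

Lemma deg_VE (f : deg) r : f ((f^-1)%g r) = r. Proof. exact: deg_VK. Qed.

Lemma deg_VE' (f : deg) r : (f^-1)%g (f r) = r. Proof. exact: deg_K. Qed.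

Lemma tw_mulA : associative tw_mul.
Proof.
move=> [f [p q]] [g [p' q']] [h [p'' q'']]; rewrite /tw_mul /= !addrA; congr (_, _).
apply: degree1_eq => r; rewrite !degM !tzE !deg_Dz !rmorphM !rmorphD /=.
by rewrite -!addrA; congr (_ + _); ring.
Qed.

Lemma tw_mul1 : left_id tw_one tw_mul.
Proof.
move=> [f [p q]]; rewrite /tw_mul /= !add0r; congr (_, _).
by apply: degree1_eq => r; rewrite !degM tzE mul0r addr0.
Qed.

Lemma tw_mulr1 : right_id tw_one tw_mul.
Proof.
move=> [f [p q]]; rewrite /tw_mul /= !addr0; congr (_, _).
by apply: degree1_eq => r; rewrite !degM tzE mulr0 addr0.
Qed.

Lemma tw_mulV : left_inverse tw_one tw_inv tw_mul.
Proof.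
move=> [f [p q]]; rewrite /tw_mul /= !addNr; congr (_, _).
apply: degree1_eq => r; rewrite !degM !tzE !deg_Dz deg_VE' mulNr rmorphN /=; ring.
Qed.

Lemma tw_mulrV : right_inverse tw_one tw_inv tw_mul.
Proof.
move=> [f [p q]]; rewrite /tw_mul /= !addrN; congr (_, _).
apply: degree1_eq => r; rewrite !degM !tzE !deg_Dz deg_VE mulrN rmorphN /=; ring.
Qed.

HB.instance Definition _ :=
  isGroup.Build twisted tw_mulA tw_mul1 tw_mulr1 tw_mulV tw_mulrV.

Lemma twM (g h : twisted) : (g * h)%g =
  ((g.1 * h.1 * tz (g.2.1 * h.2.2))%g, (g.2.1 + h.2.1, g.2.2 + h.2.2)) :> twisted.
Proof. by []. Qed.

Lemma twR (g h : twisted) : [~ g, h]%g =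
  (([~ g.1, h.1] * tz (g.2.1 * h.2.2 - h.2.1 * g.2.2))%g, (0, 0)) :> twisted.
Proof.
apply: (@mulgI _ (h * g)%g); rewrite -commgC !twM /= !addr0; congr (_, (_, _)).
- move: (commgC g.1 h.1); move: [~ g.1, h.1]%g => c gh; apply: degree1_eq => r.
  have E s : g.1 (h.1 s) = h.1 (g.1 (c s)) by rewrite -!degM gh.
  by rewrite mulr0 !degM !tzE !deg_Dz E rmorphB !rmorphM /=; ring.
- by rewrite addrC.
- by rewrite addrC.
Qed.

(** The bound is uniform in [f] and [g]. Hence the maps of the line contribute nothing to the form
    in [euler_form], which sees only the cocycle. *)
Lemma degR_bound (f g : deg) : `|[~ f, g]%g 0| <= 3.
Proof.
have := degree1_quasi (g * f)%g [~ f, g]%g; have := degree1_quasi f g.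
have := degree1_quasi g f; rewrite -commgC !ler_norml.
by move: (_ 0) (_ 0) (_ 0) (_ 0) (_ 0) => *; lra.
Qed.

End Twisted.

(** * Realization of forms *)

Section Forms.
Context {R : realType} {G : groupType} {l : nat} (l_gt1 : (1 < l)%N) (a b : nat -> G).
Hypothesis pres : surface_presentation l a b.
Local Notation N := (commutator_group G).
Local Notation inN g := (g \in @commutator_subgroup G).

(** In this single list the ith handle consists of the positions i and l + i. *)
Definition gens (i : nat) : G := if (i < l)%N then a i else b (i - l)%N.

Lemma gens_hom (K : groupType) (y : nat -> K) :
  (\prod_(i < l) [~ y i, y (l + i)%N] = 1)%g ->
  exists2 f : G -> K, (forall g h, f (g * h) = f g * f h)%g &
    forall i, (i < l + l)%N -> f (gens i) = y i.
Proof.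
case: pres => _ _ univ /(univ K y (fun i => y (l + i)%N)) [f fM fE].
exists f => // i il; rewrite /gens; have [il'|il'] := ltnP i l; first by case: (fE i il').
have il2 : (i - l < l)%N by lia.
by have [_ ->] := fE _ il2; rewrite subnKC.
Qed.

Lemma gens_rel : (\prod_(i < l) [~ gens i, gens (l + i)%N] = 1)%g.
Proof.
case: pres => _ rel _; rewrite -[RHS]rel; apply: eq_bigr => i _.
by rewrite /gens ltn_ord ltnNge leq_addr /= addKn.
Qed.

Lemma gens_gen (H : set G) : H 1%g -> (forall g h, H g -> H h -> H (g * h)%g) ->
  (forall g, H g -> H (g^-1)%g) -> (forall i, (i < l + l)%N -> H (gens i)) -> forall g, H g.
Proof.
case: pres => gen _ _ H1 HM HV Hx; apply: gen => // i il; split.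
  by have := Hx i; rewrite /gens il; apply; lia.
have <- : gens (l + i)%N = b i by rewrite /gens ltnNge leq_addr /= addKn.
by apply: Hx; lia.
Qed.

Lemma additive_expgz (V : zmodType) (s : G -> V) : (forall g h, s (g * h)%g = s g + s h) ->
  forall g (k : int), s (expgz g k) = s g *~ k.
Proof.
move=> sM g; have s1 : s 1%g = 0 by apply: (@addrI _ (s 1%g)); rewrite -sM mulg1 addr0.
have sV h : s (h^-1)%g = - s h by apply/eqP; rewrite -addr_eq0 -sM mulVg s1.
have pos (k : nat) : s (g ^+ k)%g = s g *+ k.
  by elim: k => [|k IH]; rewrite ?s1 // expgS sM IH mulrS.
by case=> k /=; rewrite ?sV pos.
Qed.

Lemma heis_hom (B : nat -> nat -> R) :
  \sum_(i < l) (B i (l + i)%N - B (l + i)%N i) = 0 ->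
  exists2 f : G -> heisenberg (l + l)%N B, (forall g h, f (g * h) = f g * f h)%g &
    forall i, (i < l + l)%N -> f (gens i) = (0, fun j => Posz (i == j)).
Proof.
move=> B0; pose y (i : nat) : heisenberg (l + l)%N B := (0, fun j => Posz (i == j)).
apply: (gens_hom (y := y)).
have delta i j : (i < l + l)%N -> (j < l + l)%N -> biform (l + l)%N B (y i).2 (y j).2 = B i j.
  move=> im jm; have := biform_delta B 1 1 im jm; rewrite !mul1r => <-.
  by congr biform; apply/funext => i'; rewrite mul1r.
have E m : (m <= l)%N -> (\prod_(i < m) [~ y i, y (l + i)%N])%g =
    (\sum_(i < m) (B i (l + i)%N - B (l + i)%N i), fun=> 0) :> heisenberg (l + l)%N B.
  elim: m => [_|m IH ml]; first by rewrite !big_ord0.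
  rewrite !big_ord_recr /= IH ?(ltnW ml) // heisR heisM !delta; [|lia..].
  by rewrite /= biform0l addr0; congr (_, _); apply/funext => i; rewrite addr0.
by rewrite E // B0.
Qed.

Lemma abelianization : exists2 ab : G -> nat -> int,
  (forall g h i, ab (g * h)%g i = ab g i + ab h i) &
  forall i j, (i < l + l)%N -> ab (gens i) j = (i == j).
Proof.
(* For the zero form the group is a direct product, and its integer component is the abelianization
   of G in coordinates. *)
have [|f fM fE] := @heis_hom (fun _ _ => 0); first by rewrite big1 // => i _; rewrite subrr.
exists (fun g => (f g).2) => [g h i|i j im]; first by rewrite fM.
by rewrite fE.
Qed.

Lemma H1_Q (h : N -> R^o) : H1_invariant R N h -> Q_invariant R N h.
Proof.
move=> [hM hc]; split => //; split.
  by exists 0 => y z; rewrite hM [h y + h z]addrC addrK subrr normr0.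
have h1 : h 1%g = 0 by apply: (@addrI _ (h 1%g)); rewrite -hM mulg1 addr0.
have hV z : h (z^-1)%g = - h z by apply/eqP; rewrite -addr_eq0 -hM mulVg h1.
move=> y; have pos (k : nat) : h (y ^+ k)%g = k%:R * h y.
  by elim: k => [|k IH]; rewrite ?mul0r // expgS hM IH -natr1 mulrDl mul1r addrC.
by case=> k /=; rewrite ?hV pos // NegzE mulrNz mulNr.
Qed.

(** The hypothesis is the surface relation in the Heisenberg group. Commutators land in its centre,
    where the real coordinate is additive and invariant under conjugation. *)
Lemma heis_form (B : nat -> nat -> R) :
  \sum_(i < l) (B i (l + i)%N - B (l + i)%N i) = 0 ->
  exists2 h : N -> R^o, H1_invariant R N h &
    has_form gens (l + l)%N h (fun i j => B i j - B j i).
Proof.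
move=> /heis_hom[f fM fE].
have fN g : inN g -> (f g).2 = fun=> 0.
  move=> gN; apply/funext => i; apply: (@ab_N _ (fun g => (f g).2)) => // g1 h1 i1.
  by rewrite fM.
have fp g (k : int) i : (f (expgz g k)).2 i = k * (f g).2 i.
  rewrite (@additive_expgz int (fun g => (f g).2 i)) => [|g1 h1]; last by rewrite fM.
  by rewrite mulrzz mulrC.
pose h (y : N) : R^o := (f (val y)).1.
exists h; first split.
- move=> y z; rewrite /h valM fM heisM /= fN ?biform0l ?addr0 //; exact: valP.
- move=> g y z zE; rewrite /h.
  have : f (val z * g)%g = f (g * val y)%g by rewrite zE mulgVK.
  rewrite !fM !heisM (fN (val y)) ?(fN (val z)); [|exact: valP..].
  by rewrite biform0l biform0r !addr0 [(f g).1 + _]addrC => -[/addIr].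
move=> i j im jm; exists 0 => k m.
have [z zE] := NP (NR (expgz (gens i) k) (expgz (gens j) m)).
rewrite -zE extend0E /h zE (homR fM) heisR /=.
have d (i' : nat) (k' : int) : (i' < l + l)%N ->
    (f (expgz (gens i') k')).2 = fun j' => k' * (i' == j')%:Z.
  by move=> im'; apply/funext => j'; rewrite fp fE.
by rewrite !d // !biform_delta // [m%:~R * _]mulrC -mulrBr subrr normr0.
Qed.

Lemma euler_form : exists2 f : N -> R^o, Q_invariant R N f &
  has_form gens (l + l)%N f (fun i j =>
    ((i == 0%N) && (j == l))%:R - ((j == 0%N) && (i == l))%:R).
Proof.
(* [a 0], [b 0] and [a 1], [b 1] go to pairs with the same commutator, half a
   translation; only the first pair moves the factor [Z^2], and its cocycle cancels
   the resulting integer translation. *)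
pose A := ((@mapB R)^-1)%g; pose B := ((@mapA R)^-1)%g.
pose y (i : nat) : twisted := (if (i == 0%N) || (i == 1%N) then A
  else if (i == l) || (i == l.+1) then B else 1%g, ((i == 0%N)%:Z, (i == l)%:Z)).
have rel : (\prod_(i < l) [~ y i, y (l + i)%N] = 1)%g.
  have lE : l = (l - 2).+2 by lia.
  have E m : (\prod_(i < m) [~ y i.+2, y (l + i.+2)%N] = 1)%g.
    rewrite big1 // => i _; rewrite twR /y /=.
    have -> : ((l + i.+2)%N == l) || ((l + i.+2)%N == l.+1) = false.
      by apply/negbTE; rewrite negb_or; apply/andP; split; apply/eqP; lia.
    have -> : ((l + i.+2)%N == 0%N) || ((l + i.+2)%N == 1%N) = false.
      by apply/negbTE; rewrite negb_or; apply/andP; split; apply/eqP; lia.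
    have -> : ((l + i.+2)%N == 0%N) = false by apply/eqP; lia.
    rewrite commg1 mul0r mul0r subrr; congr (_, _).
    by apply: degree1_eq => r; rewrite degM tzE addr0.
  have -> : (\prod_(i < l) [~ y i, y (l + i)%N] =
    \prod_(i < (l - 2).+2) [~ y i, y (l + i)%N])%g by rewrite -lE.
  rewrite !big_ord_recl /= (E (l - 2)%N) mulg1.
  have l0 : (l == 0%N) = false by apply/eqP; lia.
  have l1 : (l == 1%N) = false by apply/eqP; lia.
  have l2 : (l.+1 == l) = false by apply/eqP; lia.
  have l3 : (1%N == l) = false by apply/eqP; lia.
  have l4 : (0%N == l) = false by apply/eqP; lia.
  have y0 : y 0%N = (A, (1, 0)) by rewrite /y /= l4.
  have y1 : y 1%N = (A, (0, 0)) by rewrite /y /= l3.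
  have yl : y l = (B, (0, 1)) by rewrite /y l0 l1 eqxx.
  have yl1 : y l.+1 = (B, (0, 0)) by rewrite /y eqSS l0 l2 eqxx.
  rewrite /bump /= addn0 addn1 y0 y1 yl yl1 !twR twM /= mulr1 !mul0r ?subr0 ?addr0 ?subrr.
  congr (_, _).
  have AB : [~ A, B]%g = transl (- 2^-1) by exact: mapAB_comm.
  by rewrite AB; apply: degree1_eq => r; rewrite !degM !tzE /=; lra.
have [f fM fE] := gens_hom rel.
have fN g : inN g -> (f g).2 = (0, 0).
  move=> gN; rewrite [LHS]surjective_pairing; congr (_, _).
    apply: (@ab_N _ (fun g _ => (f g).2.1) _ g gN 0%N) => g1 h1 _.
    by rewrite fM.
  apply: (@ab_N _ (fun g _ => (f g).2.2) _ g gN 0%N) => g1 h1 _.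
  by rewrite fM.
have fp1 g (k : int) : (f (expgz g k)).2.1 = k * (f g).2.1.
  rewrite (@additive_expgz int (fun g => (f g).2.1)) => [|g1 h1]; last by rewrite fM.
  by rewrite mulrzz mulrC.
have fp2 g (k : int) : (f (expgz g k)).2.2 = k * (f g).2.2.
  rewrite (@additive_expgz int (fun g => (f g).2.2)) => [|g1 h1]; last by rewrite fM.
  by rewrite mulrzz mulrC.
(* On N the Z^2 component vanishes, so the cocycle is silent there and [(f _).1] is multiplicative.
   The homogenization of [u] is a translation number. *)
pose u (z : N) : R^o := (f (val z)).1 0.
have tz0 (g : @degree1 R) : (g * transl (0%R : int)%:~R)%g = g.
  by apply: degree1_eq => r; rewrite degM tzE addr0.
have fN1 g (h : twisted) : inN g -> (f g * h)%g.1 = ((f g).1 * h.1)%g.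
  by move=> gN; rewrite twM (fN g gN) /= mul0r tz0.
have fN2 g (h : twisted) : inN g -> (h * f g)%g.1 = (h.1 * (f g).1)%g.
  by move=> gN; rewrite twM (fN g gN) /= mulr0 tz0.
have uq : quasimorphism u.
  exists 1 => z z'; rewrite /u valM fM fN1; last exact: valP.
  exact: degree1_quasi.
have [F [qF hF] [C FC]] := homogenization uq.
exists F.
  split; first by split.
  move=> g z z' zE; apply/eqP; rewrite -subr_eq0; apply/eqP.
  apply: (@bounded_multiples R _ (2 * C + 2)) => k.
  have := FC (expgz z k); have := FC (expgz z' k); rewrite !hF -pmulrn mulrBr.
  have zkE : val (expgz z' k) = (g * val (expgz z k) * g^-1)%g.
    have cM v w : (g * (v * w) * g^-1 = (g * v * g^-1) * (g * w * g^-1))%g.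
      by rewrite !mulgA mulgVK.
    by rewrite !val_expgz zE -(hom_expgz cM).
  have uu : `|u (expgz z' k) - u (expgz z k)| <= 2.
    have e : f (val (expgz z' k) * g)%g = f (g * val (expgz z k))%g by rewrite zkE mulgVK.
    have e1 : ((f (val (expgz z' k))).1 * (f g).1)%g = ((f g).1 * (f (val (expgz z k))).1)%g.
      have := fN1 _ (f g) (valP (expgz z' k)); have := fN2 _ (f g) (valP (expgz z k)).
      by rewrite -!fM -e => <- <-.
    have := degree1_quasi (f (val (expgz z' k))).1 (f g).1.
    have := degree1_quasi (f g).1 (f (val (expgz z k))).1.
    by rewrite e1 /u !ler_norml; move: (_ 0) (_ 0) (_ 0) (_ 0) => *; lra.
  move: uu; rewrite !ler_norml.
  by move: (u _) (u _) (_ * _) (_ * _) => *; lra.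
move=> i j im jm; exists (C + 3) => k m.
have [z zE] := NP (NR (expgz (gens i) k) (expgz (gens j) m)).
(* The commutator of the lifts is bounded, while the cocycle contributes the bilinear term exactly;
   that term is the form. *)
have uz : u z = [~ (f (expgz (gens i) k)).1, (f (expgz (gens j) m)).1]%g 0 +
    k%:~R * m%:~R * (((i == 0%N) && (j == l))%:R - ((j == 0%N) && (i == l))%:R).
  have R1 (g h : twisted) : [~ g, h]%g.1 =
      ([~ g.1, h.1] * transl (g.2.1 * h.2.2 - h.2.1 * g.2.2)%R%:~R)%g by rewrite twR.
  rewrite /u zE (homR fM) R1 !fp1 !fp2 !fE // degM tzE deg_Dz; congr (_ + _).
  rewrite /= rmorphB !rmorphM /= -!pmulrn.
  by case: (i == 0%N) (j == l) (j == 0%N) (i == l) => -[] [] [] /=; ring.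
rewrite -zE extend0E; have := FC z; have := degR_bound (f (expgz (gens i) k)).1 (f (expgz (gens j) m)).1.
rewrite uz !ler_norml.
by move: (_ 0) (_ * _ * _) => *; lra.
Qed.

End Forms.

(** * Dimensions of the quotients *)

Section Dimensions.
Context {R : realType} {G : groupType} {l : nat} (l_gt1 : (1 < l)%N) (a b : nat -> G).
Hypothesis pres : surface_presentation l a b.
Local Notation N := (commutator_group G).
Local Notation inN g := (g \in @commutator_subgroup G).
Local Notation x := (gens (l := l) a b).
Local Notation m := (l + l)%N.
Implicit Types (f h : N -> R^o) (w : nat -> nat -> R).

Lemma has_form_ext f w w' : has_form x m f w ->
  (forall i j, (i < m)%N -> (j < m)%N -> w i j = w' i j) -> has_form x m f w'.
Proof. by move=> fw ww i j im jm; rewrite -ww //; exact: fw. Qed.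

Lemma has_form_sum n (c : 'I_n -> R) (F : 'I_n -> N -> R^o) (W : 'I_n -> nat -> nat -> R) :
  (forall t, has_form x m (F t) (W t)) ->
  has_form x m (\sum_t c t *: F t) (fun i j => \sum_t c t * W t i j).
Proof.
move=> FW; elim: (index_enum _) => [|t r IH].
  move=> i j _ _; exists 0 => k p; rewrite !big_nil mulr0 subr0.
  by rewrite /extend0; case: insub => [y|]; rewrite normr0.
rewrite big_cons; apply: has_form_ext (has_formD (has_formZ (c t) (FW t)) IH) _.
by move=> i j _ _; rewrite big_cons.
Qed.

Lemma Q_invariantD f h : Q_invariant R N f -> Q_invariant R N h -> Q_invariant R N (f + h).
Proof.
move=> [[[D fD] fh] fc] [[[E hE] hh] hc]; split; first split.
- exists (D + E) => y z; have := fD y z; have := hE y z; rewrite !ler_norml.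
  rewrite -[(f + h) (y * z)%g]/(f (y * z)%g + h (y * z)%g).
  rewrite -[(f + h) y]/(f y + h y) -[(f + h) z]/(f z + h z).
  by move: (f _) (f _) (f _) (h _) (h _) (h _) => *; lra.
- move=> y k; rewrite -[LHS]/(f (expgz y k) + h (expgz y k)) fh hh.
  by rewrite -mulrDr.
- by move=> g y z zE; rewrite -[LHS]/(f z + h z) (fc g y z zE) (hc g y z zE).
Qed.

Lemma Q_invariantZ c f : Q_invariant R N f -> Q_invariant R N (c *: f).
Proof.
move=> [[[D fD] fh] fc]; split; first split.
- exists (`|c| * D) => y z; have := fD y z.
  rewrite -[(c *: f) (y * z)%g]/(c * f (y * z)%g).
  rewrite -[(c *: f) y]/(c * f y) -[(c *: f) z]/(c * f z) -!mulrBr normrM.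
  exact: ler_wpM2l.
- by move=> y k; rewrite -[LHS]/(c * f (expgz y k)) fh mulrCA.
- by move=> g y z zE; rewrite -[LHS]/(c * f z) (fc g y z zE).
Qed.

Lemma Q_invariant_sum n (c : 'I_n -> R) (F : 'I_n -> N -> R^o) :
  (forall t, Q_invariant R N (F t)) -> Q_invariant R N (\sum_t c t *: F t).
Proof.
move=> FQ; elim: (index_enum _) => [|t r IH]; rewrite (big_nil, big_cons).
  split; first split=> [|y k]; [|by rewrite mulr0|by []].
  by exists 0 => y z; rewrite !subr0 normr0.
exact: Q_invariantD (Q_invariantZ _ (FQ t)) IH.
Qed.

Lemma Q_invariantB f h : Q_invariant R N f -> Q_invariant R N h -> Q_invariant R N (f - h).
Proof. by move=> fQ hQ; rewrite -scaleN1r; apply: Q_invariantD (Q_invariantZ _ hQ). Qed.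

Lemma has_formB f h w w' : has_form x m f w -> has_form x m h w' ->
  has_form x m (f - h) (fun i j => w i j - w' i j).
Proof.
move=> fw hw; rewrite -scaleN1r.
apply: has_form_ext (has_formD fw (has_formZ (-1) hw)) _.
by move=> i j _ _; rewrite mulN1r.
Qed.

(** Makes an alternating form out of free coefficients above the diagonal; elementary matrices
    become the basis of the space of forms. *)
Definition alternate w i j : R :=
  (if (i < j)%N then w i j else 0) - (if (j < i)%N then w j i else 0).

Lemma alternate_form f w i j : Q_invariant R N f -> has_form x m f w ->
  (i < m)%N -> (j < m)%N -> alternate w i j = w i j.
Proof.
move=> fQ fw im jm; have ww := has_form_alternating fQ fw im jm.
rewrite /alternate; case: ltngtP => [_|_|ij]; first by rewrite subr0.
  by rewrite ww sub0r opprK.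
by move: ww; rewrite ij; lra.
Qed.

Lemma restriction_criterion f w : Q_invariant R N f -> has_form x m f w ->
  (forall i j, (i < j)%N -> (j < m)%N -> w i j = 0) -> Q_restriction R N f.
Proof.
move=> fQ fw w0; have [ab abM abx] := @abelianization R G l l_gt1 a b pres.
apply: (extension_criterion abM abx (gens_gen l_gt1 pres) fQ) => i j im jm.
have [C fC] := fw i j im jm; exists C => k p; have := fC k p.
have -> : w i j = 0.
  rewrite -(alternate_form fQ fw im jm) /alternate.
  by case: ltngtP => [ij|ij|_]; rewrite ?w0 // subr0.
by rewrite mulr0 subr0.
Qed.

Lemma H1_extend0M h g g' : H1_invariant R N h -> inN g -> inN g' ->
  extend0 h (g * g')%g = extend0 h g + extend0 h g'.
Proof. by move=> [hM _] /NP[y <-] /NP[z <-]; rewrite -valM !extend0E hM. Qed.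

(* As [[g g', y]] is a conjugate of [[g, y]] times [[g', y]], an invariant
   homomorphism of the commutators is additive in the left argument. *)
Lemma H1_form_sum h w : H1_invariant R N h -> has_form x m h w ->
  \sum_(i < l) w i (l + i)%N = 0.
Proof.
move=> hH hw; have [_ hc] := hH; have [[_ hh] _] := H1_Q hH.
have sM y g g' : extend0 h [~ (g * g')%g, y]%g = extend0 h [~ g, y]%g + extend0 h [~ g', y]%g.
  rewrite -(extend0J hc (g'^-1)%g (NR g y)) -(H1_extend0M hH); [|apply: NJ; exact: NR|exact: NR].
  by congr extend0; rewrite !commgEl /conjg !invgK !invgM !mulgA !mulgK.
have wE i j : (i < m)%N -> (j < m)%N -> w i j = extend0 h [~ x i, x j]%g.
  move=> im jm; have [C hC] := hw i j im jm.
  apply/eqP; rewrite eq_sym -subr_eq0; apply/eqP; apply: (@bounded_multiples R _ C) => k.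
  have := hC k 1; rewrite (additive_expgz (sM _)) mulr1 -!pmulrn mulrBr.
  by rewrite [k%:R * extend0 _ _]mulr_natl expgz1.
have -> : \sum_(i < l) w i (l + i)%N = \sum_(i < l) extend0 h [~ x i, x (l + i)%N]%g.
  by apply: eq_bigr => -[i il] _; apply: wE => /=; lia.
have prodE n : inN (\prod_(i < n) [~ x i, x (l + i)%N])%g /\
    \sum_(i < n) extend0 h [~ x i, x (l + i)%N]%g =
    extend0 h (\prod_(i < n) [~ x i, x (l + i)%N])%g.
  elim: n => [|n [nN IH]]; first by rewrite !big_ord0 N1 extend01.
  rewrite !big_ord_recr /= IH -(H1_extend0M hH) //; last exact: NR.
  by split=> //; apply: NM => //; exact: NR.
by rewrite (prodE l).2 (gens_rel pres) extend01.
Qed.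

Local Notation delta p q := (fun i j => ((i == p) && (j == q))%:R : R).

(** The form of [eu] has sum 1. Removing [s] times it leaves sum zero, which is the condition under
    which [heis_form] produces an invariant homomorphism. *)
Lemma alternate_realized eu w :
  has_form x m eu (fun i j => delta 0%N l i j - delta l 0%N i j) ->
  exists2 h, H1_invariant R N h &
    has_form x m (h + (\sum_(i < l) w i (l + i)%N) *: eu) (alternate w).
Proof.
move=> euF; set s := \sum_(i < l) _.
pose B i j := if (i < j)%N then w i j - s * delta 0%N l i j else 0.
have B0 : \sum_(i < l) (B i (l + i)%N - B (l + i)%N i) = 0.
  have -> : \sum_(i < l) (B i (l + i)%N - B (l + i)%N i) =
      \sum_(i < l) (w i (l + i)%N - s * (i == 0%N :> nat)%:R).
    apply: eq_bigr => -[i il] _ /=; rewrite /B.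
    have -> : (i < l + i)%N by lia.
    have -> : (l + i < i)%N = false by lia.
    rewrite subr0 -{3}[l]addn0 eqn_add2l andbb; by [].
  rewrite sumrB -/s -mulr_sumr (bigD1 (Ordinal (ltnW l_gt1))) //= big1 ?addr0 ?mulr1 ?subrr //.
  by move=> i i0; rewrite (_ : (i == 0%N :> nat) = false) //; apply/negbTE; apply: contra i0.
have [h hH hB] := heis_form l_gt1 pres B0; exists h => //.
apply: has_form_ext (has_formD hB (has_formZ s euF)) _ => i j im jm.
rewrite /B /alternate; case: ltngtP => [ij|ij|->].
- have -> : (i == l) && (j == 0%N) = false by lia.
  by rewrite !subr0; lra.
- have -> : (i == 0%N) && (j == l) = false by lia.
  by rewrite [(i == l) && _]andbC /=; lra.
- have -> : (j == 0%N) && (j == l) = false by lia.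
  have -> : (j == l) && (j == 0%N) = false by lia.
  by lra.
Qed.

Lemma card_increasing_pairs n : #|[pred p : 'I_n * 'I_n | (p.1 < p.2)%N]| = 'C(n, 2).
Proof.
rewrite -bin2_sum big_mkord -sum1_card.
rewrite -(pair_big_dep xpredT (fun i j : 'I_n => (i < j)%N) (fun _ _ => 1%N)) /=.
rewrite (exchange_big_dep xpredT) //=; apply: eq_bigr => -[j jn] _ /=.
by rewrite -(big_ord_widen n (fun=> 1%N)) ?sum1_card ?card_ord // ltnW.
Qed.

Lemma increasing_pairs : exists e : 'I_(l * (2 * l - 1)) -> nat * nat,
  [/\ injective e, forall t, ((e t).1 < (e t).2 < m)%N &
    forall i j, (i < j)%N -> (j < m)%N -> exists t, e t = (i, j)].
Proof.
pose A := [pred p : 'I_m * 'I_m | (p.1 < p.2)%N].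
have cA : (l * (2 * l - 1))%N = #|A|.
  by rewrite card_increasing_pairs mul2n subn1 bin2 addnn -[X in (X * _)./2]mul2n -mulnA mul2n doubleK.
exists (fun t => let p := enum_val (cast_ord cA t) in (val p.1, val p.2)); split.
- move=> t t' [/val_inj e1 /val_inj e2]; apply: (@cast_ord_inj _ _ cA); apply: enum_val_inj.
  by rewrite [LHS]surjective_pairing e1 e2 -surjective_pairing.
- by move=> t; have := enum_valP (cast_ord cA t); rewrite inE /= => ->; rewrite ltn_ord.
move=> i j ij jm; have im := ltn_trans ij jm.
have pA : (Ordinal im, Ordinal jm) \in A by rewrite inE.
by exists (cast_ord (esym cA) (enum_rank_in pA (Ordinal im, Ordinal jm))); rewrite cast_ordKV enum_rankK_in.
Qed.

Lemma dim_Q_invariant_quotient :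
  dim_quotient_eq (Q_invariant R N) (Q_restriction R N) (l * (2 * l - 1))%N.
Proof.
have [eu euQ euF] := @euler_form R G l l_gt1 a b pres.
have euF' : has_form x m eu (fun i j => delta 0%N l i j - delta l 0%N i j).
  by apply: has_form_ext euF _ => i j _ _; rewrite [(j == 0%N) && _]andbC.
have [e [e_inj e_lt e_surj]] := increasing_pairs.
have real t : exists F, Q_invariant R N F /\
    has_form x m F (alternate (delta (e t).1 (e t).2)).
  have [h hH hF] := alternate_realized (delta (e t).1 (e t).2) euF'.
  by eexists; split; [|exact: hF]; apply: Q_invariantD (H1_Q hH) (Q_invariantZ _ euQ).
have [F FP] := choice real.
(* The forms of the [F t] are dual to evaluation at the pairs [e t']. This gives independence and
   also the coefficients of an arbitrary element. *)
have FE t t' : alternate (delta (e t).1 (e t).2) (e t').1 (e t').2 = (t == t')%:R.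
  have /andP[lt _] := e_lt t'; rewrite /alternate lt ltnNge (ltnW lt) /= subr0.
  congr ((nat_of_bool _)%:R); apply/idP/eqP => [/andP[/eqP e1 /eqP e2]|->]; last by rewrite !eqxx.
  by apply: e_inj; rewrite [RHS]surjective_pairing e1 e2 -surjective_pairing.
split; first by move=> f; exact: Q_restriction_invariant.
exists F; split=> [t|c cF t|v vQ]; first by case: (FP t).
  have SF := has_form_sum c (fun t => (FP t).2).
  have /andP[lt tm] := e_lt t.
  have := has_form_unique SF (Q_restriction_form x cF) (ltn_trans lt tm) tm.
  rewrite (bigD1 t) //= FE eqxx mulr1 big1 ?addr0 // => t' tt'.
  by rewrite FE (negbTE tt') mulr0.
have [w vw] := has_form_exists x m vQ.
exists (fun t => w (e t).1 (e t).2).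
have SF := has_form_sum (fun t => w (e t).1 (e t).2) (fun t => (FP t).2).
apply: restriction_criterion (has_formB vw SF) _.
  by apply: Q_invariantB => //; apply: Q_invariant_sum => t; case: (FP t).
move=> i j ij jm; have [t et] := e_surj i j ij jm.
have -> : i = (e t).1 by rewrite et.
have -> : j = (e t).2 by rewrite et.
rewrite (bigD1 t) //= FE eqxx mulr1 big1 ?addr0 ?subrr // => t' tt'.
by rewrite FE (negbTE tt') mulr0.
Qed.

Lemma dim_Q_invariant_quotient_H1 :
  dim_quotient_eq (Q_invariant R N)
    (subspace_sum (H1_invariant R N) (Q_restriction R N)) 1%N.
Proof.
have [eu euQ euF] := @euler_form R G l l_gt1 a b pres.
have euF' : has_form x m eu (fun i j => delta 0%N l i j - delta l 0%N i j).
  by apply: has_form_ext euF _ => i j _ _; rewrite [(j == 0%N) && _]andbC.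
split.
  by move=> _ [h hH [r rR ->]]; apply: Q_invariantD; [exact: H1_Q|exact: Q_restriction_invariant].
exists (fun=> eu); split=> [//|c [h hH [r rR ce]] t|v vQ].
  (* The sum over the handles vanishes on the form of [h], the form of a restriction is zero, and
     [c ord0 *: eu] has sum [c ord0]: only the handle 0 contributes. *)
  have [w hw] := has_form_exists x m (H1_Q hH).
  have := has_formD hw (Q_restriction_form x rR); rewrite -ce big_ord1 => e1.
  have e2 := has_formZ (c ord0) euF'.
  rewrite (ord1 t) -[RHS](H1_form_sum hH hw) (bigD1 (Ordinal (ltnW l_gt1))) //= big1 => [|i i0].
    rewrite addr0 addn0 -[RHS]addr0.
    have lm : (l < m)%N by lia.
    have zm : (0 < m)%N by lia.
    rewrite -(has_form_unique e2 e1 zm lm) !eqxx /=.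
    have -> : (0%N == l) = false by lia.
    by rewrite subr0 mulr1.
  have im : (i < m)%N by have := ltn_ord i; lia.
  have lim : (l + i < m)%N by have := ltn_ord i; lia.
  have := has_form_unique e2 e1 im lim; rewrite addr0 => <-.
  have -> : (i == 0%N :> nat) = false by apply/negbTE; apply: contra i0.
  have -> : ((i : nat) == l) = false by have := ltn_ord i; lia.
  by rewrite /= subrr mulr0.
have [w vw] := has_form_exists x m vQ.
have [h hH hF] := alternate_realized w euF'.
exists (fun=> \sum_(i < l) w i (l + i)%N); rewrite big_ord1.
exists h => //; exists (v - (h + (\sum_(i < l) w i (l + i)%N) *: eu)); last first.
  by rewrite opprD [RHS]addrCA [h + (- h - _)]addrA subrr add0r.
apply: restriction_criterion (has_formB vw hF) _.
  by apply: Q_invariantB => //; apply: Q_invariantD (H1_Q hH) (Q_invariantZ _ euQ).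
move=> i j ij jm; rewrite (alternate_form vQ vw) ?subrr //; exact: ltn_trans jm.
Qed.

End Dimensions.

Theorem theorem1p1 (R : realType) (l : nat) (l_gt1 : (1 < l)%N)
    (x : surface R l) :
  let G := pi1 R x in
  let N := commutator_group G in
  dim_quotient_eq (Q_invariant R N) (Q_restriction R N) (l * (2 * l - 1))%N /\
  dim_quotient_eq (Q_invariant R N)
    (subspace_sum (H1_invariant R N) (Q_restriction R N)) 1%N.
Proof.
have [a [b pres]] := pi1_presentation (ltnW l_gt1) x; split.
  exact: (@dim_Q_invariant_quotient R _ l l_gt1 a b pres).
exact: (@dim_Q_invariant_quotient_H1 R _ l l_gt1 a b pres).
Qed.
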